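(* Let $n\ge 3$. For Monge--Ampère systems with Lagrangian pairs on contact manifolds of dimension $2n+1$, the property of being a Hesse Monge--Ampère system (resp. of being an Euler--Lagrange Monge--Ampère system) depends only on the Monge--Ampère system and does not depend on the choice of the Lagrangian pair of the Monge--Ampère system. The class of Hesse Monge--Ampère systems (resp. the class of Euler--Lagrange Monge--Ampère systems) is invariant under contact transformations: if $\Phi:(M,D)\to(M',D')$ is a contactomorphism and $\mathcal M$ is a Hesse (resp. Euler--Lagrange) Monge--Ampère system on $(M,D)$, then $(\Phi^{-1})^*\mathcal M$ is a Hesse (resp. Euler--Lagrange) Monge--Ampère system on $(M',D')$.
   Context: All objects are $C^\infty$. A contact structure $D$ on a manifold $M$ of dimension $2n+1$ is a subbundle of $TM$ of codimension one, locally $D=\{\theta=0\}$ for a $1$-form $\theta$ (a contact form) such that $d\theta|_D$ is non-degenerate. A Lagrangian pair $(E_1,E_2)$ is a pair of rank-$n$ subbundles of $D$, each isotropic for $d\theta$, with $D=E_1\oplus E_2$. A Monge--Ampère system $\mathcal M$ on $(M,D)$ is an exterior differential system which is locally the ideal $\langle\theta,d\theta,\omega\rangle$ generated algebraically by a contact form $\theta$, $d\theta$ and an $n$-form $\omega$ (a local generator). It is a (bi-decomposable) Monge--Ampère system with Lagrangian pair $(E_1,E_2)$ if around each point there is a local generator $\omega=\omega_1-\omega_2$ (a bi-decomposable form) with $n$-forms $\omega_1,\omega_2$ satisfying the bi-decomposing condition: $i_u\omega_1=0$ for $u\in E_2$, $i_v\omega_2=0$ for $v\in E_1$, $\omega_1|_{E_1}$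 is a volume form on $E_1$ and $\omega_2|_{E_2}$ is a volume form on $E_2$. The standard Lagrangian pair on $\mathbf R^{2n+1}$ with coordinates $(x_1,\dots,x_n,z,p_1,\dots,p_n)$ and contact structure $D_{\rm st}=\{dz-\sum p_idx_i=0\}$ is $E_1^{\rm st}=\{v\in D_{\rm st}:dp_1(v)=\dots=dp_n(v)=0\}$, $E_2^{\rm st}=\{u\in D_{\rm st}:dx_1(u)=\dots=dx_n(u)=0\}$. A Lagrangian pair is flat if it is locally contactomorphic to $(E_1^{\rm st},E_2^{\rm st})$ on $(\mathbf R^{2n+1},D_{\rm st})$. A Hesse Monge--Ampère system is a Monge--Ampère system with a flat Lagrangian pair. A Hesse Monge--Ampère system is an Euler--Lagrange Monge--Ampère system if it is locally generated by a bi-decomposable $n$-form $\omega=\omega_1-\omega_2$ satisfying $d\omega_1\equiv 0$ and $d\omega_2\equiv0$ mod $\theta$. *)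

(* Defs.v *)
From HB Require Import structures.
From mathcomp Require Import all_boot all_order all_algebra all_fingroup.
From mathcomp Require Import all_classical all_reals all_analysis.

Set Implicit Arguments.
Unset Strict Implicit.
Unset Printing Implicit Defensive.

Import Order.TTheory GRing.Theory Num.Theory numFieldNormedType.Exports.

Local Open Scope classical_set_scope.
Local Open Scope ring_scope.

Section Smooth.
Context {R : realType}.

Fixpoint Ck {m} (k : nat) (U : set 'rV[R]_m) (f : 'rV[R]_m -> R) : Prop :=
  match k with
  | 0%N => forall x, U x -> {for x, continuous f}
  | k'.+1 => (forall x, U x -> differentiable f x) /\
             (forall v, Ck k' U ('D_v f))
  end.

Definition smooth {m} (U : set 'rV[R]_m) (f : 'rV[R]_m -> R) : Prop :=
  forall k, Ck k U f.

Definition smooth_map {m l} (U : set 'rV[R]_m) (f : 'rV[R]_m -> 'rV[R]_l) :=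
  forall j, smooth U (fun y => f y 0 j).

Lemma Ck_cst m k (U : set 'rV[R]_m) (a : R) : Ck k U (fun=> a).
Proof.
elim: k a => [|k IHk] a /=; first by move=> x _; exact: cst_continuous.
split=> [x _|v]; first exact: differentiable_cst.
rewrite (_ : 'D_v (fun=> a) = fun=> 0) //.
by apply/funext => x; exact: derive_cst.
Qed.

Lemma smooth_map_id m (U : set 'rV[R]_m) : smooth_map U id.
Proof.
move=> j [|k] /=; first by move=> x _; exact: coord_continuous.
split=> [x _|v]; first exact: differentiable_coord.
rewrite (_ : 'D_v _ = fun=> v 0 j); first exact: Ck_cst.
apply/funext => x.
have dx : differentiable (fun y : 'rV[R]_m => y 0 j) x.
  exact: differentiable_coord.
rewrite deriveE //.
have lin : linear (fun y : 'rV[R]_m => y 0 j : R).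
  by move=> a y z; rewrite !mxE.
pose L := HB.pack (fun y : 'rV[R]_m => y 0 j : R)
  (GRing.isLinear.Build _ _ _ _ _ lin) : {linear 'rV[R]_m -> R}.
by rewrite (_ : 'd _ x = L :> (_ -> _)) //;
  apply: (@diff_lin _ _ _ L); exact: coord_continuous.
Qed.

End Smooth.

(* [cfun] and [cinv] are total; only their values on [cdom] and on
   [cfun @` cdom] are meaningful. *)
Record chart (R : realType) (m : nat) (T : topologicalType) := Chart {
  cdom : set T;
  cfun :> T -> 'rV[R]_m;
  cinv : 'rV[R]_m -> T;
  open_cdom : open cdom;
  open_cimage : open (cfun @` cdom);
  cfunK : forall p, cdom p -> cinv (cfun p) = p;
  cfun_continuous : forall p, cdom p -> {for p, continuous cfun};
  cinv_continuous : forall y, (cfun @` cdom) y -> {for y, continuous cinv} }.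

(* The atlas is not required to be maximal.  [chart_at p] is a preferred chart
   around [p]: it serves to identify the tangent space at [p] with 'rV[R]_m. *)
Record manifold (R : realType) (m : nat) := Manifold {
  mpoint :> topologicalType;
  atlas : set (chart R m mpoint);
  chart_at : mpoint -> chart R m mpoint;
  atlas_chart_at : forall p, atlas (chart_at p);
  cdom_chart_at : forall p, cdom (chart_at p) p;
  smooth_transition : forall c c', atlas c -> atlas c' ->
    smooth_map (c @` (cdom c `&` cdom c')) (c' \o cinv c);
  manifold_hausdorff : hausdorff_space mpoint;
  manifold_second_countable : @second_countable mpoint }.

Arguments atlas {R m} M : rename.
Arguments chart_at {R m} M p : rename.

Section EuclideanSpace.
Context (R : realType) (m : nat).

Lemma rV_hausdorff : hausdorff_space 'rV[R]_m.
Proof. exact: norm_hausdorff. Qed.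

Lemma rV_second_countable : @second_countable 'rV[R]_m.
Proof.
pose b (i : 'rV[rat]_m * nat) : set 'rV[R]_m :=
  ball (map_mx ratr i.1 : 'rV[R]_m) (i.2.+1%:R^-1 : R).
exists (range b).
  exact: (card_le_trans (card_image_le b setT) (countableP setT)).
split=> [_ [i _ <-]|x N]; first exact: ball_open.
move=> /nbhs_ballP[e /= e0 xN].
have e20 : 0 < e / 2 by rewrite divr_gt0.
have [k ke] : exists k, (k.+1%:R^-1 : R) < e / 2.
  have [k _ hk] := near_infty_natSinv_lt (PosNum e20).
  by exists k; exact: (hk k (leqnn k)).
have k0 : 0 < (k.+1%:R^-1 : R) by rewrite invr_gt0.
have rat_near j : exists q : rat, `|ratr q - x 0 j| < k.+1%:R^-1.
  have /rat_in_itvoo[q] : x 0 j < x 0 j + k.+1%:R^-1 by rewrite ltrDl.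
  rewrite in_itv /= => /andP[q1 q2].
  by exists q; rewrite gtr0_norm ?subr_gt0// ltrBlDl.
pose q : 'rV[rat]_m := \row_j xchoose (rat_near j).
have qx i j : `|ratr (q i j) - x i j| < k.+1%:R^-1.
  by rewrite (ord1 i) mxE; exact: (xchooseP (rat_near j)).
exists (b (q, k)).
  split; first by exists (q, k).
  by rewrite /b /=; split=> // i j; rewrite mxE /ball/=; exact: qx.
move=> y [_ qy]; apply: xN; split=> // i j; rewrite /ball/=.
have := qy i j; rewrite mxE /ball/= => qy'.
rewrite -(subrKA (ratr (q i j))) (splitr e).
apply: (le_lt_trans (ler_normD _ _)); apply: ltrD.
  by rewrite distrC; exact: lt_trans (qx i j) ke.
exact: lt_trans qy' ke.
Qed.

Lemma open_id_image : open ((id : 'rV[R]_m -> 'rV[R]_m) @` setT).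
Proof. by rewrite image_id; exact: openT. Qed.

Definition id_chart : chart R m 'rV[R]_m :=
  @Chart R m 'rV[R]_m setT id id openT open_id_image
    (fun _ _ => erefl) (fun _ _ => @cvg_id _ _) (fun _ _ => @cvg_id _ _).

Lemma id_transition (c c' : chart R m 'rV[R]_m) :
  [set id_chart] c -> [set id_chart] c' ->
  smooth_map (c @` (cdom c `&` cdom c')) (c' \o cinv c).
Proof. by move=> -> ->; exact: smooth_map_id. Qed.

Definition euclidean : manifold R m :=
  @Manifold R m 'rV[R]_m [set id_chart] (fun=> id_chart) (fun=> erefl)
    (fun=> I) id_transition rV_hausdorff rV_second_countable.

End EuclideanSpace.

Definition smooth_on {R : realType} {m m' : nat} {M : manifold R m}
    {M' : manifold R m'} (U : set M) (f : M -> M') : Prop :=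
  (forall p, U p -> {for p, continuous f}) /\
  (forall c c', atlas M c -> atlas M' c' ->
     smooth_map (c @` (cdom c `&` U `&` f @^-1` cdom c')) (c' \o f \o cinv c)).

Definition diffeo_on {R : realType} {m m' : nat} {M : manifold R m}
    {M' : manifold R m'} (U : set M) (V : set M')
    (f : M -> M') (g : M' -> M) : Prop :=
  [/\ open U, open V, smooth_on U f & smooth_on V g] /\
  [/\ (forall p, U p -> V (f p)), (forall q, V q -> U (g q)),
      (forall p, U p -> g (f p) = p) & (forall q, V q -> f (g q) = q)].

(* Tangent vectors are row vectors: df_p(v) is [v *m tangent_map f p]. *)
Definition tangent_map {R : realType} {m m' : nat} {M : manifold R m}
    {M' : manifold R m'} (f : M -> M') (p : M) : 'M[R]_(m, m') :=
  jacobian (chart_at M' (f p) \o f \o cinv (chart_at M p)) (chart_at M p p).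

(* df_p(A) = B for subspaces A of T_p M and B of T_(f p) M' *)
Definition tangent_onto {R : realType} {m m' : nat} {M : manifold R m}
    {M' : manifold R m'} (f : M -> M') (p : M)
    (A : set 'rV[R]_m) (B : set 'rV[R]_m') : Prop :=
  [set v *m tangent_map f p | v in A] = B.

(* A k-tuple of vectors is the k x m matrix having them as rows. *)
Definition alternating {R : realType} {m k : nat} (w : 'M[R]_(k, m) -> R) :=
  (forall (A B C : 'M[R]_(k, m)) (i : 'I_k) (b c : R),
     row i A = b *: row i B + c *: row i C ->
     row' i B = row' i A -> row' i C = row' i A ->
     w A = b * w B + c * w C) /\
  (forall (A : 'M[R]_(k, m)) (i j : 'I_k),
     i != j -> row i A = row j A -> w A = 0).

(* A k-form on an open subset U of M is represented by a total function whose
   values outside U are irrelevant. *)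
Definition dform {R : realType} {m : nat} (M : manifold R m) (k : nat) : Type :=
  M -> 'M[R]_(k, m) -> R.

Definition plane_field {R : realType} {m : nat} (M : manifold R m) : Type :=
  M -> set 'rV[R]_m.

Section Tensors.
Context {R : realType} {m : nat} {M : manifold R m}.
Implicit Types (c : chart R m M) (U : set M).

(* The matrix turning the components at [p] of a tangent vector (those in
   [chart_at M p]) into its components in the chart [c]. *)
Definition to_chart c (p : M) : 'M[R]_m :=
  jacobian (c \o cinv (chart_at M p)) (chart_at M p p).

Definition from_chart c (p : M) : 'M[R]_m :=
  jacobian (chart_at M p \o cinv c) (c p).

Definition local_form {k} c (w : dform M k) (y : 'rV[R]_m)
    (v : 'M[R]_(k, m)) : R :=
  w (cinv c y) (v *m from_chart c (cinv c y)).

Definition smooth_form {k} U (w : dform M k) : Prop :=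
  (forall p, U p -> alternating (w p)) /\
  (forall c v, atlas M c ->
     smooth (c @` (cdom c `&` U)) (fun y => local_form c w y v)).

Definition eq_form_on {k} U (a b : dform M k) : Prop :=
  forall p v, U p -> a p v = b p v.

Definition zero_form {k} : dform M k := fun _ _ => 0.

Definition add_form {k} (a b : dform M k) : dform M k :=
  fun p v => a p v + b p v.

Definition sub_form {k} (a b : dform M k) : dform M k :=
  fun p v => a p v - b p v.

Definition wedge {k l} (a : dform M k) (b : dform M l) : dform M (k + l) :=
  fun p v => (k`! * l`!)%:R^-1 *
    \sum_(s : 'S_(k + l)) (-1) ^+ s *
      a p (usubmx (row_perm s v)) * b p (dsubmx (row_perm s v)).

(* dw(v_0,..,v_k) = sum_i (-1)^i D_(v_i) w(v_0,..,v_(i-1),v_(i+1),..,v_k) for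
   vector fields v_i that are constant in the preferred chart. *)
Definition ext_d {k} (w : dform M k) : dform M k.+1 :=
  fun p v => \sum_(i < k.+1) (-1) ^+ i *
    'D_(row i v) (fun y => local_form (chart_at M p) w y (row' i v))
      (chart_at M p p).

(* [D] is a smooth subbundle of rank [r] of the tangent bundle; the rows of
   [X q] are a local frame. *)
Definition subbundle (r : nat) (D : plane_field M) : Prop :=
  forall p, exists (U : set M) (X : M -> 'M[R]_(r, m)),
    [/\ open U, U p,
        (forall q, U q -> row_free (X q) /\ D q = [set v | (v <= X q)%MS])
      & (forall c i, atlas M c ->
           smooth_map (c @` (cdom c `&` U))
             (fun y => row i (X (cinv c y) *m to_chart c (cinv c y))))].

End Tensors.

Definition pullback {R : realType} {m m' : nat} {M : manifold R m}
    {M' : manifold R m'} {k : nat} (f : M -> M') (w : dform M' k) : dform M k :=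
  fun p v => w (f p) (v *m tangent_map f p).

(* [graded_forms] holds, for each degree, a set of forms over a fixed open set;
   in [form_sheaf] the open set varies. *)
Definition graded_forms {R : realType} {m : nat} (M : manifold R m) : Type :=
  forall k, set (dform M k).

Definition form_sheaf {R : realType} {m : nat} (M : manifold R m) : Type :=
  set M -> graded_forms M.

Section ExteriorDifferentialSystems.
Context {R : realType} {m : nat} {M : manifold R m}.

(* Homogeneous (two-sided) ideals of the algebra of smooth forms on [U]; forms
   that agree on [U] are identified. *)
Definition ideal_on (U : set M) (J : graded_forms M) : Prop :=
  [/\ (forall k (a : dform M k), J k a -> smooth_form U a),
      (forall k (a b : dform M k),
         J k a -> smooth_form U b -> eq_form_on U a b -> J k b),
      (forall k, J k zero_form),
      (forall k (a b : dform M k), J k a -> J k b -> J k (add_form a b))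
    & (forall k l (a : dform M k) (b : dform M l), J k a -> smooth_form U b ->
         J (k + l)%N (wedge a b) /\ J (l + k)%N (wedge b a))].

(* The ideal of forms on [U] generated algebraically by t, dt and w. *)
Definition ideal_gen {n} (U : set M) (t : dform M 1) (w : dform M n) :
    graded_forms M := fun k a =>
  forall J, ideal_on U J ->
    J 1%N t -> J 2%N (ext_d t) -> J n w -> J k a.

(* A sheaf of homogeneous differential ideals; only the values of the sheaf on
   open sets matter. *)
Definition eds (I : form_sheaf M) : Prop :=
  [/\ (forall U, open U -> ideal_on U (I U)),
      (forall U k (a : dform M k), open U -> I U k a -> I U k.+1 (ext_d a)),
      (forall U V k (a : dform M k),
         open U -> open V -> V `<=` U -> I U k a -> I V k a)
    & (forall U k (a : dform M k), open U ->
         (forall p, U p -> exists V, [/\ open V, V p, V `<=` U & I V k a]) ->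
         I U k a)].

End ExteriorDifferentialSystems.

Arguments ideal_gen {R m M n} U t w k a.

(* The image (f^-1)^* I of [I] under the diffeomorphism [f] with inverse [g]. *)
Definition transport {R : realType} {m m' : nat} {M : manifold R m}
    {M' : manifold R m'} (f : M -> M') (g : M' -> M) (I : form_sheaf M) :
    form_sheaf M' := fun W k b =>
  exists2 a : dform M k, I (f @^-1` W) k a & eq_form_on W b (pullback g a).

Section Contact.
Context {R : realType} {n : nat} {M : manifold R (2 * n).+1}.
Implicit Types (D E : plane_field M) (U : set M) (t : dform M 1).

Definition contact_form D U t : Prop :=
  [/\ open U, smooth_form U t,
      (forall q, U q -> D q = [set v | t q v = 0])
    & (forall q u, U q -> D q u ->
         (forall v, D q v -> ext_d t q (col_mx u v) = 0) -> u = 0)].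

Definition contact_structure D : Prop :=
  subbundle (2 * n) D /\
  (forall p, exists U t, U p /\ contact_form D U t).

Definition isotropic D E : Prop :=
  forall U t, contact_form D U t ->
    forall q u v, U q -> E q u -> E q v -> ext_d t q (col_mx u v) = 0.

Definition direct_sum D E1 E2 : Prop := forall q,
  D q = [set v1 + v2 | v1 in E1 q & v2 in E2 q] /\ E1 q `&` E2 q = [set 0].

Definition lagrangian_pair D E1 E2 : Prop :=
  [/\ subbundle n E1, subbundle n E2, isotropic D E1, isotropic D E2
    & direct_sum D E1 E2].

End Contact.

Definition contactomorphism {R : realType} {n : nat}
    {M M' : manifold R (2 * n).+1} (D : plane_field M) (D' : plane_field M')
    (f : M -> M') (g : M' -> M) : Prop :=
  diffeo_on setT setT f g /\ forall p, tangent_onto f p (D p) (D' (f p)).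

(* R^(2n+1) with coordinates (x, z, p) in blocks of sizes n, 1 and n.  The chart
   of [euclidean] is the identity, so tangent vectors have the same blocks. *)
Section StandardModel.
Context (R : realType) (n : nat).

Definition std_space : manifold R (n + (1 + n)) := euclidean R (n + (1 + n)).

Definition xpart (y : 'rV[R]_(n + (1 + n))) : 'rV[R]_n := lsubmx y.
Definition zpart (y : 'rV[R]_(n + (1 + n))) : R := lsubmx (rsubmx y) 0 0.
Definition ppart (y : 'rV[R]_(n + (1 + n))) : 'rV[R]_n := rsubmx (rsubmx y).

Definition D_std : plane_field std_space := fun y =>
  [set v | zpart v - \sum_(i < n) ppart y 0 i * xpart v 0 i = 0].

Definition E1_std : plane_field std_space := fun y =>
  [set v | D_std y v /\ ppart v = 0].

Definition E2_std : plane_field std_space := fun y =>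
  [set u | D_std y u /\ xpart u = 0].

End StandardModel.

Section MongeAmpere.
Context {R : realType} {n : nat} {M : manifold R (2 * n).+1}.
Variables (D : plane_field M) (I : form_sheaf M).
Arguments I : clear implicits.
Implicit Types (E : plane_field M) (U : set M).

Definition generated_on U (t : dform M 1) (w : dform M n) : Prop :=
  forall V, open V -> V `<=` U ->
  forall k (a : dform M k), I V k a <-> ideal_gen V t w k a.

(* [U] is the domain of the contact form, hence open. *)
Definition local_generator U (t : dform M 1) (w : dform M n) : Prop :=
  [/\ contact_form D U t, smooth_form U w & generated_on U t w].

Definition monge_ampere : Prop :=
  eds I /\ (forall p, exists U t w, U p /\ local_generator U t w).

(* i_u w = 0 at [q]: w vanishes as soon as its first argument is u. *)
Definition interior_zero (q : M) (u : 'rV[R]_(2 * n).+1) (w : dform M n) :=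
  forall (v : 'M[R]_(n, (2 * n).+1)) (i : 'I_n),
    i = 0%N :> nat -> row i v = u -> w q v = 0.

(* A form of top degree on the n-dimensional space [E q] is a volume form when
   it is not identically zero. *)
Definition volume_on (q : M) E (w : dform M n) : Prop :=
  exists v : 'M[R]_(n, (2 * n).+1),
    (forall i, E q (row i v)) /\ w q v != 0.

Definition bi_decomposing U E1 E2 (w1 w2 : dform M n) : Prop :=
  [/\ smooth_form U w1, smooth_form U w2
    & forall q, U q ->
      [/\ (forall u, E2 q u -> interior_zero q u w1),
          (forall v, E1 q v -> interior_zero q v w2),
          volume_on q E1 w1 & volume_on q E2 w2]].

Definition monge_ampere_pair E1 E2 : Prop :=
  [/\ monge_ampere, lagrangian_pair D E1 E2
    & forall p, exists U t w1 w2,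
        [/\ U p, local_generator U t (sub_form w1 w2)
          & bi_decomposing U E1 E2 w1 w2]].

Definition flat E1 E2 : Prop :=
  forall p, exists (U : set M) (V : set (std_space R n))
    (f : M -> std_space R n) (g : std_space R n -> M),
    [/\ U p, diffeo_on U V f g
      & forall q, U q ->
        [/\ tangent_onto f q (D q) (D_std (f q)),
            tangent_onto f q (E1 q) (E1_std (f q))
          & tangent_onto f q (E2 q) (E2_std (f q))]].

Definition hesse_pair E1 E2 : Prop := monge_ampere_pair E1 E2 /\ flat E1 E2.

(* a = 0 mod t on [U], i.e. a lies in the ideal generated by t *)
Definition zero_mod U (t : dform M 1) (a : dform M n.+1) : Prop :=
  exists2 b : dform M n, smooth_form U b & eq_form_on U a (wedge t b).

Definition euler_lagrange_pair E1 E2 : Prop :=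
  hesse_pair E1 E2 /\
  forall p, exists U t w1 w2,
    [/\ U p, local_generator U t (sub_form w1 w2),
        bi_decomposing U E1 E2 w1 w2,
        zero_mod U t (ext_d w1) & zero_mod U t (ext_d w2)].

Definition hesse : Prop := exists E1 E2, hesse_pair E1 E2.

Definition euler_lagrange : Prop := exists E1 E2, euler_lagrange_pair E1 E2.

End MongeAmpere.

(* Main.v *)
(** Invariance under a contactomorphism is naturality: every ingredient of the
    definitions (ideals, contact forms, Lagrangian pairs, bi-decomposing forms,
    flat charts) is carried along by pullback.  The one analytic point is that
    pullback commutes with the exterior derivative, which rests on the chain
    rule and on the symmetry of second derivatives.

    Independence of the Lagrangian pair is a statement about one tangent space.
    On tuples that are isotropic for the symplectic form, the elements of degree
    n of the ideal generated by t, dt and w are multiples of w, so that any two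
    local generators have the same zeros among the Lagrangian planes.  In
    symplectic coordinates adapted to (E1, E2) a generator sends the plane
    spanned by the rows of (X | P) to a det X - b det P.  Let L be a member of
    another pair and (x, p) a vector of L.  If x.p <> 0, then because n >= 3
    the graph of a symmetric matrix of rank at most two is a Lagrangian plane
    that meets both members of the other pair, hence is a zero, although exactly
    one of its two determinants vanishes.  So x.p = 0 on L, whence L is the sum
    of its intersections with E1 and E2; if both were nonzero, L itself would be
    a zero.  Thus L is E1 or E2, and the two pairs agree up to order at every
    point.  By continuity the order is locally constant.  An exchange replaces
    the generator w by -w and is absorbed, for flatness, by the Legendre
    transformation of the standard model. *)

Require Import Defs.
From HB Require Import structures.
From mathcomp Require Import all_boot all_order all_algebra all_fingroup.
From mathcomp Require Import all_classical all_reals all_analysis.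
From mathcomp Require Import ring.

Set Implicit Arguments.
Unset Strict Implicit.
Unset Printing Implicit Defensive.

Import Order.TTheory GRing.Theory Num.Theory numFieldNormedType.Exports.
(* mathcomp also defines [alternating]. *)
Import Defs.

Local Open Scope classical_set_scope.
Local Open Scope ring_scope.

(** * Smooth functions of several variables *)

Section Differentiability.
Context {R : realType}.

(** The bound n >= 3 enters twice. The differential of a second contact form has degree 2 < n, where
    the ideal comes from t and dt alone; so it vanishes on every tuple isotropic for the first
    contact form, and both generators can be compared on the same tuples. And a symmetric n x n
    matrix of rank at most two is singular, so that on its graph the generator takes the value a * 1
    - b * 0, which is not zero.

    The number x.p is, up to a factor, the quadratic form of a neutral metric on E1 + E2. On a
    Lagrangian plane x.q = y.p; if the form vanishes there, then also x.q + y.p = 0, so (x, 0) and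
    (0, p) are orthogonal to the plane and belong to it by maximality. This is what splits the
    plane.

    On the analytic side the obstacle is that components of tangent vectors refer to a preferred
    chart, which may jump from point to point. Statements about smoothness or continuity are
    therefore rewritten in one fixed chart, while the algebra at a single point uses preferred
    components. *)

Lemma near_eq_differentiable (V W : normedModType R) (f g : V -> W) (x : V) :
  {near x, f =1 g} -> differentiable f x -> differentiable g x.
Proof.
move=> fg df.
(* The difference vanishes near [x], so it is its value plus o(id) with the zero map as
   differential; [g] is then a sum of differentiable maps. *)
suff d0 : differentiable (g - f) x.
  by rewrite -[g](subrK f); exact: differentiableD.
have h0 : {near x, (g - f : V -> W) =1 cst 0}.
  by near=> y; rewrite /= !fctE (near fg y) ?subrr//; near: y.
have hx : (g - f) x = 0 by exact: (nbhs_singleton h0).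
have H : (g - f) \o shift x = cst ((g - f) x) + (0 : V -> W) +o_ 0 id.
  rewrite hx; apply/eqaddoP => e e0.
  have : \forall y \near 0, (g - f) (y + x) = 0.
    by move: h0; rewrite (near_shift 0) subr0.
  apply: filterS => y yE.
  have -> : ((g - f) \o shift x - (cst 0 + 0)) y = 0 :> W.
    by rewrite !fctE /= -[LHS]/((g - f) (y + x) - (0 + 0)) yE addr0 subrr.
  by rewrite normr0 mulr_ge0// ltW.
have c0 : continuous (\0 : V -> W) by exact: cst_continuous.
have dE : 'd (g - f) x = (\0 : V -> W) :> (V -> W).
  exact: (@diff_unique R V W (g - f) \0 x c0 H).
by apply/diff_locallyP; split; rewrite dE //; exact: c0.
Unshelve. all: by end_near. Qed.

Lemma near_eq_diff (V W : normedModType R) (f g : V -> W) (x : V) :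
  {near x, f =1 g} -> differentiable f x -> 'd f x = 'd g x :> (V -> W).
Proof.
move=> fg df; have dg := near_eq_differentiable fg df.
by apply/funext => v; rewrite -!deriveE//; exact: near_eq_derive.
Qed.

End Differentiability.

Section SmoothCalculus.
Context {R : realType}.

Lemma differentiable_rV (V : normedModType R) n (f : V -> 'rV[R]_n) x :
  (forall j, differentiable (fun y => f y 0 j : R) x) -> differentiable f x.
Proof.
move=> df.
have -> : f = \sum_(j < n) (fun y => f y 0 j *: (delta_mx 0 j : 'rV[R]_n)).
  by apply/funext => y; rewrite fct_sumE [LHS]row_sum_delta.
by apply: differentiable_sum => j; apply: differentiableZl.
Qed.

Lemma derive_rV (V : normedModType R) n (f : V -> 'rV[R]_n) x v :
  differentiable f x -> 'D_v f x = \row_j 'D_v (fun y => f y 0 j : R) x.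
Proof.
move=> df; rewrite derive_mx; last exact: diff_derivable.
by apply/rowP => j; rewrite !mxE.
Qed.

Lemma derive_rV_coord n (W : normedModType R) (f : 'rV[R]_n -> W) x v :
  differentiable f x -> 'D_v f x = \sum_j v 0 j *: 'D_('e_j) f x.
Proof.
move=> df; rewrite deriveE// {1}[v]row_sum_delta linear_sum.
by apply: eq_bigr => j _; rewrite linearZ/= deriveE.
Qed.

Lemma derive_comp_rV m n (W : normedModType R) (f : 'rV[R]_m -> 'rV[R]_n)
    (g : 'rV[R]_n -> W) x v :
  differentiable f x -> differentiable g (f x) ->
  'D_v (g \o f) x = \sum_j 'D_v (fun y => f y 0 j : R) x *: 'D_('e_j) g (f x).
Proof.
move=> df dg; rewrite deriveE; last exact: differentiable_comp.
rewrite diff_comp//= -deriveE// -deriveE// derive_rV_coord//.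
by apply: eq_bigr => j _; rewrite derive_rV// mxE.
Qed.

Variable m : nat.
Implicit Types (U V : set 'rV[R]_m) (f g : 'rV[R]_m -> R).

Lemma nbhs_open_eq (T : topologicalType) (S : Type) (U : set T) (f g : T ->
  S) x :
  open U -> U x -> (forall y, U y -> f y = g y) -> {near x, f =1 g}.
Proof. by move=> oU Ux fg; apply: (filterS fg); exact: open_nbhs_nbhs. Qed.

Lemma Ck_ext k U f g :
  open U -> (forall x, U x -> f x = g x) -> Ck k U f -> Ck k U g.
Proof.
move=> oU; elim: k f g => [|k IHk] f g fg /=.
  move=> cf x Ux; rewrite /prop_for /continuous_at -fg//.
  apply: cvg_trans (cf x Ux).
  by apply: (@near_eq_cvg _ _ (nbhs x)); exact: (nbhs_open_eq oU Ux fg).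
move=> [df Df]; split=> [x Ux|v].
  exact: near_eq_differentiable (nbhs_open_eq oU Ux fg) (df x Ux).
apply: IHk (Df v) => x Ux.
by apply: near_eq_derive; exact: (nbhs_open_eq oU Ux fg).
Qed.

Lemma Ck_sub k U V f : V `<=` U -> Ck k U f -> Ck k V f.
Proof.
move=> VU; elim: k f => [|k IHk] f /=; first by move=> cf x /VU; exact: cf.
by move=> [df Df]; split=> [x /VU|v]; [exact: df|exact: IHk].
Qed.

(** Each clause of [Ck] is imposed point by point on derivatives of one total function, so it can be
    checked separately at every point. *)
Lemma Ck_local k U f :
  (forall x, U x -> exists2 V, V x & Ck k V f) -> Ck k U f.
Proof.
elim: k f => [|k IHk] f /= Uf.
  by move=> x /Uf[V Vx]; apply.
split=> [x /Uf[V Vx []]|v]; first by move=> + _; apply.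
by apply: IHk => x /Uf[V Vx [_ Df]]; exists V.
Qed.

Lemma CkS k U f : Ck k.+1 U f -> Ck k U f.
Proof.
elim: k f => [|k IHk] f /= [df Df].
  by move=> x Ux; exact/differentiable_continuous/df.
by split=> // v; apply: IHk; exact: Df.
Qed.

Lemma CkD k U f g : open U -> Ck k U f -> Ck k U g -> Ck k U (f + g).
Proof.
move=> oU; elim: k f g => [|k IHk] f g /=.
  by move=> cf cg x Ux; apply: continuousD; [exact: cf|exact: cg].
move=> [df Df] [dg Dg]; split=> [x Ux|v].
  by apply: differentiableD; [exact: df|exact: dg].
apply: Ck_ext (IHk _ _ (Df v) (Dg v)) => // x Ux.
by rewrite deriveD//; apply: diff_derivable; [exact: df|exact: dg].
Qed.

Lemma CkM k U f g : open U -> Ck k U f -> Ck k U g -> Ck k U (f * g).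
Proof.
move=> oU; elim: k f g => [|k IHk] f g.
  by move=> cf cg x Ux; apply: continuousM; [exact: cf|exact: cg].
move=> Cf Cg; have [df Df] := Cf; have [dg Dg] := Cg; split=> [x Ux|v].
  by apply: differentiableM; [exact: df|exact: dg].
have := CkD oU (IHk _ _ (CkS Cf) (Dg v)) (IHk _ _ (CkS Cg) (Df v)).
apply: Ck_ext => // x Ux.
by rewrite deriveM//; apply: diff_derivable; [exact: df|exact: dg].
Qed.

Lemma smooth_cst U (a : R) : smooth U (fun=> a).
Proof. by move=> k; exact: Ck_cst. Qed.

Lemma smooth_ext U f g :
  open U -> (forall x, U x -> f x = g x) -> smooth U f -> smooth U g.
Proof. by move=> oU fg sf k; exact: Ck_ext (sf k). Qed.

Lemma smooth_sub U V f : V `<=` U -> smooth U f -> smooth V f.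
Proof. by move=> VU sf k; exact: Ck_sub (sf k). Qed.

Lemma smooth_local U f :
  (forall x, U x -> exists2 V, V x & smooth V f) -> smooth U f.
Proof.
by move=> Uf k; apply: Ck_local => x /Uf[V Vx sf]; exists V.
Qed.

Lemma smoothD U f g : open U -> smooth U f -> smooth U g ->
  smooth U (fun x => f x + g x).
Proof. by move=> oU sf sg k; exact: CkD. Qed.

Lemma smoothM U f g : open U -> smooth U f -> smooth U g ->
  smooth U (fun x => f x * g x).
Proof. by move=> oU sf sg k; exact: CkM. Qed.

Lemma smooth_sum U I (r : seq I) (P : pred I) (F : I -> 'rV[R]_m -> R) :
  open U -> (forall i, P i -> smooth U (F i)) ->
  smooth U (fun x => \sum_(i <- r | P i) F i x).
Proof.
move=> oU sF; elim: r => [|i r IHr].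
  by apply: smooth_ext (smooth_cst U 0) => // x _; rewrite big_nil.
case Pi : (P i); last by apply: smooth_ext IHr => // x _; rewrite big_cons Pi.
by apply: smooth_ext (smoothD oU (sF i Pi) IHr) => // x _; rewrite big_cons Pi.
Qed.

Lemma smooth_prod U I (r : seq I) (P : pred I) (F : I -> 'rV[R]_m -> R) :
  open U -> (forall i, P i -> smooth U (F i)) ->
  smooth U (fun x => \prod_(i <- r | P i) F i x).
Proof.
move=> oU sF; elim: r => [|i r IHr].
  by apply: smooth_ext (smooth_cst U 1) => // x _; rewrite big_nil.
case Pi : (P i); last by apply: smooth_ext IHr => // x _; rewrite big_cons Pi.
by apply: smooth_ext (smoothM oU (sF i Pi) IHr) => // x _; rewrite big_cons Pi.
Qed.

Lemma smooth_differentiable U f x : smooth U f -> U x -> differentiable f x.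
Proof. by move=> /(_ 1%N)[df _]; exact: df. Qed.

Lemma smooth_continuous U f x : smooth U f -> U x -> {for x, continuous f}.
Proof. by move=> /(_ 0%N); apply. Qed.

Lemma smooth_derive U f v : smooth U f -> smooth U ('D_v f).
Proof. by move=> sf k; have [_] := sf k.+1; apply. Qed.

Lemma smooth_map_differentiable n U (f : 'rV[R]_m -> 'rV[R]_n) x :
  smooth_map U f -> U x -> differentiable f x.
Proof.
move=> sf Ux; apply: differentiable_rV => j.
exact: smooth_differentiable (sf j) Ux.
Qed.

End SmoothCalculus.

Section SmoothComposition.
Context {R : realType} {m n : nat}.
Implicit Types (U : set 'rV[R]_m) (V : set 'rV[R]_n).

(** Induction with the chain rule: a derivative of [g \o f] is a sum of products of derivatives of
    the components of [f] with composites ['D_('e_j) g \o f]. Since [f] is smooth to all orders,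
    only the order of [g] drops. *)
Lemma Ck_comp k U V (f : 'rV[R]_m -> 'rV[R]_n) (g : 'rV[R]_n -> R) :
  open U -> (forall x, U x -> V (f x)) -> smooth_map U f -> Ck k V g ->
  Ck k U (g \o f).
Proof.
move=> oU UV sf; elim: k g => [|k IHk] g.
  move=> cg x Ux; apply: continuous_comp; last exact: (cg _ (UV _ Ux)).
  exact/differentiable_continuous/(smooth_map_differentiable sf Ux).
move=> [dg Dg]; split=> [x Ux|v].
  apply: differentiable_comp; last exact: (dg _ (UV _ Ux)).
  exact: smooth_map_differentiable sf Ux.
have C : Ck k U (\sum_(j < n)
    ('D_v (fun y => f y 0 j : R) * ('D_('e_j) g \o f))).
  elim/big_rec: _ => [|j h _ Ch]; first exact: Ck_cst.
  apply: CkD => //; apply: CkM => //; last exact: IHk (Dg _).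
  exact: (smooth_derive v (sf j) k).
apply: Ck_ext C => // x Ux; rewrite derive_comp_rV; first last.
- exact: (dg _ (UV _ Ux)).
- exact: smooth_map_differentiable sf Ux.
by rewrite fct_sumE.
Qed.

Lemma smooth_comp U V (f : 'rV[R]_m -> 'rV[R]_n) (g : 'rV[R]_n -> R) :
  open U -> (forall x, U x -> V (f x)) -> smooth_map U f -> smooth V g ->
  smooth U (g \o f).
Proof. by move=> oU UV sf sg k; exact: (Ck_comp oU UV sf (sg k)). Qed.

Lemma smooth_map_comp l U V (f : 'rV[R]_m -> 'rV[R]_n)
    (g : 'rV[R]_n -> 'rV[R]_l) :
  open U -> (forall x, U x -> V (f x)) -> smooth_map U f -> smooth_map V g ->
  smooth_map U (g \o f).
Proof. by move=> oU UV sf sg j; exact: (smooth_comp oU UV sf (sg j)). Qed.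

Lemma smooth_jacobian U (f : 'rV[R]_m -> 'rV[R]_n) i j :
  open U -> smooth_map U f -> smooth U (fun y => jacobian f y i j).
Proof.
move=> oU sf; apply: smooth_ext (smooth_derive 'e_i (sf j)) => // x Ux.
rewrite mxE -deriveE; last exact: smooth_map_differentiable sf Ux.
by rewrite derive_rV ?mxE//; exact: smooth_map_differentiable sf Ux.
Qed.

End SmoothComposition.

Section Jacobian.
Context {R : realType}.

Lemma jacobian_comp m n l (f : 'rV[R]_m -> 'rV[R]_n) (g : 'rV[R]_n -> 'rV[R]_l)
    x : differentiable f x -> differentiable g (f x) ->
  jacobian (g \o f) x = jacobian f x *m jacobian g (f x).
Proof.
move=> df dg; apply/row_matrixP => i; rewrite row_mul !rowE !mul_rV_lin1/=.
by rewrite diff_comp//= mul_rV_lin1.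
Qed.

Lemma near_eq_jacobian m n (f g : 'rV[R]_m -> 'rV[R]_n) x :
  {near x, f =1 g} -> differentiable f x -> jacobian f x = jacobian g x.
Proof.
move=> fg df.
have dE := near_eq_diff fg df.
exact: (congr1 (@lin1_mx _ m n) dE).
Qed.

Lemma jacobian_id m (x : 'rV[R]_m) : jacobian id x = 1%:M.
Proof.
apply/row_matrixP => i; rewrite !rowE mul_rV_lin1/= mulmx1.
by rewrite -deriveE// derive_id.
Qed.

End Jacobian.

Section Schwarz.
Context {R : realType} {m : nat}.
Implicit Types (U : set 'rV[R]_m) (f : 'rV[R]_m -> R).

Lemma is_derive_line f (y v : 'rV[R]_m) (s : R) :
  differentiable f (y + s *: v) ->
  is_derive s (1 : R) (fun t => f (y + t *: v)) ('D_v f (y + s *: v)).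
Proof.
move=> df.
have E : (fun h => h^-1 *: (((fun t => f (y + t *: v)) \o shift s) (h *: (1 :
  R))
           - f (y + s *: v))) =
         (fun h => h^-1 *: ((f \o shift (y + s *: v)) (h *: v)
           - f (y + s *: v))).
  by apply/funext => h /=; rewrite [h *: 1]mulr1 scalerDl addrCA.
have /derivableP := @diff_derivable _ _ _ _ _ v df.
by move=> [D1 D2]; split; rewrite /derivable /derive E.
Qed.

Lemma mvt_line f (y v : 'rV[R]_m) (h : R) : 0 < h ->
  (forall s, 0 <= s <= h -> differentiable f (y + s *: v)) ->
  exists2 s, 0 < s < h & f (y + h *: v) - f y = h * 'D_v f (y + s *: v).
Proof.
move=> h0 df.
have [||s sh E] := @MVT R (fun t => f (y + t *: v)) (fun s => 'D_v f (y + s *: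
  v)) 0 h h0.
- move=> s /[!in_itv]/= /andP[s0 sh]; apply: is_derive_line; apply: df.
  by rewrite !ltW.
- apply: derivable_within_continuous => s /[!in_itv]/= sh.
  by have [] := is_derive_line (df s sh).
exists s; first by move: sh; rewrite in_itv.
by move: E; rewrite scale0r addr0 subr0 mulrC.
Qed.

(** The mean value theorem is applied twice: in direction [u] to the increment of [f] along
    [h *: v], then in direction [v] to ['D_u f]. *)
Lemma second_difference f U (x u v : 'rV[R]_m) (h : R) : open U -> 0 < h ->
  smooth U f ->
  (forall s t, 0 <= s <= h -> 0 <= t <= h -> U (x + s *: u + t *: v)) ->
  exists s t, [/\ 0 < s < h, 0 < t < h &
    f (x + h *: u + h *: v) - f (x + h *: u) - (f (x + h *: v) - f x) =
    h * (h * 'D_v ('D_u f) (x + s *: u + t *: v))].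
Proof.
move=> oU h0 sf hU.
have hh : 0 <= h <= h by rewrite ltW//=.
pose g := (f \o (fun z => z + h *: v)) - f.
have dsh w z : is_diff z (fun z : 'rV[R]_m => z + w) id.
  have -> : (fun z : 'rV[R]_m => z + w) = id + cst w by [].
  by apply: is_diff_eq; rewrite addr0.
have dfs s : 0 <= s <= h -> differentiable f (x + s *: u + h *: v).
  by move=> sh; apply: (smooth_differentiable sf); exact: hU.
have dfs0 s : 0 <= s <= h -> differentiable f (x + s *: u).
  move=> sh; apply: (smooth_differentiable sf).
  rewrite -[_ + _]addr0 -(scale0r v); apply: hU => //.
  by rewrite lexx ltW.
have dfsh s : 0 <= s <= h ->
    differentiable (f \o (fun z => z + h *: v)) (x + s *: u).
  by move=> sh; apply: differentiable_comp => //; exact: dfs.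
have [s sh E] : exists2 s, 0 < s < h &
    g (x + h *: u) - g x = h * 'D_u g (x + s *: u).
  apply: mvt_line => // s sh.
  by apply: differentiableB; [exact: dfsh|exact: dfs0].
have sh' : 0 <= s <= h by case/andP : sh => *; rewrite !ltW.
have [t th E'] : exists2 t, 0 < t < h &
    'D_u f (x + s *: u + h *: v) - 'D_u f (x + s *: u) =
    h * 'D_v ('D_u f) (x + s *: u + t *: v).
  apply: (@mvt_line ('D_u f) _ _ _ h0) => t th.
  exact: (smooth_differentiable (smooth_derive u sf) (hU _ _ sh' th)).
exists s, t; split => //; rewrite -E' [LHS](_ : _ = g (x + h *: u) - g x).
  rewrite E; congr (_ * _); rewrite deriveB; first last.
  - exact/diff_derivable/dfs0.
  - exact/diff_derivable/dfsh.
  congr (_ - _); rewrite deriveE; last exact: dfsh.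
  by rewrite diff_comp//= ?diff_val -?deriveE//; exact: dfs.
by [].
Qed.

(** The second difference is symmetric in [u] and [v], so the two mixed derivatives agree at two
    points as close to [x] as desired. If they differed at [x], continuity would keep each within
    half of the gap, a contradiction. *)
Lemma schwarz f U (x u v : 'rV[R]_m) : open U -> U x -> smooth U f ->
  'D_u ('D_v f) x = 'D_v ('D_u f) x.
Proof.
move=> oU Ux sf; apply/eqP/negP => /negP; set a := 'D_u _ x; set b := 'D_v _ x.
rewrite -subr_eq0 -normr_gt0 => ab0.
have e0 : 0 < `|a - b| / 2 by rewrite divr_gt0.
have near_line (P : set 'rV[R]_m) : nbhs x P -> exists2 h : R, 0 < h &
    forall s t, 0 <= s <= h -> 0 <= t <= h -> P (x + s *: u + t *: v).
  move=> /nbhs_ballP[r /= r0 rP].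
  have k0 : 0 < `|u| + `|v| + 1 by rewrite ltr_wpDl// addr_ge0.
  (* The summand 1 keeps the denominator positive when [u] and [v] vanish; the factor 1/2 makes the
     final estimate strict. *)
  exists (r / 2 / (`|u| + `|v| + 1)); first by rewrite !divr_gt0.
  set h := _ / _ => s t /andP[s0 sh] /andP[t0 th]; apply: rP.
  rewrite -ball_normE /ball_/= -addrA opprD addNKr normrN.
  apply: le_lt_trans (ler_normD _ _) _; rewrite !normrZ !ger0_norm//.
  apply: (@le_lt_trans _ _ (h * `|u| + h * `|v|)).
    by apply: lerD; apply: ler_wpM2r.
  apply: (@le_lt_trans _ _ (h * (`|u| + `|v| + 1))).
    by rewrite !mulrDr mulr1 lerDl !divr_ge0 ?ltW.
  by rewrite /h divfK ?gt_eqF// ltr_pdivrMr// ltr_pMr// ltr1n.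
have sa := smooth_derive u (smooth_derive v sf).
have sb := smooth_derive v (smooth_derive u sf).
have ca := smooth_continuous sa Ux; have cb := smooth_continuous sb Ux.
move/cvgrPdist_lt: ca => /(_ _ e0) Na; move/cvgrPdist_lt: cb => /(_ _ e0) Nb.
have NU : nbhs x U by exact: open_nbhs_nbhs.
have [h h0 H] := near_line _ (filterI NU (filterI Na Nb)).
have HU s t : 0 <= s <= h -> 0 <= t <= h -> U (x + s *: u + t *: v).
  by move=> sh th; have [] := H s t sh th.
have HU' t s : 0 <= t <= h -> 0 <= s <= h -> U (x + t *: v + s *: u).
  by move=> sh th; rewrite addrAC; exact: HU.
have [s [t [/andP[s0 sh] /andP[t0 th] E]]] := second_difference oU h0 sf HU.
have [t' [s' [/andP[t0' th'] /andP[s0' sh'] E']]] :=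
  second_difference oU h0 sf HU'.
have [_ [_ Hb]] := H s t ltac:(by rewrite !ltW) ltac:(by rewrite !ltW).
have [_ [Ha _]] := H s' t' ltac:(by rewrite !ltW) ltac:(by rewrite !ltW).
have EE : 'D_u ('D_v f) (x + s' *: u + t' *: v) =
          'D_v ('D_u f) (x + s *: u + t *: v).
  apply: (mulfI (lt0r_neq0 h0)); apply: (mulfI (lt0r_neq0 h0)).
  rewrite (addrAC x (s' *: u)); apply: (etrans (esym E')); apply: etrans E.
  by rewrite (addrAC x (h *: v)); ring.
set c := 'D_v ('D_u f) (x + s *: u + t *: v) in EE.
have Ha' : `|a - c| < `|a - b| / 2 by rewrite -EE; exact: Ha.
have Hb' : `|b - c| < `|a - b| / 2 := Hb.
clearbody a b c; have := le_lt_trans (ler_distD c a b).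
by rewrite (distrC c b) => /(_ _ (ltrD Ha' Hb')); rewrite -splitr ltxx.
Qed.

End Schwarz.

(** * Alternating forms *)

Section Alternating.
Context {R : realType} {m k : nat}.
Implicit Types (w : 'M[R]_(k, m) -> R) (A B : 'M[R]_(k, m)).

Definition set_row (i : 'I_k) (u : 'rV[R]_m) (A : 'M[R]_(k, m)) :
    'M[R]_(k, m) :=
  \matrix_(r, c) if r == i then u 0 c else A r c.

Lemma row_set_row i u A : row i (set_row i u A) = u.
Proof. by apply/rowP => c; rewrite !mxE eqxx. Qed.

Lemma row_set_row_neq i r u A : r != i -> row r (set_row i u A) = row r A.
Proof. by move=> /negbTE ri; apply/rowP => c; rewrite !mxE ri. Qed.

Lemma set_row_id i A : set_row i (row i A) A = A.
Proof. by apply/matrixP => r c; rewrite !mxE; case: eqP => // ->. Qed.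

Lemma eq_row' i A B :
  (forall r, r != i -> row r A = row r B) -> row' i A = row' i B.
Proof.
move=> AB; apply/row_matrixP => r.
have := AB (lift i r); rewrite eq_sym neq_lift => /(_ isT) /rowP E.
by apply/rowP => c; have := E c; rewrite !mxE.
Qed.

Lemma alt_lin w i A b c u v : alternating w ->
  w (set_row i (b *: u + c *: v) A) =
  b * w (set_row i u A) + c * w (set_row i v A).
Proof.
move=> [ml _]; apply: (ml _ _ _ i); rewrite ?row_set_row//.
  by apply: eq_row' => r ri; rewrite !row_set_row_neq.
by apply: eq_row' => r ri; rewrite !row_set_row_neq.
Qed.

Lemma alt_sum w i A (I : Type) (r : seq I) (c : I -> R) (u : I -> 'rV[R]_m) :
  alternating w ->
  w (set_row i (\sum_(j <- r) c j *: u j) A) =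
  \sum_(j <- r) c j * w (set_row i (u j) A).
Proof.
move=> aw; elim: r => [|j r IHr].
  by have := alt_lin i A 0 0 0 0 aw; rewrite !big_nil scale0r !mul0r !addr0.
by rewrite !big_cons -[X in _ + X]scale1r alt_lin// mul1r IHr.
Qed.

(** Expand the value on a tuple having u + v in both places: the two terms with equal rows vanish,
    and the other two cancel. *)
Lemma alt_xrow w i j A : alternating w -> i != j -> w (xrow i j A) = - w A.
Proof.
move=> aw ij; have [_ z] := aw.
pose u := row i A; pose v := row j A.
pose B x y := set_row i x (set_row j y A).
have rj x y : row j (B x y) = y.
  by rewrite row_set_row_neq 1?eq_sym// row_set_row.
have sB x y : B x y = set_row j y (set_row i x A).
  apply/matrixP => r c; rewrite !mxE.
  by case: eqP => // ->; rewrite (negbTE ij).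
have BB x : w (B x x) = 0 by apply: (z _ i j ij); rewrite rj row_set_row.
have := BB (u + v).
rewrite {1}/B -[u]scale1r -[v]scale1r alt_lin// !mul1r !scale1r.
rewrite -!/(B _ _) !sB -[u]scale1r -[v]scale1r !alt_lin// !mul1r !scale1r.
rewrite -!sB !BB add0r addr0.
have -> : B u v = A.
  by apply/matrixP => r c; rewrite !mxE; case: eqP => [->//|_];
    case: eqP => [->|].
have -> : B v u = xrow i j A.
  apply/matrixP => r c; rewrite !mxE.
  case: eqP => [->|/eqP ri]; first by rewrite tpermL.
  case: eqP => [->|/eqP rj']; first by rewrite tpermR.
  by rewrite tpermD// eq_sym.
by move=> /eqP; rewrite addrC addr_eq0 => /eqP.
Qed.

Lemma alt_row_perm w (s : 'S_k) A : alternating w ->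
  w (row_perm s A) = (-1) ^+ s * w A.
Proof.
move=> aw; have [ts -> /allP dts] := prod_tpermP s.
elim: ts dts A => [|[i j] ts IHt] dts A.
  by rewrite big_nil odd_perm1 expr0 mul1r row_perm1.
have ij : i != j by apply: (dts (i, j)); rewrite inE eqxx.
rewrite big_cons/= row_permM alt_xrow// IHt; last first.
  by move=> p pt; apply: dts; rewrite inE pt orbT.
by rewrite odd_permM odd_tperm ij/= signrN mulNr.
Qed.

End Alternating.

Section MultilinearExpansion.
Context {R : realType}.

(** This is the first clause of [alternating], isolated because the expansion over choices of rows
    is an induction in which only this clause matters. *)
Definition multilinear {m k} (w : 'M[R]_(k, m) -> R) :=
  forall (A B C : 'M[R]_(k, m)) (i : 'I_k) (b c : R),
     row i A = b *: row i B + c *: row i C ->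
     row' i B = row' i A -> row' i C = row' i A ->
     w A = b * w B + c * w C.

Lemma mlin_head m k (w : 'M[R]_(1 + k, m) -> R) (I : Type) (r : seq I) c
    (u : I -> 'rV[R]_m) B : multilinear w ->
  w (col_mx (\sum_(j <- r) c j *: u j) B) =
  \sum_(j <- r) c j * w (col_mx (u j) B).
Proof.
move=> ml; have E (u' : 'rV[R]_m) : row (lshift k 0) (col_mx u' B) = u'.
  by rewrite rowKu; apply/rowP => j; rewrite !mxE.
have E' (u1 u2 : 'rV[R]_m) : row' (lshift k 0) (col_mx u1 B) =
  row' (lshift k 0) (col_mx u2 B).
  apply/matrixP => a b; rewrite !mxE.
  by case: splitP => // x /= /eqP; rewrite (ord1 x) eq_sym.
have L b1 b2 u1 u2 : w (col_mx (b1 *: u1 + b2 *: u2) B) =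
    b1 * w (col_mx u1 B) + b2 * w (col_mx u2 B).
  by apply: (ml _ _ _ (lshift k 0)); [rewrite !E|exact: E'|exact: E'].
elim: r => [|j r IHr].
  by have := L 0 0 0 0; rewrite !big_nil scale0r !mul0r !addr0.
by rewrite !big_cons -[X in _ + X]scale1r L mul1r IHr.
Qed.

Lemma mlin_tail m k (w : 'M[R]_(1 + k, m) -> R) u :
  multilinear w -> multilinear (fun B : 'M[R]_(k, m) => w (col_mx u B)).
Proof.
move=> ml A B C i b c AE BA CA.
have rE (X Y : 'M[R]_(k, m)) : row' i X = row' i Y ->
    row' (rshift 1 i) (col_mx u X) = row' (rshift 1 i) (col_mx u Y).
  move=> /matrixP XY; apply/matrixP => p q; rewrite !mxE.
  case: splitP => // x xE; have xi : x != i.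
    apply/eqP => xi; have := neq_lift (rshift 1 i) p.
    by rewrite (_ : lift _ p = rshift 1 i) ?eqxx//; apply: ord_inj;
      rewrite xE xi.
  case: (unliftP i x) xi => [y -> _|->]; last by rewrite eqxx.
  by have := XY y q; rewrite !mxE.
by apply: (ml _ _ _ (rshift 1 i)); rewrite ?rowKd//; exact: rE.
Qed.

(** Each row of the product is a combination of the rows of [E]; expanding all of them gives one
    term for each choice [f] of a row of [E] per argument. *)
Lemma mlin_mul m k l (w : 'M[R]_(k, m) -> R) (A : 'M[R]_(k, l))
    (E : 'M[R]_(l, m)) : multilinear w ->
  w (A *m E) =
  \sum_(f : {ffun 'I_k -> 'I_l}) (\prod_i A i (f i)) * w (rowsub f E).
Proof.
elim: k w A => [|k IHk] w A ml.
  rewrite (big_pred1 (ffun0 (card_ord 0) : {ffun 'I_0 -> 'I_l})).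
    rewrite big_ord0 mul1r; congr (w _); apply/matrixP => -[] //.
  by move=> f; apply/esym/eqP/ffunP => -[].
pose A1 := usubmx (A : 'M[R]_(1 + k, l));
  pose A2 := dsubmx (A : 'M[R]_(1 + k, l)).
have AE : A = col_mx A1 A2 by rewrite /A1 /A2 vsubmxK.
have -> : A *m E = col_mx (A1 *m E) (A2 *m E).
  by rewrite [in LHS]AE; exact: (@mul_col_mx _ 1 k).
rewrite [A1 *m E]mulmx_sum_row mlin_head//.
(* A choice for k + 1 arguments is a choice for the first one together with a choice for the k
   others. *)
pose h (p : 'I_l * {ffun 'I_k -> 'I_l}) : {ffun 'I_k.+1 -> 'I_l} :=
  [ffun i => if unlift ord0 i is Some j then p.2 j else p.1].
rewrite (reindex h); last first.
  exists (fun f : {ffun 'I_k.+1 -> 'I_l} =>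
    (f ord0, [ffun i => f (lift ord0 i)])) => [[a f] _|f _].
    congr (_, _); first by rewrite ffunE unlift_none.
    by apply/ffunP => i; rewrite !ffunE liftK.
  by apply/ffunP => i; rewrite ffunE; case: unliftP => [j ->|->];
    rewrite ?ffunE.
pose G f := (\prod_i A i (f i)) * w (rowsub f E).
transitivity (\sum_p G (h (p.1, p.2))); last by apply: eq_bigr => -[].
rewrite -(pair_bigA _ (fun a f => G (h (a, f))))/= /G.
apply: eq_bigr => a _; rewrite (IHk _ _ (mlin_tail _ ml)) big_distrr/=.
apply: eq_bigr => f _; rewrite mulrA big_ord_recl; congr (_ * _ * w _).
- rewrite ffunE unlift_none /A1 !mxE; congr (A _ _); exact/val_inj.
- apply: eq_bigr => i _; rewrite ffunE liftK /A2 !mxE; congr (A _ _);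
    exact/val_inj.
- apply/matrixP => i j; rewrite !mxE ffunE; case: splitP => x xE.
    have -> : i = ord0 by apply/val_inj; rewrite /= xE (ord1 x).
    by rewrite unlift_none !mxE.
  have -> : i = lift ord0 x by apply/val_inj; rewrite /= xE.
  by rewrite liftK !mxE.
Qed.

(** Choices that are not injective repeat a row of [E] and contribute nothing; the injective ones
    are permutations, whose signs assemble the Leibniz formula. *)
Lemma alt_det m k (w : 'M[R]_(k, m) -> R) (A : 'M[R]_k) (E : 'M[R]_(k, m)) :
  alternating w -> w (A *m E) = \det A * w E.
Proof.
move=> aw; have [ml z] := aw; rewrite mlin_mul//.
rewrite (bigID (fun f : {ffun 'I_k -> 'I_k} => injectiveb f)) /= addrC.
rewrite big1 ?add0r => [|f Uf]; last first.
  case/injectivePn: Uf => i1 [i2 Di12 Ef12].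
  rewrite (z _ _ _ Di12) ?mulr0//.
  by rewrite !row_rowsub Ef12.
rewrite (reindex (@pval _)) /=; last first.
  pose in_Sn := insubd (1%g : 'S_k).
  by exists in_Sn => /= f Uf; first apply: val_inj; apply: insubdK.
rewrite /determinant big_distrl/=; apply: eq_big => /= [s|s _].
  by rewrite (valP s).
rewrite -mulrA mulrCA; congr (_ * _); first by apply: eq_bigr => i _;
  rewrite pvalE.
rewrite -(alt_row_perm s)//; congr w; apply/matrixP => i j.
by rewrite !mxE pvalE.
Qed.

(** Averaging over all permutations of the rows turns the products of entries into minors; the
    factor k! appears because [f] runs over all choices of columns and not only the increasing ones.
    The values of [w] on basis tuples are thus separated from the entries of [V], so that both can
    be differentiated by the product rule. *)
Lemma alt_minors m k (w : 'M[R]_(k, m) -> R) (V : 'M[R]_(k, m)) :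
  alternating w ->
  (k`!)%:R * w V = \sum_(f : {ffun 'I_k -> 'I_m})
     w (rowsub f 1%:M) * \det (colsub f V).
Proof.
move=> aw; have [ml _] := aw.
transitivity (\sum_(s : 'S_k) (-1) ^+ s * w (row_perm s V)).
  under eq_bigr do rewrite alt_row_perm// mulrA -signr_addb addbb expr0 mul1r.
  by rewrite sumr_const mulr_natl card_Sn.
under eq_bigr => s _ do rewrite -[row_perm s V]mulmx1 mlin_mul// big_distrr/=.
rewrite exchange_big; apply: eq_bigr => f _; rewrite -det_tr mulrC big_distrl/=.
apply: eq_bigr => s _; rewrite mulrA; congr (_ * _ * _).
by apply: eq_bigr => i _; rewrite !mxE.
Qed.

End MultilinearExpansion.

(** * The exterior derivative in coordinates *)

Section DerivativeOfSums.
Context {R : realType} {V : normedModType R}.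
Implicit Types (x v : V).

Lemma differentiable_bigsum (I : Type) (r : seq I) (F : I -> V -> R) x :
  (forall i, differentiable (F i) x) ->
  differentiable (fun y => \sum_(i <- r) F i y) x.
Proof.
move=> dF; elim: r => [|i r IHr].
  rewrite (_ : (fun _ => _) = cst 0); first exact: differentiable_cst.
  by apply/funext => y; rewrite big_nil.
rewrite (_ : (fun _ => _) = F i + (fun y => \sum_(i <- r) F i y)).
  exact: differentiableD.
by apply/funext => y; rewrite big_cons.
Qed.

Lemma derive_bigsum (I : Type) (r : seq I) (F : I -> V -> R) x v :
  (forall i, differentiable (F i) x) ->
  'D_v (fun y => \sum_(i <- r) F i y) x = \sum_(i <- r) 'D_v (F i) x.
Proof.
move=> dF; elim: r => [|i r IHr].
  rewrite big_nil (_ : (fun _ => _) = cst 0); first exact: derive_cst.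
  by apply/funext => y; rewrite big_nil.
rewrite big_cons (_ : (fun _ => _) = F i + (fun y => \sum_(i <- r) F i y)).
  rewrite deriveD ?IHr//; apply: diff_derivable => //.
  exact: differentiable_bigsum.
by apply/funext => y; rewrite big_cons.
Qed.

Lemma differentiable_bigprod k (F : 'I_k -> V -> R) x :
  (forall i, differentiable (F i) x) ->
  differentiable (fun y => \prod_i F i y) x.
Proof.
elim: k F => [|k IHk] F dF.
  rewrite (_ : (fun _ => _) = cst 1); first exact: differentiable_cst.
  by apply/funext => y; rewrite big_ord0.
rewrite (_ : (fun _ => _) = F ord0 * (fun y => \prod_i F (lift ord0 i) y)).
  by apply: differentiableM => //; exact: IHk.
by apply/funext => y; rewrite big_ord_recl.
Qed.

Lemma derive_bigprod k (F : 'I_k -> V -> R) x v :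
  (forall i, differentiable (F i) x) ->
  'D_v (fun y => \prod_i F i y) x =
  \sum_j \prod_i (if i == j then 'D_v (F i) x else F i x).
Proof.
elim: k F => [|k IHk] F dF.
  rewrite big_ord0 (_ : (fun _ => _) = cst 1); first exact: derive_cst.
  by apply/funext => y; rewrite big_ord0.
rewrite (_ : (fun _ => _) = F ord0 * (fun y => \prod_i F (lift ord0 i) y)).
  have dP := differentiable_bigprod (fun i => dF (lift ord0 i)).
  rewrite deriveM; [|exact: diff_derivable|exact: diff_derivable].
  rewrite IHk// big_ord_recl/= big_ord_recl eqxx addrC; congr (_ + _).
    by rewrite mulrC; congr (_ * _).
  rewrite scaler_sumr; apply: eq_bigr => j _; rewrite big_ord_recl.
  by congr (_ * _); apply: eq_bigr => i _; rewrite (inj_eq lift_inj).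
by apply/funext => y; rewrite big_ord_recl.
Qed.

Lemma differentiable_det k (M : V -> 'M[R]_k) x :
  (forall i j, differentiable (fun y => M y i j) x) ->
  differentiable (fun y => \det (M y)) x.
Proof.
move=> dM; apply: differentiable_bigsum => s.
rewrite (_ : (fun _ => _) = (-1) ^+ s *: (fun y => \prod_i M y i (s i)))//.
by apply: differentiableZ; exact: differentiable_bigprod.
Qed.

Lemma derive_det k (M : V -> 'M[R]_k) x v :
  (forall i j, differentiable (fun y => M y i j) x) ->
  'D_v (fun y => \det (M y)) x =
  \sum_j \det (set_row j (\row_c 'D_v (fun y => M y j c) x) (M x)).
Proof.
move=> dM; have dP (s : 'S_k) : differentiable (fun y => \prod_i M y i (s i)) x.
  exact: differentiable_bigprod.
rewrite derive_bigsum; last first.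
  move=> s; rewrite (_ : (fun _ => _) =
    (-1) ^+ s *: (fun y => \prod_i M y i (s i)))//.
  exact: differentiableZ.
rewrite exchange_big/=; apply: eq_bigr => s _.
rewrite (_ : (fun _ => _) = (-1) ^+ s *: (fun y => \prod_i M y i (s i)))//.
rewrite deriveZ; last exact: diff_derivable.
rewrite derive_bigprod//= scaler_sumr; apply: eq_bigr => j _; congr (_ * _).
by apply: eq_bigr => i _; rewrite !mxE; case: eqP => // ->.
Qed.

End DerivativeOfSums.

Section ExteriorDerivativeInCoordinates.
Context {R : realType}.

Lemma row'_mul k l m (i : 'I_k) (A : 'M[R]_(k, l)) (B : 'M[R]_(l, m)) :
  row' i (A *m B) = row' i A *m B.
Proof. by rewrite !row'Esub mul_rowsub_mx. Qed.

Lemma det_alternating k : alternating (@determinant R k).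
Proof.
split; first exact: determinant_multilinear.
move=> A i j ij /rowP rij; apply: (determinant_alternate ij) => c.
by have := rij c; rewrite !mxE.
Qed.

(* By Laplace expansion the sum is a contraction of [H] with a determinant that
   is antisymmetric in its two extra rows, while [H] is symmetric. *)
Lemma det_col'_sum k (N : 'M[R]_(k, k.+1)) (a : 'I_k) (H : 'M[R]_k.+1) :
  H^T = H ->
  \sum_(i < k.+1) (-1) ^+ i * \det (col' i (set_row a (row i H) N)) = 0.
Proof.
move=> HT; pose a1 := lift ord0 a.
(* The row 0 on top of [N] is a placeholder for [x]. With x = 'e_i, expansion along that row gives
   the i-th term of the sum. *)
pose B (x u : 'rV[R]_k.+1) : 'M[R]_k.+1 :=
  set_row ord0 x (set_row a1 u (col_mx (0 : 'rV[R]_k.+1) N)).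
have BE (i : 'I_k.+1) u : (-1) ^+ i * \det (col' i (set_row a u N)) =
  \det (B 'e_i u).
  rewrite (expand_det_row _ ord0) (bigD1 i)//= big1 => [|j /negbTE ji].
    rewrite !mxE !eqxx mul1r addr0 /cofactor add0n; congr (_ * \det _).
    apply/matrixP => p q; rewrite !mxE/= (inj_eq lift_inj).
    case: eqP => // _; case: splitP => y; first by rewrite (ord1 y).
    by rewrite /= /bump/= => -[/val_inj->].
  by rewrite !mxE eqxx ji mul0r.
have sw x u : \det (B x u) = - \det (B u x).
  have n01 : ord0 != a1 by exact: neq_lift.
  rewrite -(alt_xrow _ (det_alternating _) n01); congr (\det _).
  apply/matrixP => r c; rewrite !mxE.
  case: (r =P ord0) => [->|/eqP r0];
    first by rewrite tpermL eqxx eq_sym (negbTE n01).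
  case: (r =P a1) => [->|/eqP r1]; first by rewrite tpermR eqxx.
  by rewrite tpermD ?(negbTE r0) ?(negbTE r1)// eq_sym.
have lin (i : 'I_k.+1) u : \det (B 'e_i u) = \sum_r u 0 r * \det (B 'e_i 'e_r).
  have sB x y : B x y = set_row a1 y (set_row ord0 x (col_mx (0 :
    'rV[R]_k.+1) N)).
    apply/matrixP => r c; rewrite !mxE.
    by case: eqP => // ->.
  rewrite sB {1}[u]row_sum_delta alt_sum; last exact: det_alternating.
  by apply: eq_bigr => r _; rewrite sB.
under eq_bigr => i _ do rewrite BE lin.
set S := \sum_i _; suff : S = - S.
  by move=> /eqP; rewrite -addr_eq0 -mulr2n mulrn_eq0/= => /eqP.
rewrite {1}/S exchange_big/= /S -sumrN; apply: eq_bigr => i _.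
rewrite -sumrN; apply: eq_bigr => j _.
by rewrite sw mulrN !mxE -{1}HT mxE.
Qed.

(** The formula of [ext_d] for a form on a coordinate space, with no chart in between. *)
Definition coord_d m k (a : 'rV[R]_m -> 'M[R]_(k, m) -> R) y
    (v : 'M[R]_(k.+1, m)) : R :=
  \sum_(i < k.+1) (-1) ^+ i * 'D_(row i v) (fun z => a z (row' i v)) y.

Definition coord_pullback m n k (phi : 'rV[R]_m -> 'rV[R]_n)
    (a : 'rV[R]_n -> 'M[R]_(k, n) -> R) y (v : 'M[R]_(k, m)) : R :=
  a (phi y) (v *m jacobian phi y).

Variables (m n k : nat) (U : set 'rV[R]_m) (V : set 'rV[R]_n).
Variables (phi : 'rV[R]_m -> 'rV[R]_n) (a : 'rV[R]_n -> 'M[R]_(k, n) -> R).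
Hypotheses (oU : open U) (UV : forall x, U x -> V (phi x)).
Hypotheses (sphi : smooth_map U phi) (aa : forall y, V y -> alternating (a y)).
Hypothesis sa : forall B, smooth V (fun y => a y B).

(** Multilinearity writes the value as a polynomial in the entries of [A y], whose coefficients are
    values of the form on basis tuples. *)
Lemma smooth_multilinear (A : 'rV[R]_m -> 'M[R]_(k, n)) :
  (forall i j, smooth U (fun y => A y i j)) ->
  smooth U (fun y => a (phi y) (A y)).
Proof.
move=> sA; apply: (@smooth_ext _ _ U (fun y => \sum_(f : {ffun 'I_k -> 'I_n})
    (\prod_i A y i (f i)) * a (phi y) (rowsub f 1%:M))) => // [y Uy|].
  rewrite -[in RHS](mulmx1 (A y)) [RHS]mlin_mul//.
  by have [] := aa (UV Uy).
apply: smooth_sum => // f _; apply: smoothM => //; first exact: smooth_prod.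
exact: (smooth_comp oU UV sphi (sa _)).
Qed.

Lemma smooth_coord_pullback B : smooth U (fun y => coord_pullback phi a y B).
Proof.
apply: smooth_multilinear => i j.
apply: (@smooth_ext _ _ U (fun y => \sum_l B i l * jacobian phi y l j)) => //.
  by move=> y _; rewrite mxE.
apply: smooth_sum => // l _; apply: smoothM => //; first exact: smooth_cst.
exact: smooth_jacobian.
Qed.

(* After expanding [a] into minors, the derivatives of the coefficients give
   the right-hand side, and the second derivatives of [phi] cancel, by
   [det_col'_sum] applied to the Hessians of the components of [phi]. *)
Lemma coord_d_pullback y v : open V -> U y ->
  coord_d (coord_pullback phi a) y v = coord_d a (phi y) (v *m jacobian phi y).
Proof.
move=> oV Uy; have k0 : (k`!)%:R != 0 :> R by rewrite pnatr_eq0 -lt0n fact_gt0.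
apply: (mulfI k0); rewrite /coord_d !big_distrr/=.
have dphi z : U z -> differentiable phi z by exact: smooth_map_differentiable.
(* Column [r] of [N f] is the derivative, along row [r] of [v], of the components of [phi] selected
   by [f]. Leaving out the i-th argument of the form amounts to deleting column [i]. *)
pose N (f : {ffun 'I_k -> 'I_n}) z : 'M[R]_(k, k.+1) :=
  \matrix_(p, r) 'D_(row r v) (fun t => phi t 0 (f p) : R) z.
have NE (f : {ffun 'I_k -> 'I_n}) i z : U z ->
    colsub f (row' i v *m jacobian phi z) = (col' i (N f z))^T.
  move=> Uz; apply/matrixP => p q; rewrite [LHS]mxE [RHS]mxE [RHS]mxE [RHS]mxE.
  transitivity ('D_(row (lift i p) v) phi z 0 (f q)).
    rewrite (deriveEjacobian _ (dphi z Uz)) [LHS]mxE [RHS]mxE.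
    by apply: eq_bigr => l _; congr (_ * _); rewrite !mxE.
  by rewrite (derive_rV _ (dphi z Uz)) mxE.
pose J := jacobian phi y.
pose c (f : {ffun 'I_k -> 'I_n}) z := a z (rowsub f 1%:M).
have dc f : differentiable (c f) (phi y).
  exact: smooth_differentiable (sa _) (UV Uy).
have dcphi f : differentiable (c f \o phi) y.
  exact: differentiable_comp (dphi y Uy) (dc f).
have dN f p r : differentiable (fun z => N f z p r) y.
  rewrite (_ : (fun _ => _) = 'D_(row r v) (fun t => phi t 0 (f p) : R)).
    exact: smooth_differentiable (smooth_derive _ (sphi _)) Uy.
  by apply/funext => z; rewrite mxE.
have ddet f i : differentiable (fun z => \det (col' i (N f z))) y.
  apply: differentiable_det => p q.
  rewrite (_ : (fun _ => _) = (fun z => N f z p (lift i q)))//.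
  by apply/funext => z; rewrite mxE.
have dM f i : differentiable ((c f \o phi) * (fun z => \det (col' i (N f z))))
  y.
  exact: differentiableM.
have L i : (k`!)%:R * 'D_(row i v) (fun z => coord_pullback phi a z (row' i v))
  y
   = \sum_f ((c f (phi y)) * 'D_(row i v) (fun z => \det (col' i (N f z))) y +
        \det (col' i (N f y)) * 'D_(row i v *m J) (c f) (phi y)).
  have dpb : differentiable (fun z => coord_pullback phi a z (row' i v)) y.
    exact: smooth_differentiable (smooth_coord_pullback _) Uy.
  rewrite -[LHS]deriveZ; last exact: diff_derivable.
  rewrite (@near_eq_derive _ _ _ _ (fun z => \sum_f
     ((c f \o phi) * (fun z => \det (col' i (N f z)))) z)); last first.
    apply: (nbhs_open_eq oU Uy) => z Uz.
    rewrite -[LHS]/(_ * _) (alt_minors _ (aa (UV Uz))).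
    by apply: eq_bigr => f _; rewrite NE// det_tr.
  rewrite derive_bigsum//; apply: eq_bigr => f _.
  rewrite deriveM; [|exact: diff_derivable|exact: diff_derivable].
  congr (_ + _ * _); rewrite (deriveE _ (dcphi f)).
  rewrite (diff_comp (dphi y Uy) (dc f))/= -(deriveE _ (dphi y Uy)).
  by rewrite (deriveEjacobian _ (dphi y Uy)) -(deriveE _ (dc f)).
have L' i : (k`!)%:R * 'D_(row i v *m J) (fun z => a z (row' i v *m J)) (phi y)
   = \sum_f (\det (col' i (N f y)) * 'D_(row i v *m J) (c f) (phi y)).
  have da : differentiable (fun z => a z (row' i v *m J)) (phi y).
    exact: smooth_differentiable (sa _) (UV Uy).
  rewrite -[LHS]deriveZ; last exact: diff_derivable.
  rewrite (@near_eq_derive _ _ _ _ (fun z => \sum_f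
     (\det (col' i (N f y)) *: c f) z)); last first.
    apply: (nbhs_open_eq oV (UV Uy)) => z Vz.
    rewrite -[LHS]/(_ * _) (alt_minors _ (aa Vz)).
    by apply: eq_bigr => f _; rewrite NE// det_tr mulrC.
  rewrite derive_bigsum//; last by move=> f; exact: differentiableZ.
  by apply: eq_bigr => f _; rewrite deriveZ//; exact: diff_derivable.
transitivity (\sum_(i < k.+1) (-1) ^+ i * \sum_f
     (c f (phi y) * 'D_(row i v) (fun z => \det (col' i (N f z))) y +
        \det (col' i (N f y)) * 'D_(row i v *m J) (c f) (phi y))).
  by apply: eq_bigr => i _; rewrite mulrCA L.
transitivity (\sum_(i < k.+1) (-1) ^+ i * \sum_f
        (\det (col' i (N f y)) * 'D_(row i v *m J) (c f) (phi y))); last first.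
  by apply: eq_bigr => i _; rewrite mulrCA -L' row_mul -row'_mul.
under eq_bigr => i _ do rewrite big_split/= mulrDr.
rewrite big_split/= [X in X + _](_ : _ = 0) ?add0r//.
under eq_bigr => i _ do rewrite big_distrr/=.
rewrite exchange_big/= big1// => f _.
under eq_bigr => i _ do rewrite mulrCA.
rewrite -big_distrr/= [X in _ * X](_ : _ = 0) ?mulr0//.
(* The Hessian of the component [f p] of [phi], evaluated on the rows of [v]. Differentiating row
   [p] of [N f] along [row i v] replaces it by row [i] of this matrix. *)
pose H p : 'M[R]_k.+1 := \matrix_(i, r) 'D_(row i v) ('D_(row r v)
   (fun t => phi t 0 (f p) : R)) y.
have HT p : (H p)^T = H p.
  by apply/matrixP => i r; rewrite !mxE (schwarz _ _ oU Uy (sphi _)).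
transitivity (\sum_(i < k.+1) \sum_p
    (-1) ^+ i * \det (col' i (set_row p (row i (H p)) (N f y)))).
  apply: eq_bigr => i _; rewrite derive_det; last first.
    move=> p q; rewrite (_ : (fun _ => _) = (fun z => N f z p (lift i q)))//.
    by apply/funext => z; rewrite mxE.
  rewrite big_distrr/=; apply: eq_bigr => p _; congr (_ * \det _).
  apply/matrixP => r q; rewrite !mxE; case: eqP => // rp.
  congr (derive _ _ _); apply/funext => z; by rewrite !mxE.
by rewrite exchange_big/= big1// => p _; exact: det_col'_sum.
Qed.

End ExteriorDerivativeInCoordinates.

(** * Manifolds and tangent maps *)

Lemma open_preimage (T T' : topologicalType) (U : set T) (W : set T')
    (f : T -> T') :
  open U -> open W -> (forall p, U p -> {for p, continuous f}) ->
  open (U `&` f @^-1` W).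
Proof.
move=> oU oW cf; rewrite openE => p [Up Wp]; apply: filterI.
  exact: open_nbhs_nbhs.
by apply: (cf p Up); exact: open_nbhs_nbhs.
Qed.

Section Charts.
Context {R : realType} {m : nat} {M : manifold R m}.
Implicit Types (c : chart R m M) (U W : set M) (p q : M).

Lemma open_chart_image c W : open W -> open (c @` (cdom c `&` W)).
Proof.
move=> oW; rewrite openE => _ [p [cp Wp] <-].
have Cp : (c @` cdom c) (c p) by exists p.
have N1 : nbhs (c p) (c @` cdom c) by apply: open_nbhs_nbhs; split=> //;
  exact: open_cimage.
have N2 : nbhs (c p) (cinv c @^-1` W).
  by apply: (cinv_continuous Cp); rewrite /= cfunK//; exact: open_nbhs_nbhs.
apply: filterS (filterI N1 N2) => _ [[q cq <-]] /=; rewrite cfunK// => Wq.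
by exists q.
Qed.

Lemma smooth_on_id : smooth_on setT (id : M -> M).
Proof.
split=> [p _|c c' cA c'A]; first exact: cvg_id.
move=> j; apply: smooth_sub (smooth_transition cA c'A j).
by move=> _ [p [[cp _] /= c'p] <-]; exists p.
Qed.

End Charts.

Lemma smooth_on_sub {R : realType} {m m' : nat} {M : manifold R m}
    {M' : manifold R m'} (U V : set M) (f : M -> M') :
  V `<=` U -> smooth_on U f -> smooth_on V f.
Proof.
move=> VU [cf sf]; split=> [p /VU|c c' cA c'A j]; first exact: cf.
apply: smooth_sub (sf c c' cA c'A j) => _ [p [[cp /VU Up] fp] <-].
by exists p.
Qed.

Section Representatives.
Context {R : realType} {m m' m'' : nat}.
Context {M : manifold R m} {M' : manifold R m'} {M'' : manifold R m''}.

Definition rep {m m'} {M : manifold R m} {M' : manifold R m'}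
    (c : chart R m M) (c' : chart R m' M') (f : M -> M') : 'rV[R]_m ->
      'rV[R]_m' :=
  c' \o f \o cinv c.

Variables (U : set M) (f : M -> M').
Hypotheses (oU : open U) (sf : smooth_on U f).

Lemma open_rep_dom (c : chart R m M) (c' : chart R m' M') :
  open (c @` (cdom c `&` U `&` f @^-1` cdom c')).
Proof.
rewrite -setIA; apply: open_chart_image; apply: open_preimage => //.
  exact: open_cdom.
by case: sf.
Qed.

Lemma smooth_rep (c : chart R m M) (c' : chart R m' M') : atlas M c ->
  atlas M' c' ->
  smooth_map (c @` (cdom c `&` U `&` f @^-1` cdom c')) (rep c c' f).
Proof. by case: sf => _; apply. Qed.

Lemma differentiable_rep (c : chart R m M) (c' : chart R m' M') p :
  atlas M c -> atlas M' c' ->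
  cdom c p -> U p -> cdom c' (f p) -> differentiable (rep c c' f) (c p).
Proof.
move=> cA c'A cp Up c'p; apply: smooth_map_differentiable (smooth_rep cA c'A) _.
by exists p.
Qed.

Lemma rep_eq (g : M -> M') (c : chart R m M) (c' : chart R m' M') p :
  atlas M c -> atlas M' c' ->
  cdom c p -> U p -> cdom c' (f p) -> (forall q, U q -> f q = g q) ->
  jacobian (rep c c' f) (c p) = jacobian (rep c c' g) (c p).
Proof.
move=> cA c'A cp Up c'p fg; apply: near_eq_jacobian;
  last exact: differentiable_rep.
apply: (@nbhs_open_eq _ _ (c @` (cdom c `&` U `&` f @^-1` cdom c'))).
- exact: open_rep_dom.
- by exists p.
- by move=> _ [q [[cq Uq] _] <-]; rewrite /rep /= cfunK// fg.
Qed.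

Variables (V : set M') (g : M' -> M'').
Hypotheses (oV : open V) (sg : smooth_on V g).

Lemma rep_comp_eq (c : chart R m M) (c' : chart R m' M') (c'' :
  chart R m'' M'') y :
  (c @` (cdom c `&` U `&` f @^-1` cdom c')) y ->
  (rep c' c'' g \o rep c c' f) y = rep c c'' (g \o f) y.
Proof.
by move=> [q [[cq Uq] c'q] <-]; rewrite /rep /= !cfunK.
Qed.

Lemma rep_comp (c : chart R m M) (c' : chart R m' M') (c'' :
  chart R m'' M'') p : atlas M c -> atlas M' c' -> atlas M'' c'' ->
  cdom c p -> U p -> cdom c' (f p) -> V (f p) -> cdom c'' (g (f p)) ->
  jacobian (rep c c'' (g \o f)) (c p) =
  jacobian (rep c c' f) (c p) *m jacobian (rep c' c'' g) (c' (f p)).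
Proof.
move=> cA c'A c''A cp Up c'p Vp c''p.
have E : rep c c' f (c p) = c' (f p) by rewrite /rep /= cfunK.
have df : differentiable (rep c c' f) (c p) by exact: differentiable_rep.
have dg : differentiable (rep c' c'' g) (rep c c' f (c p)).
  rewrite E; case: sg => _ sg';
    apply: (smooth_map_differentiable (sg' _ _ c'A c''A)).
  by exists (f p).
rewrite -E; apply: etrans (jacobian_comp df dg).
apply/esym/near_eq_jacobian; last first.
  exact: differentiable_comp.
apply: (@nbhs_open_eq _ _ (c @` (cdom c `&` U `&` f @^-1` cdom c'))).
- exact: open_rep_dom.
- by exists p.
- by move=> y; exact: rep_comp_eq.
Qed.

(** The charts at both ends are prescribed, but the intermediate point may leave any single chart;
    smoothness is therefore checked locally, through the preferred chart at [f p]. *)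
Lemma smooth_on_comp : smooth_on (U `&` f @^-1` V) (g \o f).
Proof.
case: (sf) => cf _; case: (sg) => cg sg'; split=> [p [Up Vp]|c c'' cA c''A j].
  by apply: continuous_comp; [exact: cf|exact: cg].
apply: smooth_local => _ [p [[cp [Up Vp]] c''p] <-].
pose c' := chart_at M' (f p).
have c'A : atlas M' c' by exact: atlas_chart_at.
pose W := V `&` g @^-1` cdom c''.
have oW : open W by apply: open_preimage => //; exact: open_cdom.
pose S := c @` (cdom c `&` (U `&` f @^-1` (W `&` cdom c'))).
have oS : open S.
  apply: open_chart_image; apply: open_preimage => //; apply: openI => //.
  exact: open_cdom.
exists S; first by exists p => //; do !split => //; exact: cdom_chart_at.
apply: (@smooth_ext _ _ S (fun y => (rep c' c'' g \o rep c c' f) y 0 j)) => //.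
  move=> _ [q [cq [Uq [Wq c'q]]] <-]; rewrite (@rep_comp_eq _ _ _ (c q))//.
  by exists q.
apply: (smooth_map_comp oS _ _ (sg' _ _ c'A c''A)).
  move=> _ [q [cq [Uq [[Vq c''q] c'q]]] <-]; exists (f q) => //.
  by rewrite /rep /= cfunK.
move=> i; apply: smooth_sub (smooth_rep cA c'A i).
by move=> _ [q [cq [Uq [[Vq c''q] c'q]]] <-]; exists q.
Qed.

End Representatives.

Section TangentMaps.
Context {R : realType}.

Lemma tangent_map_comp {m m' m'' : nat} {M : manifold R m} {M' : manifold R m'}
    {M'' : manifold R m''} (U : set M) (V : set M') (f : M -> M')
    (g : M' -> M'') p : open U -> smooth_on U f -> smooth_on V g ->
  U p -> V (f p) ->
  tangent_map (g \o f) p = tangent_map f p *m tangent_map g (f p).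
Proof.
move=> oU sf sg Up Vp; apply: (rep_comp oU sf sg) => //;
  (exact: atlas_chart_at || exact: cdom_chart_at).
Qed.

Lemma tangent_map_eq {m m' : nat} {M : manifold R m} {M' : manifold R m'}
    (U : set M) (f g : M -> M') p : open U -> smooth_on U f -> U p ->
  (forall q, U q -> f q = g q) -> tangent_map f p = tangent_map g p.
Proof.
move=> oU sf Up fg; rewrite /tangent_map -(fg p Up).
apply: (rep_eq oU sf) => //; (exact: atlas_chart_at || exact: cdom_chart_at).
Qed.

Lemma tangent_map_id {m : nat} {M : manifold R m} (p : M) :
  tangent_map (id : M -> M) p = 1%:M.
Proof.
rewrite -(jacobian_id (chart_at M p p)); apply/esym/near_eq_jacobian;
  last first.
  exact: ex_diff.
pose c := chart_at M p.
apply: (@nbhs_open_eq _ _ (c @` cdom c)); first exact: open_cimage.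
  by exists p => //; exact: cdom_chart_at.
by move=> _ [q cq <-]; rewrite /= cfunK.
Qed.

Lemma tangent_map_diffeo {m m' : nat} {M : manifold R m} {M' : manifold R m'}
    (U : set M) (V : set M') (f : M -> M') (g : M' -> M) p :
  diffeo_on U V f g -> U p ->
  tangent_map f p *m tangent_map g (f p) = 1%:M.
Proof.
move=> [[oU oV sf sg] [UV VU gf fg]] Up.
rewrite -(tangent_map_comp oU sf sg)//; last exact: UV.
rewrite -(tangent_map_id p); apply/esym/(@tangent_map_eq _ _ _ _ U) => //.
  exact: smooth_on_sub smooth_on_id.
by move=> q Uq; rewrite /= gf.
Qed.

Lemma diffeo_sym {m m' : nat} {M : manifold R m} {M' : manifold R m'}
    (U : set M) (V : set M') (f : M -> M') (g : M' -> M) :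
  diffeo_on U V f g -> diffeo_on V U g f.
Proof. by move=> [[? ? ? ?] [? ? ? ?]]. Qed.

Context {m m' : nat} {M : manifold R m} {M' : manifold R m'}.
Variables (U : set M) (f : M -> M').
Hypotheses (oU : open U) (sf : smooth_on U f).

(** Both sides are the Jacobian of [f] read in [c] and in the preferred chart at [f p], factored
    through the identity of [M] on the left and of [M'] on the right. This is the passage from
    preferred components to fixed charts. *)
Lemma from_chart_tangent_map (c : chart R m M) (c' : chart R m' M') p :
  atlas M c -> atlas M' c' ->
  cdom c p -> U p -> cdom c' (f p) ->
  from_chart c p *m tangent_map f p =
  jacobian (rep c c' f) (c p) *m from_chart c' (f p).
Proof.
move=> cA c'A cp Up c'p;
  transitivity (jacobian (rep c (chart_at M' (f p)) f) (c p)).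
  apply/esym/(@rep_comp _ _ _ _ M M M' setT id openT smooth_on_id U f sf) => //;
  (exact: atlas_chart_at || exact: cdom_chart_at).
apply: (@rep_comp _ _ _ _ M M' M' U f oU sf setT id smooth_on_id) => //;
  (exact: atlas_chart_at || exact: cdom_chart_at).
Qed.

End TangentMaps.

Section ChartMatrices.
Context {R : realType} {m : nat} {M : manifold R m}.
Implicit Types (c : chart R m M) (p : M).

Lemma from_chartK c p : atlas M c -> cdom c p ->
  from_chart c p *m to_chart c p = 1%:M.
Proof.
move=> cA cp; transitivity (jacobian (rep c c id) (c p)).
  apply/esym/(@rep_comp _ _ _ _ M M M setT id openT smooth_on_id setT id
    smooth_on_id) => //;
  (exact: atlas_chart_at || exact: cdom_chart_at).
rewrite -(jacobian_id (c p)); apply/esym/near_eq_jacobian; last first.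
  exact: ex_diff.
apply: (@nbhs_open_eq _ _ (c @` cdom c)); first exact: open_cimage.
  by exists p.
by move=> _ [q cq <-]; rewrite /rep /= cfunK.
Qed.

Lemma to_chartK c p : atlas M c -> cdom c p ->
  to_chart c p *m from_chart c p = 1%:M.
Proof. by move=> cA cp; apply: mulmx1C; exact: from_chartK. Qed.

End ChartMatrices.

(** * Differential forms on manifolds *)

Section AlternatingClosure.
Context {R : realType}.

Lemma alternating_mulr m n k (w : 'M[R]_(k, n) -> R) (C : 'M[R]_(m, n)) :
  alternating w -> alternating (fun v => w (v *m C)).
Proof.
move=> [ml z]; split=> [A B B' i b c AE BA CA|A i j ij Aij].
  apply: (ml _ _ _ i); first by rewrite !row_mul AE mulmxDl !scalemxAl.
  - by rewrite !row'_mul BA.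
  - by rewrite !row'_mul CA.
by apply: (z _ i j ij); rewrite !row_mul Aij.
Qed.

Lemma alternating0 m k : alternating (fun _ : 'M[R]_(k, m) => 0 : R).
Proof. by split=> // A B C i b c _ _ _; rewrite !mulr0 addr0. Qed.

Lemma alternating_lin m k (a b : 'M[R]_(k, m) -> R) (x y : R) :
  alternating a -> alternating b -> alternating (fun v => x * a v + y * b v).
Proof.
move=> [la za] [lb zb]; split=> [A B C i s t AE BA CA|A i j ij Aij].
  by rewrite (la _ _ _ _ _ _ AE BA CA) (lb _ _ _ _ _ _ AE BA CA); ring.
by rewrite (za _ _ _ ij Aij) (zb _ _ _ ij Aij) !mulr0 addr0.
Qed.

(** The value of [wedge] at one point, so that its alternation becomes a statement of linear
    algebra. *)
Definition alg_wedge m k l (a : 'M[R]_(k, m) -> R) (b : 'M[R]_(l, m) -> R)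
    (v : 'M[R]_(k + l, m)) : R :=
  (k`! * l`!)%:R^-1 * \sum_(s : 'S_(k + l)) (-1) ^+ s *
      a (usubmx (row_perm s v)) * b (dsubmx (row_perm s v)).

(** For linearity in row [i], each permutation [s] sends that row to exactly one of the two factors,
    according to the block containing the preimage of [i]. When rows [i] and [j] agree, composing
    [s] with their transposition changes the sign of the sum and nothing else. *)
Lemma alternating_wedge m k l (a : 'M[R]_(k, m) -> R) (b : 'M[R]_(l, m) -> R) :
  alternating a -> alternating b -> alternating (alg_wedge a b).
Proof.
move=> aa ab; split=> [A B C i x y AE BA CA|A i j ij Aij]; rewrite /alg_wedge.
  rewrite (mulrCA x) (mulrCA y) -mulrDr; congr (_ * _).
  rewrite !big_distrr -big_split/=; apply: eq_bigr => s _.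
  have nE (X Y : 'M[R]_(k + l, m)) r : row' i X = row' i Y -> r != i ->
      row r X = row r Y.
    move=> /matrixP XY ri; apply/rowP => q; rewrite !mxE.
    case: (unliftP i r) ri => [r' -> _|->]; last by rewrite eqxx.
    by have := XY r' q; rewrite !mxE.
  have uE (X : 'M[R]_(k + l, m)) r :
      row r (usubmx (row_perm s X)) = row (s (lshift l r)) X.
    by apply/rowP => q; rewrite !mxE.
  have dE (X : 'M[R]_(k + l, m)) r :
      row r (dsubmx (row_perm s X)) = row (s (rshift k r)) X.
    by apply/rowP => q; rewrite !mxE.
  have [la _] := aa; have [lb _] := ab.
  case: (split_ordP (s^-1%g i)) => r /(canRL (permKV s)) /esym rE.
    have dd X : row' i X = row' i A ->
        dsubmx (row_perm s X) = dsubmx (row_perm s A).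
      move=> XA; apply/row_matrixP => q; rewrite !dE; apply: nE => //.
      by rewrite -rE (inj_eq perm_inj) eq_rlshift.
    have uu X : row' i X = row' i A ->
        row' r (usubmx (row_perm s X)) = row' r (usubmx (row_perm s A)).
      move=> XA; apply: eq_row' => q qr; rewrite !uE; apply: nE => //.
      by rewrite -rE (inj_eq perm_inj) (inj_eq (@lshift_inj _ _)).
    have AU : row r (usubmx (row_perm s A)) = x *: row r (usubmx (row_perm s B))
        + y *: row r (usubmx (row_perm s C)) by rewrite !uE rE.
    have -> := la _ _ _ _ _ _ AU (uu _ BA) (uu _ CA).
    rewrite (dd _ BA) (dd _ CA).
    by rewrite mulrDr mulrDl !mulrA ![x * _]mulrC ![y * _]mulrC.
  have uu X : row' i X = row' i A ->
      usubmx (row_perm s X) = usubmx (row_perm s A).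
    move=> XA; apply/row_matrixP => q; rewrite !uE; apply: nE => //.
    by rewrite -rE (inj_eq perm_inj) eq_lrshift.
  have dd X : row' i X = row' i A ->
      row' r (dsubmx (row_perm s X)) = row' r (dsubmx (row_perm s A)).
    move=> XA; apply: eq_row' => q qr; rewrite !dE; apply: nE => //.
    by rewrite -rE (inj_eq perm_inj) (inj_eq (@rshift_inj _ _)).
  have AD : row r (dsubmx (row_perm s A)) = x *: row r (dsubmx (row_perm s B))
      + y *: row r (dsubmx (row_perm s C)) by rewrite !dE rE.
  have -> := lb _ _ _ _ _ _ AD (dd _ BA) (dd _ CA).
  rewrite (uu _ BA) (uu _ CA).
  by rewrite mulrDr (mulrCA _ x) (mulrCA _ y).
set S := \sum_s _; suff -> : S = 0 by rewrite mulr0.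
suff : S = - S.
  by move=> /eqP; rewrite -addr_eq0 -mulr2n mulrn_eq0/= => /eqP.
rewrite {1}/S (reindex_inj (mulIg (tperm i j))) /S -sumrN.
apply: eq_bigr => s _; rewrite odd_permM odd_tperm ij addbT signrN !mulNr.
suff -> : row_perm (s * tperm i j) A = row_perm s A by [].
apply/matrixP => p q; rewrite !mxE permM; have /rowP /(_ q) := Aij.
by rewrite !mxE; case: tpermP => // ->.
Qed.

End AlternatingClosure.

Section SmoothForms.
Context {R : realType} {m : nat} {M : manifold R m}.
Implicit Types (U V : set M).

Lemma smooth_form_sub k U V (a : dform M k) :
  V `<=` U -> smooth_form U a -> smooth_form V a.
Proof.
move=> VU [aa sa]; split=> [p /VU|c v cA]; first exact: aa.
apply: smooth_sub (sa c v cA) => _ [p [cp /VU Up] <-].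
by exists p.
Qed.

Lemma smooth_form_ext k U (a b : dform M k) : open U ->
  eq_form_on U a b -> smooth_form U a -> smooth_form U b.
Proof.
move=> oU ab [aa sa]; split=> [p Up|c v cA].
  by rewrite (_ : b p = a p); [exact: aa|apply/funext => v; rewrite ab].
apply: smooth_ext (sa c v cA); first exact: open_chart_image.
by move=> _ [p [cp Up] <-]; rewrite /local_form ab// cfunK.
Qed.

Lemma smooth_form0 k U : open U -> smooth_form U (@zero_form R m M k).
Proof.
move=> oU; split=> [p _|c v cA]; first exact: alternating0.
exact: smooth_cst.
Qed.

Lemma smooth_form_lin k U (a b : dform M k) (x y : R) : open U ->
  smooth_form U a -> smooth_form U b ->
  smooth_form U (fun p v => x * a p v + y * b p v : R).
Proof.
move=> oU [aa sa] [ab sb]; split=> [p Up|c v cA].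
  by apply: alternating_lin; [exact: aa|exact: ab].
have oc := @open_chart_image _ _ _ c _ oU.
by apply: smoothD => //; apply: smoothM => //;
  (exact: smooth_cst || exact: sa || exact: sb).
Qed.

Lemma smooth_form_add k U (a b : dform M k) : open U ->
  smooth_form U a -> smooth_form U b -> smooth_form U (add_form a b).
Proof.
move=> oU sa sb; apply: smooth_form_ext (smooth_form_lin 1 1 oU sa sb) => //.
by move=> p v _; rewrite !mul1r.
Qed.

Lemma smooth_form_sub_form k U (a b : dform M k) : open U ->
  smooth_form U a -> smooth_form U b -> smooth_form U (sub_form a b).
Proof.
move=> oU sa sb; apply: smooth_form_ext (smooth_form_lin 1 (-1) oU sa sb) => //.
by move=> p v _; rewrite mul1r mulN1r.
Qed.

Lemma smooth_form_wedge k l U (a : dform M k) (b : dform M l) : open U ->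
  smooth_form U a -> smooth_form U b -> smooth_form U (wedge a b).
Proof.
move=> oU [aa sa] [ab sb]; split=> [p Up|c v cA].
  exact: alternating_wedge (aa p Up) (ab p Up).
have oc := @open_chart_image _ _ _ c _ oU.
pose F (s : 'S_(k + l)) y :=
  (-1) ^+ s * local_form c a y (usubmx (row_perm s v)) *
  local_form c b y (dsubmx (row_perm s v)).
apply: (@smooth_ext _ _ _ (fun y => (k`! * l`!)%:R^-1 * \sum_s F s y)) => //.
  move=> y _; congr (_ * _); apply: eq_bigr => s _.
  by rewrite /F /local_form !mul_usub_mx !mul_dsub_mx !row_permE !mulmxA.
apply: smoothM => //; first exact: smooth_cst.
apply: smooth_sum => // s _.
apply: smoothM => //; last exact: sb.
by apply: smoothM => //; [exact: smooth_cst|exact: sa].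
Qed.

Lemma ext_d_ext k U (a b : dform M k) p v : open U ->
  eq_form_on U a b -> U p -> ext_d a p v = ext_d b p v.
Proof.
move=> oU ab Up; apply: eq_bigr => i _; congr (_ * _).
pose c := chart_at M p; have cp : cdom c p by exact: cdom_chart_at.
apply: near_eq_derive; apply: (@nbhs_open_eq _ _ (c @` (cdom c `&` U))).
- exact: open_chart_image.
- by exists p.
- by move=> _ [q [cq Uq] <-]; rewrite /local_form ab// cfunK.
Qed.

End SmoothForms.

Section Pullback.
Context {R : realType} {m m' : nat} {M : manifold R m} {M' : manifold R m'}.
Variables (U : set M) (V : set M') (f : M -> M').
Hypotheses (oU : open U) (oV : open V) (sf : smooth_on U f).

Lemma pullback_wedge k l (a : dform M' k) (b : dform M' l) p v :
  pullback f (wedge a b) p v = wedge (pullback f a) (pullback f b) p v.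
Proof.
rewrite /pullback /wedge; congr (_ * _); apply: eq_bigr => s _.
by rewrite !mul_usub_mx !mul_dsub_mx !row_permE !mulmxA.
Qed.

Lemma local_form_pullback k (w : dform M' k) (c : chart R m M)
    (c' : chart R m' M') y v : atlas M c -> atlas M' c' ->
  (c @` (cdom c `&` U `&` f @^-1` cdom c')) y ->
  local_form c (pullback f w) y v =
  coord_pullback (rep c c' f) (local_form c' w) y v.
Proof.
move=> cA c'A [p [[cp Up] /= c'p] <-].
rewrite /local_form /pullback /coord_pullback cfunK//.
have -> : cinv c' (rep c c' f (c p)) = f p by rewrite /rep /= !cfunK.
by rewrite -!mulmxA (from_chart_tangent_map oU sf cA c'A).
Qed.

Lemma alternating_pullback k (w : dform M' k) p :
  alternating (w (f p)) -> alternating (pullback f w p).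
Proof. exact: alternating_mulr. Qed.

Lemma alternating_local_form k (w : dform M' k) (c : chart R m' M') y :
  smooth_form V w -> (c @` (cdom c `&` V)) y -> alternating (local_form c w y).
Proof.
move=> [aw _] [p [cp Vp] <-]; apply: alternating_mulr; rewrite cfunK//.
exact: aw.
Qed.

Lemma smooth_rep_dom (c : chart R m M) (c' : chart R m' M') :
  atlas M c -> atlas M' c' ->
  smooth_map (c @` (cdom c `&` (U `&` f @^-1` (V `&` cdom c')))) (rep c c' f).
Proof.
move=> cA c'A i; apply: smooth_sub (smooth_rep sf cA c'A i).
by move=> _ [q [cq [Uq [Vq c'q]]] <-]; exists q.
Qed.

Lemma open_rep_dom' (c : chart R m M) (c' : chart R m' M') :
  open (c @` (cdom c `&` (U `&` f @^-1` (V `&` cdom c')))).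
Proof.
apply: open_chart_image; apply: open_preimage => //; last by case: sf.
by apply: openI => //; exact: open_cdom.
Qed.

Lemma rep_dom_sub (c : chart R m M) (c' : chart R m' M') y :
  (c @` (cdom c `&` (U `&` f @^-1` (V `&` cdom c')))) y ->
  (c' @` (cdom c' `&` V)) (rep c c' f y).
Proof.
move=> [q [cq [Uq [Vq c'q]]] <-]; exists (f q) => //.
by rewrite /rep /= cfunK.
Qed.

Lemma smooth_form_pullback k (w : dform M' k) :
  smooth_form V w -> smooth_form (U `&` f @^-1` V) (pullback f w).
Proof.
move=> sw; have [aw sw'] := sw; split=> [p [Up Vp]|c v cA].
  exact/alternating_pullback/aw.
apply: smooth_local => _ [p [cp [Up Vp]] <-].
pose c' := chart_at M' (f p).
have c'A : atlas M' c' by exact: atlas_chart_at.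
exists (c @` (cdom c `&` (U `&` f @^-1` (V `&` cdom c')))).
  by exists p => //; do !split => //; exact: cdom_chart_at.
apply: (@smooth_ext _ _ _ (fun y => coord_pullback (rep c c' f) (local_form c'
  w) y v)).
- exact: open_rep_dom'.
- move=> y [q [cq [Uq [Vq c'q]]] yE]; apply/esym/local_form_pullback => //.
  by exists q.
apply: (@smooth_coord_pullback _ _ _ _ _ (c' @` (cdom c' `&` V))).
- exact: open_rep_dom'.
- exact: rep_dom_sub.
- exact: smooth_rep_dom.
- by move=> y; exact: alternating_local_form.
- by move=> B; exact: sw'.
Qed.

(** In the preferred charts at [p] and [f p] this is [coord_d_pullback]. The local expression of the
    pullback agrees with the coordinate one only near the point, which is enough for a
    derivative. *)
Lemma ext_d_pullback k (w : dform M' k) p v :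
  smooth_form V w -> U p -> V (f p) ->
  ext_d (pullback f w) p v = pullback f (ext_d w) p v.
Proof.
move=> sw Up Vp; have [aw sw'] := sw.
pose c := chart_at M p; pose c' := chart_at M' (f p).
have cA : atlas M c by exact: atlas_chart_at.
have c'A : atlas M' c' by exact: atlas_chart_at.
have cp : cdom c p by exact: cdom_chart_at.
have c'p : cdom c' (f p) by exact: cdom_chart_at.
pose S := c @` (cdom c `&` (U `&` f @^-1` (V `&` cdom c'))).
have oS : open S by exact: open_rep_dom'.
have Sp : S (c p) by exists p.
transitivity (coord_d (coord_pullback (rep c c' f) (local_form c' w)) (c p) v).
  apply: eq_bigr => i _; congr (_ * _); apply: near_eq_derive.
  apply: (nbhs_open_eq oS Sp) => y [q [cq [Uq [Vq c'q]]] yE].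
  by apply: local_form_pullback => //; exists q.
have aw' y : (c' @` (cdom c' `&` V)) y -> alternating (local_form c' w y).
  exact: alternating_local_form.
have sw'' B : smooth (c' @` (cdom c' `&` V)) (fun y => local_form c' w y B).
  exact: sw'.
have oV' : open (c' @` (cdom c' `&` V)) by exact: open_chart_image.
apply: etrans (coord_d_pullback oS (@rep_dom_sub c c') (smooth_rep_dom cA c'A)
  aw' sw'' v oV' Sp) _.
by rewrite /rep /= cfunK.
Qed.

End Pullback.

Lemma pullback_comp {R : realType} {m m' k : nat} {M : manifold R m}
    {M' : manifold R m'} (U : set M) (V : set M') (f : M -> M') (g : M' -> M)
    (w : dform M k) : diffeo_on U V f g ->
  eq_form_on U (pullback f (pullback g w)) w.
Proof.
move=> dfg p v Up; have [_ [_ _ gf _]] := dfg.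
by rewrite /pullback -mulmxA (tangent_map_diffeo dfg Up) mulmx1 gf.
Qed.

(** * Transport along diffeomorphisms *)

Lemma diffeo_restrict {R : realType} {m m' : nat} {M : manifold R m}
    {M' : manifold R m'} (U U' : set M) (V V' : set M') (f : M -> M')
    (g : M' -> M) :
  diffeo_on U V f g -> open U' -> open V' -> U' `<=` U -> V' `<=` V ->
  (forall p, U' p -> V' (f p)) -> (forall q, V' q -> U' (g q)) ->
  diffeo_on U' V' f g.
Proof.
move=> [[oU oV sf sg] [UV VU gf fg]] oU' oV' UU VV UV' VU'; split; split => //.
- exact: smooth_on_sub sf.
- exact: smooth_on_sub sg.
- by move=> p /UU; exact: gf.
- by move=> p /VV; exact: fg.
Qed.

Lemma open_preimageT {T T' : topologicalType} (f : T -> T') (W : set T') :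
  (forall p, {for p, continuous f}) -> open W -> open (f @^-1` W).
Proof.
move=> cf oW; rewrite -[_ @^-1` _]setTI.
by apply: open_preimage => //; exact: openT.
Qed.

Lemma mulmx_coef (R : pzSemiRingType) m n p (A : 'M[R]_(m, n))
    (B : 'M[R]_(n, p)) i j : (A *m B) i j = \sum_l A i l * B l j.
Proof. by rewrite mxE. Qed.

Section PushForward.
Context {R : realType} {m m' : nat} {M : manifold R m} {M' : manifold R m'}.
Variables (U : set M) (W : set M') (f : M -> M') (g : M' -> M).
Hypothesis dfg : diffeo_on U W f g.

Let oU : open U. Proof. by have [[]] := dfg. Qed.
Let oW : open W. Proof. by have [[]] := dfg. Qed.
Let sf : smooth_on U f. Proof. by have [[]] := dfg. Qed.
Let sg : smooth_on W g. Proof. by have [[]] := dfg. Qed.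
Let WU q : W q -> U (g q). Proof. by have [_ [_ + _ _]] := dfg; apply. Qed.
Definition push_forms (g : M' -> M) (W : set M') (J : graded_forms M) :
    graded_forms M' :=
  fun k b => exists2 a : dform M k, J k a & eq_form_on W b (pullback g a).

Lemma smooth_form_pull k (a : dform M k) :
  smooth_form U a -> smooth_form W (pullback g a).
Proof.
move=> sa; apply: smooth_form_sub (smooth_form_pullback oW oU sg sa).
by move=> q Wq; split=> //; exact: WU.
Qed.

Lemma ext_d_pull k (a : dform M k) : smooth_form U a ->
  eq_form_on W (ext_d (pullback g a)) (pullback g (ext_d a)).
Proof.
by move=> sa q v Wq; apply: (ext_d_pullback oW oU sg _ sa) => //; exact: WU.
Qed.

Lemma eq_form_wedge k l (a a' : dform M' k) (b b' : dform M' l) :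
  eq_form_on W a a' -> eq_form_on W b b' ->
  eq_form_on W (wedge a b) (wedge a' b').
Proof.
move=> aa bb q v Wq; congr (_ * _); apply: eq_bigr => s _.
by rewrite aa// bb.
Qed.

Lemma eq_form_pull k (a b : dform M k) :
  eq_form_on U a b -> eq_form_on W (pullback g a) (pullback g b).
Proof. by move=> ab q v Wq; apply: ab; exact: WU. Qed.

End PushForward.

Section PushIdeal.
Context {R : realType} {m m' : nat} {M : manifold R m} {M' : manifold R m'}.
Variables (U : set M) (W : set M') (f : M -> M') (g : M' -> M).
Hypothesis dfg : diffeo_on U W f g.
Let dgf : diffeo_on W U g f. Proof. exact: diffeo_sym. Qed.
Let oU : open U. Proof. by have [[]] := dfg. Qed.
Let oW : open W. Proof. by have [[]] := dfg. Qed.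

(** Closure under products is the point to check: a multiplier [b] on the target is arbitrary, but
    it coincides on [W] with g^* f^* b and so is itself a pullback. *)
Lemma ideal_on_push J : ideal_on U J -> ideal_on W (push_forms g W J).
Proof.
move=> [J1 J2 J3 J4 J5]; split.
- move=> k b [a Ja ab];
    apply: smooth_form_ext oW _ (smooth_form_pull dfg (J1 _ _ Ja)).
  by move=> q v Wq; rewrite ab.
- by move=> k a b [a0 Ja0 aa0] _ ab; exists a0 => // q v Wq; rewrite -ab// aa0.
- by move=> k; exists zero_form => //; exact: J3.
- move=> k a b [a0 Ja0 aa0] [b0 Jb0 bb0].
  exists (add_form a0 b0); first exact: J4.
  by move=> q v Wq; rewrite /add_form aa0// bb0.
- move=> k l a b [a0 Ja0 aa0] sb; have spb := smooth_form_pull dgf sb.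
  have [Jl Jr] := J5 _ _ _ _ Ja0 spb.
  have bE : eq_form_on W b (pullback g (pullback f b)).
    by move=> q v Wq; rewrite (pullback_comp _ dgf).
  split.
    exists (wedge a0 (pullback f b)) => // q v Wq; rewrite pullback_wedge.
    exact: (eq_form_wedge aa0 bE).
  exists (wedge (pullback f b) a0) => // q v Wq; rewrite pullback_wedge.
  exact: (eq_form_wedge bE aa0).
Qed.

End PushIdeal.

Section PushGenerators.
Context {R : realType} {m m' n : nat} {M : manifold R m} {M' : manifold R m'}.
Variables (U : set M) (W : set M') (f : M -> M') (g : M' -> M).
Hypothesis dfg : diffeo_on U W f g.
Let dgf : diffeo_on W U g f. Proof. exact: diffeo_sym. Qed.

(** [ideal_gen] is an intersection of ideals. An ideal on [W] containing the pulled-back generators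
    is carried by [f] to an ideal on [U] containing t, dt and w, hence containing [a]. *)
Lemma ideal_gen_pull k (t : dform M 1) (w : dform M n) (a : dform M k) :
  smooth_form U t -> @ideal_gen _ _ _ n U t w k a ->
  @ideal_gen _ _ _ n W (pullback g t) (pullback g w) k (pullback g a).
Proof.
move=> st Ga J' iJ' Jt Jdt Jw.
have [J1 J2 _ _ _] := iJ'.
have iJ := ideal_on_push dgf iJ'.
have [K1 _ _ _ _] := iJ.
have pE l (b : dform M l) : eq_form_on U b (pullback f (pullback g b)).
  by move=> q v Uq; rewrite (pullback_comp _ dfg).
have Ja : push_forms f U J' a.
  apply: Ga => //; [by exists (pullback g t)| |by exists (pullback g w)].
  exists (ext_d (pullback g t)); first exact: Jdt.
  move=> q v Uq; apply: etrans (pE _ (ext_d t) q v Uq) _.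
  exact: esym (eq_form_pull dgf (ext_d_pull dfg st) v Uq).
have [b Jb ab] := Ja.
apply: J2 Jb _ _; first by apply: (smooth_form_pull dfg); exact: K1.
move=> q v Wq; rewrite (eq_form_pull dfg ab)//.
by rewrite (pullback_comp _ dgf).
Qed.

End PushGenerators.

Section Transport.
Context {R : realType} {m : nat} {M M' : manifold R m}.
Variables (f : M -> M') (g : M' -> M).
Hypothesis dfg : diffeo_on setT setT f g.

Let gf p : g (f p) = p. Proof. by have [_ [_ _ + _]] := dfg; apply. Qed.
Let fg q : f (g q) = q. Proof. by have [_ [_ _ _ +]] := dfg; apply. Qed.
Let cf p : {for p, continuous f}.
Proof. by have [[_ _ [+ _] _] _] := dfg; apply. Qed.
Let cg p : {for p, continuous g}.
Proof. by have [[_ _ _ [+ _]] _] := dfg; apply. Qed.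

Lemma open_preimage_diffeo (W : set M') : open W -> open (f @^-1` W).
Proof. exact: open_preimageT. Qed.

Lemma diffeo_on_preimage (W : set M') : open W ->
  diffeo_on (f @^-1` W) W f g.
Proof.
move=> oW; apply: (diffeo_restrict dfg) => //;
  first exact: open_preimage_diffeo.
by move=> q Wq; rewrite /= fg.
Qed.

Lemma ideal_on_transport (I : form_sheaf M) W : eds I -> open W ->
  ideal_on W (transport f g I W).
Proof.
move=> [eI _ _ _] oW.
apply: (ideal_on_push (diffeo_on_preimage oW)); apply: eI.
exact: open_preimage_diffeo.
Qed.

Lemma eds_transport (I : form_sheaf M) : eds I -> eds (transport f g I).
Proof.
move=> eI; have [I1 I2 I3 I4] := eI; split.
- by move=> W oW; exact: ideal_on_transport.
- move=> W k b oW [a Ia ab]; have oU := open_preimage_diffeo oW.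
  exists (ext_d a); first exact: I2.
  have [J1 _ _ _ _] := I1 _ oU.
  move=> q v Wq; rewrite (ext_d_ext _ oW ab Wq).
  exact: (ext_d_pull (diffeo_on_preimage oW) (J1 _ _ Ia)).
- move=> W V k b oW oV VW [a Ia ab]; exists a.
    apply: I3 Ia; [exact: open_preimage_diffeo|exact: open_preimage_diffeo|].
    by move=> p /VW.
  by move=> q v /VW Wq; exact: ab.
(* Gluing: the local preimages of [b] need not be compared with one another, since each agrees with
   the single form f^* b. *)
- move=> W k b oW loc; exists (pullback f b); last first.
    move=> q v Wq; rewrite (@pullback_comp _ _ _ _ _ _ setT setT)//.
    exact: diffeo_sym.
  apply: I4; first exact: open_preimage_diffeo.
  move=> p Wp; have [V [oV Vp VW [a Ia ab]]] := loc _ Wp.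
  have oV' := open_preimage_diffeo oV.
  exists (f @^-1` V); split => //; first by move=> q /VW.
  have [J1 J2 _ _ _] := I1 _ oV'.
  have E : eq_form_on (f @^-1` V) a (pullback f b).
    move=> q v Vq; rewrite /pullback ab//.
    exact: esym (pullback_comp a (diffeo_on_preimage oV) v Vq).
  by apply: (J2 _ _ _ Ia _ E); apply: (smooth_form_ext oV' E); exact: J1.
Qed.

(** The image of [E] under the differential of [f], written as a preimage under the differential of
    [g]; membership then involves no existential. *)
Definition push_field (g : M' -> M) (E : plane_field M) : plane_field M' :=
  fun q => [set v | E (g q) (v *m tangent_map g q)].

Let Tfg p : tangent_map f p *m tangent_map g (f p) = 1%:M.
Proof. exact: tangent_map_diffeo dfg _. Qed.

Let Tgf q : tangent_map g q *m tangent_map f (g q) = 1%:M.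
Proof. exact: tangent_map_diffeo (diffeo_sym dfg) _. Qed.

Let Tfg' q : tangent_map f (g q) *m tangent_map g q = 1%:M.
Proof. by apply: mulmx1C; exact: Tgf. Qed.

Lemma tangent_onto_push (E : plane_field M) (E' : plane_field M') :
  (forall p, tangent_onto f p (E p) (E' (f p))) <-> E' = push_field g E.
Proof.
split=> [EE|-> p].
  apply/funext => q; have := EE (g q); rewrite fg => <-.
  apply/seteqP; split=> [_ [v Ev <-]|v /= Ev] /=.
    by rewrite /push_field/= -mulmxA Tfg' mulmx1.
  by exists (v *m tangent_map g q) => //; rewrite -mulmxA Tgf mulmx1.
apply/seteqP; split=> [_ [v Ev <-]|v /= Ev] /=.
  by rewrite /push_field/= -mulmxA Tfg mulmx1 gf.
move: Ev; rewrite /push_field/= gf => Ev.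
exists (v *m tangent_map g (f p)) => //; rewrite -mulmxA.
by rewrite (mulmx1C (Tfg p)) mulmx1.
Qed.

(** A local frame of the image is the frame of [E] at [g q] followed by the differential of [f]. *)
Lemma subbundle_push r (E : plane_field M) :
  subbundle r E -> subbundle r (push_field g E).
Proof.
move=> sE q0; have [U [X [oU Uq0 XE sX]]] := sE (g q0).
have oU' : open (g @^-1` U) by exact: open_preimageT.
exists (g @^-1` U), (fun q => X (g q) *m tangent_map f (g q)); split => //.
  move=> q Uq; have [Xf EX] := XE _ Uq; split.
    rewrite /row_free mxrankMfree//.
    by apply/row_freeP; exists (tangent_map g q); exact: Tfg'.
  apply/seteqP; split=> v /=; rewrite /push_field/= EX/= => vX.
    have := submxMr (tangent_map f (g q)) vX.
    by rewrite -mulmxA Tgf mulmx1.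
  have := submxMr (tangent_map g q) vX.
  by rewrite -mulmxA Tfg' mulmx1.
move=> c' i c'A j; apply: smooth_local => _ [q [c'q Uq] <-].
pose c := chart_at M (g q).
have cA : atlas M c by exact: atlas_chart_at.
pose S := c' @` (cdom c' `&` (g @^-1` (U `&` cdom c))).
have oS : open S.
  apply: open_chart_image; apply: open_preimageT => //; apply: openI => //.
  exact: open_cdom.
exists S; first by exists q => //; do !split => //; exact: cdom_chart_at.
have [[_ _ sf sg] _] := dfg.
have sgS : smooth_map S (rep c' c g).
  move=> l; apply: smooth_sub (smooth_rep sg c'A cA l).
  by move=> _ [p [c'p [Up cp]] <-]; exists p.
have SS y : S y -> (c @` (cdom c `&` U)) (rep c' c g y).
  by move=> [p [c'p [Up cp]] <-]; exists (g p) => //; rewrite /rep /= cfunK.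
have SS' y : S y -> (c @` (cdom c `&` setT `&` f @^-1` cdom c')) (rep c' c g y).
  move=> [p [c'p [Up cp]] <-]; exists (g p); last by rewrite /rep /= cfunK.
  by do !split => //=; rewrite fg.
(* The frame of the image in the chart [c'] is the frame of [E] in the fixed chart [c], times the
   Jacobian of [f] read from [c] to [c']: both factors are smooth, and the preferred charts have
   cancelled. *)
pose F y := \sum_l (row i (X (cinv c (rep c' c g y)) *m
     to_chart c (cinv c (rep c' c g y)))) 0 l *
     jacobian (rep c c' f) (rep c' c g y) l j.
apply: (@smooth_ext _ _ _ F) => //.
  move=> _ [p [c'p [Up cp]] <-].
  have E0 : rep c' c g (c' p) = c (g p) by rewrite /rep/= cfunK.
  rewrite /F E0 (cfunK cp) (cfunK c'p).
  have JE : jacobian (rep c c' f) (c (g p)) =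
      from_chart c (g p) *m tangent_map f (g p) *m to_chart c' p.
    have c'fg : cdom c' (f (g p)) by rewrite fg.
    rewrite (from_chart_tangent_map openT sf cA c'A cp I c'fg) fg.
    move: (jacobian (rep _ _ _) _) => J.
    by rewrite -(mulmxA J) (from_chartK c'A c'p) mulmx1.
  rewrite -[RHS]/(row i (X (g p) *m tangent_map f (g p) *m to_chart c' p) 0 j).
  have -> : X (g p) *m tangent_map f (g p) *m to_chart c' p =
      X (g p) *m to_chart c (g p) *m jacobian (rep c c' f) (c (g p)).
    rewrite JE; move: (to_chartK cA cp); move: (tangent_map f _) (to_chart c _).
    move: (from_chart c _) (to_chart c' _) (X (g p)) => A1 A2 A3 A4 A5 A51.
    by rewrite !mulmxA -(mulmxA A3 A5 A1) A51 mulmx1.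
  rewrite [in RHS]row_mul.
  exact: esym (mulmx_coef _ _ 0 j).
apply: smooth_sum => // l _; apply: smoothM => //.
  exact: (smooth_comp oS SS sgS (sX c i cA l)).
apply: (@smooth_comp _ _ _ _ _ (rep c' c g) (fun y => jacobian (rep c c' f) y l
  j) oS SS' sgS).
apply: smooth_jacobian; last exact: smooth_rep.
exact: (open_rep_dom openT sf).
Qed.

End Transport.

(** A 2-form takes a matrix with 2 rows whereas [col_mx u v] has 1 + 1 of them; the types are
    convertible, but rewriting needs this form. *)
Lemma mul_col_mx2 (R : pzSemiRingType) m n (u v : 'rV[R]_m) (T : 'M[R]_(m, n)) :
  @mulmx _ 2 _ _ (col_mx u v) T = col_mx (u *m T) (v *m T).
Proof. exact: (@mul_col_mx _ 1 1). Qed.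

Section PushFields.
Context {R : realType} {m : nat} {M M' : manifold R m}.
Variables (f : M -> M') (g : M' -> M).
Hypothesis dfg : diffeo_on setT setT f g.

Lemma diffeoTK p : g (f p) = p.
Proof. by have [_ [_ _ gf _]] := dfg; exact: gf. Qed.

Lemma tangent_mapK p : tangent_map f p *m tangent_map g (f p) = 1%:M.
Proof. exact: (tangent_map_diffeo dfg). Qed.

Lemma tangent_mapVK p : tangent_map g (f p) *m tangent_map f p = 1%:M.
Proof. by apply: mulmx1C; exact: tangent_mapK. Qed.

Lemma push_fieldK (E : plane_field M) : push_field f (push_field g E) = E.
Proof.
apply/funext => p; apply/funext => v; rewrite /push_field /=.
by rewrite -mulmxA tangent_mapK mulmx1 diffeoTK.
Qed.

End PushFields.

(** * Contact forms and Monge--Ampère systems under a diffeomorphism *)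

Section PushContact.
Context {R : realType} {n : nat} {M M' : manifold R (2 * n).+1}.
Variables (f : M -> M') (g : M' -> M).
Hypothesis dfg : diffeo_on setT setT f g.
Let dgf : diffeo_on setT setT g f. Proof. exact: diffeo_sym. Qed.
Let fg q : f (g q) = q. Proof. exact: (diffeoTK dgf). Qed.

Lemma open_push (U : set M) : open U -> open (g @^-1` U).
Proof. exact: (open_preimage_diffeo dgf). Qed.

Lemma diffeo_push (U : set M) : open U -> diffeo_on U (g @^-1` U) f g.
Proof. by move=> oU; apply/diffeo_sym/(diffeo_on_preimage dgf). Qed.

Lemma contact_form_push (D : plane_field M) U (t : dform M 1) :
  contact_form D U t ->
  contact_form (push_field g D) (g @^-1` U) (pullback g t).
Proof.
move=> [oU st Dt nd]; have dU := diffeo_push oU; split.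
- exact: open_push.
- exact: (smooth_form_pull dU).
- by move=> q Uq; rewrite /push_field Dt.
move=> q u Uq Du ndu.
have TV := tangent_mapVK dgf q; have TK := tangent_mapK dgf q.
have Eu : u *m tangent_map g q = 0.
  apply: (nd _ _ Uq Du) => v Dv.
  have Dv' : push_field g D q (v *m tangent_map f (g q)).
    by rewrite /push_field /= -mulmxA TV mulmx1.
  have := ndu _ Dv'; rewrite (ext_d_pull dU st _ Uq) /pullback mul_col_mx2.
  by rewrite -(mulmxA v) TV mulmx1.
rewrite -[u]mulmx1 -TK mulmxA.
by move: Eu; move: (tangent_map g q) => T ->; rewrite mul0mx.
Qed.

End PushContact.

Section PushMongeAmpere.
Context {R : realType} {n : nat} {M M' : manifold R (2 * n).+1}.
Variables (f : M -> M') (g : M' -> M).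
Hypothesis dfg : diffeo_on setT setT f g.
Let dgf : diffeo_on setT setT g f. Proof. exact: diffeo_sym. Qed.
Let fg q : f (g q) = q. Proof. exact: (diffeoTK dgf). Qed.
Let gf p : g (f p) = p. Proof. exact: (diffeoTK dfg). Qed.

(** [isotropic] quantifies over the contact forms of the image, so the given form is pulled back to
    [M] by [f], where the hypothesis applies. *)
Lemma isotropic_push (D E : plane_field M) :
  isotropic D E -> isotropic (push_field g D) (push_field g E).
Proof.
move=> iE W t' ct' q u v Wq Eu Ev; have [oW st' _ _] := ct'.
have ct := contact_form_push dgf ct'; rewrite (push_fieldK dfg) in ct.
have dW := diffeo_push dgf oW.
have TK := tangent_mapK dgf q.
have fgq : (f @^-1` W) (g q) by rewrite /= fg.
have := iE _ _ ct (g q) _ _ fgq Eu Ev.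
rewrite (ext_d_pull dW st' _ fgq) /pullback mul_col_mx2 -!mulmxA TK !mulmx1.
by rewrite fg.
Qed.

Lemma direct_sum_push (D E1 E2 : plane_field M) :
  direct_sum D E1 E2 ->
  direct_sum (push_field g D) (push_field g E1) (push_field g E2).
Proof.
move=> dE q; have [DE E0] := dE (g q).
have TV := tangent_mapVK dgf q; have TK := tangent_mapK dgf q.
split; apply/seteqP; split.
- move=> v; rewrite /push_field /= DE => -[v1 E1v [v2 E2v E]].
  exists (v1 *m tangent_map f (g q)); first by rewrite /= -mulmxA TV mulmx1.
  exists (v2 *m tangent_map f (g q)); first by rewrite /= -mulmxA TV mulmx1.
  by rewrite -mulmxDl E -mulmxA TK mulmx1.
- move=> _ [v1 E1v [v2 E2v <-]]; rewrite /push_field /= DE mulmxDl.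
  by exists (v1 *m tangent_map g q) => //; exists (v2 *m tangent_map g q).
- move=> v [E1v E2v]; have :
    (E1 (g q) `&` E2 (g q)) (v *m tangent_map g q) by [].
  rewrite E0 /= => v0; rewrite -[v]mulmx1 -TK mulmxA.
  by move: v0; move: (tangent_map g q) => T ->; rewrite mul0mx.
- move=> v /= ->; have : [set 0] (0 : 'rV[R]_(2 * n).+1) by [].
  by rewrite -E0 /push_field /= mul0mx.
Qed.

Lemma lagrangian_pair_push (D E1 E2 : plane_field M) :
  lagrangian_pair D E1 E2 ->
  lagrangian_pair (push_field g D) (push_field g E1) (push_field g E2).
Proof.
move=> [s1 s2 i1 i2 ds]; split.
- exact: (subbundle_push dfg).
- exact: (subbundle_push dfg).
- exact: isotropic_push.
- exact: isotropic_push.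
- exact: direct_sum_push.
Qed.

Lemma generated_in (I : form_sheaf M) U (t : dform M 1) (w : dform M n) :
  open U -> generated_on I U t w ->
  [/\ I U 1%N t, I U 2%N (ext_d t) & I U n w].
Proof.
move=> oU gU; have gUU := gU U oU (@subset_refl _ U).
by split; apply/gUU => J iJ Jt Jdt Jw.
Qed.

Lemma generated_on_sub (I : form_sheaf M) U V (t : dform M 1) (w : dform M n) :
  V `<=` U -> generated_on I U t w -> generated_on I V t w.
Proof. by move=> VU gU V' oV' V'V; apply: gU => // p /V'V /VU. Qed.

(** Both inclusions rest on [ideal_gen] being the smallest ideal: a form of the transported system
    is the pullback of an element generated by t, dt and w, and the transported system is itself an
    ideal containing the three pulled-back generators. *)
Lemma local_generator_push (D : plane_field M) (I : form_sheaf M) U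
    (t : dform M 1) (w : dform M n) : eds I ->
  local_generator D I U t w ->
  local_generator (push_field g D) (transport f g I) (g @^-1` U)
    (pullback g t) (pullback g w).
Proof.
move=> eI [ct sw gU]; have [oU st _ _] := ct.
have dU := diffeo_push dfg oU; split.
- exact: (contact_form_push dfg).
- exact: (smooth_form_pull dU).
move=> V' oV' V'U k b; have dV := diffeo_on_preimage dfg oV'.
have oV : open (f @^-1` V') by exact: (open_preimage_diffeo dfg).
have VU : f @^-1` V' `<=` U by move=> p /V'U /=; rewrite gf.
have gV := gU _ oV VU.
have iV := ideal_on_transport dfg eI oV'.
have [T1 _ _ _ _] := iV.
have stV : smooth_form (f @^-1` V') t by exact: smooth_form_sub st.
split=> [Tb|Gb].
  have sb := T1 _ _ Tb; have [a Ia ab] := Tb.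
  have Ga : @ideal_gen _ _ _ n (f @^-1` V') t w k a by apply/gV.
  move=> J iJ Jt Jdt Jw; have Ja := ideal_gen_pull dV stV Ga iJ Jt Jdt Jw.
  have [_ J2 _ _ _] := iJ; apply: (J2 _ _ _ Ja sb).
  by move=> q v V'q; rewrite ab.
have [It Idt Iw] := generated_in oV (generated_on_sub VU gU).
apply: Gb iV _ _ _.
- by exists t.
- by exists (ext_d t); [exact: Idt|exact: (ext_d_pull dV stV)].
- by exists w.
Qed.

Lemma monge_ampere_push (D : plane_field M) (I : form_sheaf M) :
  monge_ampere D I -> monge_ampere (push_field g D) (transport f g I).
Proof.
move=> [eI lI]; split; first exact: (eds_transport dfg).
move=> q; have [U [t [w [Uq lg]]]] := lI (g q).
exists (g @^-1` U), (pullback g t), (pullback g w); split => //.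
exact: local_generator_push.
Qed.

Lemma bi_decomposing_push U (E1 E2 : plane_field M) (w1 w2 : dform M n) :
  open U -> bi_decomposing U E1 E2 w1 w2 ->
  bi_decomposing (g @^-1` U) (push_field g E1) (push_field g E2)
    (pullback g w1) (pullback g w2).
Proof.
move=> oU [s1 s2 bd]; have dU := diffeo_push dfg oU; split.
- exact: (smooth_form_pull dU).
- exact: (smooth_form_pull dU).
move=> q Uq; have [b1 b2 b3 b4] := bd _ Uq.
have TV := tangent_mapVK dgf q.
have iz (w : dform M n) u :
    interior_zero (g q) (u *m tangent_map g q) w ->
    interior_zero q u (pullback g w).
  move=> iw v i i0 vi; apply: (iw _ i i0); rewrite row_mul.
  by rewrite vi.
have vol E (w : dform M n) : volume_on (g q) E w ->
    volume_on q (push_field g E) (pullback g w).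
  move=> [v [Ev wv]]; exists (v *m tangent_map f (g q)); split.
    by move=> i; rewrite /push_field /= row_mul -mulmxA TV mulmx1.
  by rewrite /pullback -mulmxA TV mulmx1.
split.
- by move=> u E2u; apply: iz; exact: b1.
- by move=> u E1u; apply: iz; exact: b2.
- exact: vol.
- exact: vol.
Qed.

Lemma monge_ampere_pair_push (D : plane_field M) (I : form_sheaf M) E1 E2 :
  monge_ampere_pair D I E1 E2 ->
  monge_ampere_pair (push_field g D) (transport f g I)
    (push_field g E1) (push_field g E2).
Proof.
move=> [ma lp loc]; split.
- exact: monge_ampere_push.
- exact: lagrangian_pair_push.
move=> q; have [U [t [w1 [w2 [Uq lg bd]]]]] := loc (g q).
have [[oU _ _ _] _ _] := lg.
exists (g @^-1` U), (pullback g t), (pullback g w1), (pullback g w2).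
split => //; last exact: bi_decomposing_push.
by have [eI _] := ma; exact: (local_generator_push eI lg).
Qed.

Lemma tangent_onto_comp m (N : manifold R m) U (h : M -> N)
    (E : plane_field M) (B : set 'rV[R]_m) q :
  open U -> smooth_on U h -> U (g q) -> tangent_onto h (g q) (E (g q)) B ->
  tangent_onto (h \o g) q (push_field g E q) B.
Proof.
move=> oU sh Uq <-; have [[_ oT _ sg] _] := dfg.
have TV := tangent_mapVK dgf q.
rewrite /tangent_onto (tangent_map_comp oT sg sh I Uq).
apply/seteqP; split=> [_ [v Ev <-]|_ [v Ev <-]].
  by rewrite mulmxA; exists (v *m tangent_map g q).
exists (v *m tangent_map f (g q)).
  by rewrite /push_field /= -mulmxA TV mulmx1.
by rewrite mulmxA -(mulmxA v) TV mulmx1.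
Qed.

Lemma diffeo_on_comp m (N : manifold R m) U V (h : M -> N) (k : N -> M) :
  diffeo_on U V h k -> diffeo_on (g @^-1` U) V (h \o g) (f \o k).
Proof.
move=> [[oU oV sh sk] [UV VU kh hk]]; have [[oT _ sf sg] _] := dfg.
split; split => //.
- exact: (open_push dfg).
- apply: smooth_on_sub (smooth_on_comp openT sg oU sh).
  by move=> q Uq; split.
- apply: smooth_on_sub (smooth_on_comp oV sk openT sf).
  by move=> q Uq; split.
- by move=> q Uq; exact: UV.
- by move=> q Vq; rewrite /= gf; exact: VU.
- by move=> q Uq; rewrite /= kh.
- by move=> q Vq; rewrite /= gf hk.
Qed.

Lemma flat_push (D E1 E2 : plane_field M) : flat D E1 E2 ->
  flat (push_field g D) (push_field g E1) (push_field g E2).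
Proof.
move=> fl q; have [U [V [h [k [Uq dhk hE]]]]] := fl (g q).
exists (g @^-1` U), V, (h \o g), (f \o k); split => //.
  exact: diffeo_on_comp.
have [[oU _ sh _] _] := dhk.
move=> q' Uq'; have [hD h1 h2] := hE _ Uq'; split.
- exact: (tangent_onto_comp oU sh Uq' hD).
- exact: (tangent_onto_comp oU sh Uq' h1).
- exact: (tangent_onto_comp oU sh Uq' h2).
Qed.

Lemma hesse_pair_push (D : plane_field M) (I : form_sheaf M) E1 E2 :
  hesse_pair D I E1 E2 ->
  hesse_pair (push_field g D) (transport f g I)
    (push_field g E1) (push_field g E2).
Proof.
by move=> [ma fl]; split; [exact: monge_ampere_pair_push|exact: flat_push].
Qed.

Lemma zero_mod_push U (t : dform M 1) (w : dform M n) :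
  open U -> smooth_form U w -> zero_mod U t (ext_d w) ->
  zero_mod (g @^-1` U) (pullback g t) (ext_d (pullback g w)).
Proof.
move=> oU sw [b sb tb]; have dU := diffeo_push dfg oU.
exists (pullback g b); first exact: (smooth_form_pull dU).
move=> q v Uq; rewrite (ext_d_pull dU sw _ Uq) -pullback_wedge.
exact: (eq_form_pull dU tb).
Qed.

Lemma euler_lagrange_pair_push (D : plane_field M) (I : form_sheaf M) E1 E2 :
  euler_lagrange_pair D I E1 E2 ->
  euler_lagrange_pair (push_field g D) (transport f g I)
    (push_field g E1) (push_field g E2).
Proof.
move=> [he loc]; split; first exact: hesse_pair_push.
move=> q; have [U [t [w1 [w2 [Uq lg bd z1 z2]]]]] := loc (g q).
have [[oU _ _ _] _ _] := lg; have [s1 s2 _] := bd.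
have [[[eI _] _ _] _] := he.
exists (g @^-1` U), (pullback g t), (pullback g w1), (pullback g w2).
split; first exact: Uq.
- exact: (local_generator_push eI lg).
- exact: (bi_decomposing_push oU bd).
- exact: (zero_mod_push oU s1 z1).
- exact: (zero_mod_push oU s2 z2).
Qed.

End PushMongeAmpere.

Section ContactInvariance.
Context {R : realType} {n : nat} {M M' : manifold R (2 * n).+1}.
Variables (D : plane_field M) (D' : plane_field M') (I : form_sheaf M).
Variables (f : M -> M') (g : M' -> M).
Hypothesis cfg : contactomorphism D D' f g.

Lemma contactomorphism_push : D' = push_field g D.
Proof. by have [dfg onto] := cfg; exact: (tangent_onto_push dfg _ _).1. Qed.

Lemma hesse_transport : hesse D I -> hesse D' (transport f g I).
Proof.
move=> [E1 [E2 he]]; have [dfg _] := cfg; rewrite contactomorphism_push.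
by exists (push_field g E1), (push_field g E2); exact: hesse_pair_push.
Qed.

Lemma euler_lagrange_transport :
  euler_lagrange D I -> euler_lagrange D' (transport f g I).
Proof.
move=> [E1 [E2 he]]; have [dfg _] := cfg; rewrite contactomorphism_push.
by exists (push_field g E1), (push_field g E2); exact: euler_lagrange_pair_push.
Qed.

End ContactInvariance.

(** * Lagrangian splittings of a symplectic vector space *)

Section DotProduct.
Context {R : realFieldType} {n : nat}.
Implicit Types (x y p q : 'rV[R]_n).

Definition dot x p : R := (x *m p^T) 0 0.

Lemma dotC x p : dot x p = dot p x.
Proof. by rewrite /dot -[x in LHS]trmxK -trmx_mul mxE. Qed.

Lemma dotDl x y p : dot (x + y) p = dot x p + dot y p.
Proof. by rewrite /dot mulmxDl mxE. Qed.

Lemma dotZl a x p : dot (a *: x) p = a * dot x p.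
Proof. by rewrite /dot -scalemxAl mxE. Qed.

Lemma dotDr p x y : dot p (x + y) = dot p x + dot p y.
Proof. by rewrite dotC dotDl !(dotC p). Qed.

Lemma dotZr a p x : dot p (a *: x) = a * dot p x.
Proof. by rewrite dotC dotZl (dotC p). Qed.

Lemma dot0l p : dot 0 p = 0. Proof. by rewrite /dot mul0mx mxE. Qed.

Lemma dot0r p : dot p 0 = 0. Proof. by rewrite dotC dot0l. Qed.

Lemma dotE x p : x *m p^T = (dot x p)%:M.
Proof. by rewrite [LHS]mx11_scalar. Qed.

Lemma mul_outer x p q : x *m (p^T *m q) = dot x p *: q.
Proof. by rewrite mulmxA dotE mul_scalar_mx. Qed.

Lemma dot_eq0 x : (forall p, dot x p = 0) -> x = 0.
Proof.
move=> x0; apply/rowP => i; have := x0 'e_i.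
by rewrite /dot trmx_delta -colE !mxE.
Qed.

Lemma dot_row (X P : 'M[R]_n) i j : dot (row i X) (row j P) = (X *m P^T) i j.
Proof. by rewrite /dot !mxE; apply: eq_bigr => k _; rewrite !mxE. Qed.

(** A sum of two matrices of rank at most one has rank at most two, less than [n]. *)
Lemma det_outer (p q : 'rV[R]_n) (s t : R) : (2 < n)%N ->
  \det (s *: (p^T *m p) + t *: (q^T *m q)) = 0.
Proof.
move=> n2; set S := _ + _; apply/eqP/negPn/negP => Su.
have : S \in unitmx by rewrite unitmxE unitfE.
move=> /mxrank_unit rS;
  have r1 (c : R) (u : 'rV[R]_n) : (\rank (c *: (u^T *m u)) <= 1)%N.
  by rewrite scalemxAl (leq_trans (mxrankM_maxl _ _))// rank_leq_col.
have := leq_trans (mxrank_add _ _) (leq_add (r1 s p) (r1 t q)).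
by rewrite -/S rS addn1 leqNgt n2.
Qed.

Lemma det_eq0_mul (A : 'M[R]_n) y : y != 0 -> y *m A = 0 -> \det A = 0.
Proof. by move=> y0 yA; apply/eqP/det0P; exists y. Qed.

Lemma exists_ortho (c : 'cV[R]_n) : (1 < n)%N ->
  exists2 z : 'rV[R]_n, z != 0 & z *m c = 0.
Proof.
move=> n1; have : kermx c != 0.
  rewrite -mxrank_eq0 mxrank_ker -lt0n subn_gt0.
  by rewrite (leq_ltn_trans (rank_leq_col _)).
move=> /rowV0Pn[z zc z0]; exists z => //; exact/sub_kermxP.
Qed.

End DotProduct.

Section LagrangianSplitting.
Context {R : realFieldType} {n : nat}.
Hypothesis n3 : (2 < n)%N.
Variables (X1 P1 X2 P2 : 'M[R]_n) (a b : R).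
Hypotheses (a0 : a != 0) (b0 : b != 0).

(** Membership of (x, p) in the plane spanned by the rows of (X | P). *)
Definition in_lag (X P : 'M[R]_n) (x p : 'rV[R]_n) :=
  exists z, x = z *m X /\ p = z *m P.

Hypothesis iso1 : forall x p y q,
  in_lag X1 P1 x p -> in_lag X1 P1 y q -> dot x q = dot y p.
Hypothesis iso2 : forall x p y q,
  in_lag X2 P2 x p -> in_lag X2 P2 y q -> dot x q = dot y p.
Hypothesis dec : forall x p, exists x1 p1 x2 p2,
  [/\ in_lag X1 P1 x1 p1, in_lag X2 P2 x2 p2, x = x1 + x2 & p = p1 + p2].
(** All that is retained of the second generator: it vanishes on a Lagrangian plane meeting both of
    its members, hence so does the first one, whose value there is a det X - b det P. *)
Hypothesis zeros : forall (X P : 'M[R]_n) y1 y2, X *m P^T = P *m X^T ->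
  y1 != 0 -> in_lag X1 P1 (y1 *m X) (y1 *m P) ->
  y2 != 0 -> in_lag X2 P2 (y2 *m X) (y2 *m P) -> a * \det X = b * \det P.
Hypothesis nz1 : a * \det X1 != b * \det P1.
Hypothesis nz2 : a * \det X2 != b * \det P2.

Lemma in_lag_lin (X P : 'M[R]_n) c x p y q :
  in_lag X P x p -> in_lag X P y q -> in_lag X P (c *: x + y) (c *: p + q).
Proof.
move=> [z [-> ->]] [z' [-> ->]]; exists (c *: z + z').
by rewrite !mulmxDl !scalemxAl.
Qed.

(** The two planes span the space, and the symplectic form is non-degenerate. *)
Lemma lag_ortho x p :
  (forall y q, in_lag X1 P1 y q -> dot x q = dot y p) ->
  (forall y q, in_lag X2 P2 y q -> dot x q = dot y p) -> x = 0 /\ p = 0.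
Proof.
move=> o1 o2; have o y q : dot x q = dot y p.
  have [y1 [q1 [y2 [q2 [l1 l2 -> ->]]]]] := dec y q.
  by rewrite dotDl dotDr (o1 _ _ l1) (o2 _ _ l2).
split; apply: dot_eq0 => r; first by rewrite (o 0 r) dot0l.
by rewrite dotC -(o r 0) dot0r.
Qed.

(** The component of (x, p) in the second plane is orthogonal to the first plane by difference and
    to the second by isotropy, hence is zero. *)
Lemma lag_max x p :
  (forall y q, in_lag X1 P1 y q -> dot x q = dot y p) -> in_lag X1 P1 x p.
Proof.
move=> o1; have [x1 [p1 [x2 [p2 [l1 l2 xE pE]]]]] := dec x p.
have [x20 p20] : x2 = 0 /\ p2 = 0.
  apply: lag_ortho => y q l; last exact: iso2.
  have := o1 y q l; rewrite xE pE dotDl dotDr (iso1 l1 l).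
  by move=> /addrI.
by rewrite xE pE x20 p20 !addr0.
Qed.

(* The graph over one factor of a symmetric map of rank at most 2 is a
   Lagrangian plane on which exactly one of the two determinants vanishes. *)
Lemma graph_zeros_r x p y q kx kp (s : R) : in_lag X1 P1 x p ->
  dot x p != 0 -> in_lag X2 P2 kx kp -> kx = s *: x + y -> kp = s *: p + q ->
  dot y p = 0 -> dot x q = 0 -> kx != 0 -> (dot y q != 0 \/ q = 0) -> False.
Proof.
move=> l1 xp l2 kxE kpE yp xq kx0 yq.
(* The symmetric matrix sending [x] to [p] and [y] to [q]. If q = 0, the inverse of [dot y q] is 0
   by convention and the second term vanishes anyway. *)
pose S := (dot x p)^-1 *: (p^T *m p) + (dot y q)^-1 *: (q^T *m q).
have xS : x *m S = p.
  by rewrite mulmxDr -!scalemxAr !mul_outer xq scale0r scaler0 addr0 scalerA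
     mulVf// scale1r.
have yS : y *m S = q.
  rewrite mulmxDr -!scalemxAr !mul_outer yp scale0r scaler0 add0r.
  by case: yq => [yq|->]; [rewrite scalerA mulVf// scale1r|rewrite !scaler0].
have ST : S^T = S.
  by rewrite linearD !linearZ/= !trmx_mul !trmxK.
have x0 : x != 0 by apply: contraNneq xp => ->; rewrite dot0l.
have := @zeros 1%:M S x kx; rewrite !mulmx1 mul1mx ST trmx1 mulmx1 xS.
have -> : kx *m S = kp by rewrite kxE mulmxDl -scalemxAl xS yS kpE.
move=> /(_ erefl x0 l1 kx0 l2); rewrite det1 det_outer// mulr1 mulr0.
by move/eqP; rewrite (negbTE a0).
Qed.

(** The same argument with the two factors exchanged: the graph is taken over the p-factor, by a map
    sending [p] to [x] and killing [q]. The generator would be -b on it. *)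
Lemma graph_zeros_l x p q kx kp (s : R) : in_lag X1 P1 x p ->
  dot x p != 0 -> in_lag X2 P2 kx kp -> kx = s *: x -> kp = s *: p + q ->
  dot x q = 0 -> kp != 0 -> False.
Proof.
move=> l1 xp l2 kxE kpE xq kp0.
(* The zero summand only brings the matrix into the shape of [det_outer]. *)
pose T := (dot x p)^-1 *: (x^T *m x) + 0 *: (x^T *m x).
have pT : p *m T = x.
  rewrite mulmxDr -!scalemxAr !mul_outer scale0r addr0 scalerA.
  by rewrite (dotC p) mulVf// scale1r.
have qT : q *m T = 0.
  by rewrite mulmxDr -!scalemxAr !mul_outer (dotC q) xq !scale0r !scaler0 addr0.
have TT : T^T = T.
  by rewrite linearD !linearZ/= !trmx_mul !trmxK.
have p0 : p != 0 by apply: contraNneq xp => ->; rewrite dot0r.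
have := @zeros T 1%:M p kp; rewrite !mulmx1 mul1mx TT trmx1 mulmx1 pT.
have -> : kp *m T = kx by rewrite kpE mulmxDl -scalemxAl pT qT kxE addr0.
move=> /(_ erefl p0 l1 kp0 l2); rewrite det1 det_outer// mulr1 mulr0.
by move/esym/eqP; rewrite (negbTE b0).
Qed.

(* Otherwise let [K] be the orthogonal of [(x, p)] in the second plane; modulo
   [(x, p)] its vectors are pairs [(yy, qq)].  The graphs above rule out
   [dot yy qq != 0], so that [(yy, 0)] is orthogonal to [K] and to [(x, p)],
   hence lies in their span; they also rule out vectors with [yy = 0] or
   [qq = 0], so that [K = 0], which is impossible for dimension reasons. *)
Lemma lag_dot0 x p : in_lag X1 P1 x p -> dot x p = 0.
Proof.
move=> l1; apply/eqP/negPn/negP => xp.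
have x0 : x != 0 by apply: contraNneq xp => ->; rewrite dot0l.
have p0 : p != 0 by apply: contraNneq xp => ->; rewrite dot0r.
pose K kx kp := in_lag X2 P2 kx kp /\ dot x kp = dot kx p.
(* The multiple of (x, p) is chosen so that the remainder satisfies [dot yy p = 0]; orthogonality to
   (x, p) then yields [dot x qq = 0]. These are the side conditions of [graph_zeros_r]. *)
pose al kx := dot kx p / dot x p.
pose yy kx := kx - al kx *: x; pose qq kx kp := kp - al kx *: p.
have alE kx : al kx * dot x p = dot kx p by rewrite /al divfK.
have yyp kx : dot (yy kx) p = 0.
  by rewrite /yy -scaleNr dotDl dotZl mulNr alE subrr.
have xqq kx kp : K kx kp -> dot x (qq kx kp) = 0.
  by move=> [_ E]; rewrite /qq -scaleNr dotDr dotZr mulNr alE E subrr.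
have kxE kx : kx = al kx *: x + yy kx by rewrite addrC subrK.
have kpE kx kp : kp = al kx *: p + qq kx kp by rewrite addrC subrK.
have Kx0 kx kp : K kx kp -> kx = 0 -> kp = 0.
  move=> Kk kx0; have [l2 E] := Kk.
  case: (eqVneq kp 0) => // kp0; exfalso.
  by apply: (@graph_zeros_l x p kp kx kp 0) => //;
     rewrite ?kx0 ?scale0r ?add0r// E kx0 dot0l.
have yq0 kx kp : K kx kp -> dot (yy kx) (qq kx kp) = 0.
  move=> Kk; have [l2 _] := Kk; apply/eqP/negPn/negP => yq.
  case: (eqVneq kx 0) => [kx0|kx0].
    by move: yq; rewrite /qq (Kx0 _ _ Kk kx0) kx0 /yy /al dot0l mul0r !scale0r
       !subrr dot0l eqxx.
  apply: (graph_zeros_r l1 xp l2 (kxE kx) (kpE kx kp)) => //.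
  - exact: xqq.
  - by left.
have Klin c kx kp kx' kp' : K kx kp -> K kx' kp' ->
    K (c *: kx + kx') (c *: kp + kp').
  move=> [l E] [l' E']; split; first exact: in_lag_lin.
  by rewrite dotDl dotDr dotZl dotZr E E'.
have yyD c kx kx' : yy (c *: kx + kx') = c *: yy kx + yy kx'.
  rewrite /yy /al dotDl dotZl mulrDl -mulrA scalerDl scalerBr scalerA.
  by rewrite opprD addrACA.
have qqD c kx kp kx' kp' :
    qq (c *: kx + kx') (c *: kp + kp') = c *: qq kx kp + qq kx' kp'.
  rewrite /qq /al dotDl dotZl mulrDl -mulrA scalerDl scalerBr scalerA.
  by rewrite opprD addrACA.
have kE kx kx' kp' : K kx' kp' ->
    dot kx kp' = al kx * al kx' * dot x p + dot (yy kx) (qq kx' kp').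
  move=> Kk; rewrite {1}(kxE kx) {1}(kpE kx' kp') (dotDl (al kx *: x)).
  rewrite !(dotDr _ (al kx' *: p)) !(dotZl (al kx)) !(dotZr (al kx')).
  by rewrite yyp (xqq _ _ Kk) !mulr0 addr0 add0r mulrA.
(* Polarising [yq0] shows that two products add up to 0, and isotropy of the second plane shows that
   they are equal. *)
have yq kx kp kx' kp' : K kx kp -> K kx' kp' -> dot (yy kx) (qq kx' kp') = 0.
  move=> Kk Kk'; have := yq0 _ _ (Klin 1 _ _ _ _ Kk Kk').
  rewrite yyD qqD !scale1r (dotDl (yy kx)) !(dotDr _ (qq kx kp)).
  rewrite (yq0 _ _ Kk) (yq0 _ _ Kk') add0r addr0.
  have [l E] := Kk; have [l' E'] := Kk'; have := iso2 l l'.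
  rewrite (kE _ _ _ Kk') (kE _ _ _ Kk) (mulrC (al kx')) => /addrI ->.
  by move=> /eqP; rewrite -mulr2n mulrn_eq0/= => /eqP.
(* A vector of the second plane not orthogonal to (x, p): together with [K] it spans that plane.
   Without it, (x, p) would be orthogonal to both planes. *)
have [ex [ep [le ue]]] : exists ex ep,
    in_lag X2 P2 ex ep /\ dot ex p - dot x ep != 0.
  apply: contrapT => no; have [] : x = 0 /\ p = 0.
    apply: lag_ortho => y q l; first exact: iso1.
    apply/eqP/negPn/negP => xq; apply: no; exists y, q; split => //.
    by rewrite subr_eq0 eq_sym.
  by move=> x00; rewrite x00 eqxx in x0.
have Kyy kx kp : K kx kp -> yy kx = 0.
  move=> Kk; have [x1 [p1 [x2 [p2 [l1' l2' yE pE]]]]] := dec (yy kx) 0.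
  have K2 : K x2 p2.
    split=> //; have := yyp kx; rewrite yE dotDl => E.
    have := iso1 l1 l1'; have /eqP := esym pE;
      rewrite addrC addr_eq0 => /eqP ->.
    rewrite -scaleN1r dotZr mulN1r => ->.
    by apply/eqP; rewrite eq_sym -addr_eq0 addrC E.
  pose d := dot ex p - dot x ep.
  (* This constant makes (x1, p1) - c (x, p) orthogonal to (ex, ep); since the difference is also
     orthogonal to [K] and to the first plane, it is zero. *)
  have [c cd] : {c | c * d = dot ex p1 - dot x1 ep}.
    by exists ((dot ex p1 - dot x1 ep) / d); rewrite divfK.
  have [v1 v2] : x1 - c *: x = 0 /\ p1 - c *: p = 0.
    rewrite -!scaleNr ![_ + _ *: _]addrC; apply: lag_ortho => y q l.
      exact: (iso1 (in_lag_lin (- c) l1 l1') l).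
    (* The multiple of (ex, ep) whose subtraction moves (y, q) into [K]. *)
    have [r rd] : {r | r * d = dot y p - dot x q}.
      by exists ((dot y p - dot x q) / d); rewrite divfK.
    have Kr : K (- r *: ex + y) (- r *: ep + q).
      split; first exact: in_lag_lin.
      rewrite dotDl dotDr dotZl dotZr; apply/eqP; rewrite -subr_eq0.
      apply/eqP; transitivity (r * d - (dot y p - dot x q));
        last by rewrite rd subrr.
      by rewrite /d; ring.
    have [lr _] := Kr; have := yq _ _ _ _ Kk Kr;
      rewrite /qq -scaleNr dotDr dotZr yyp.
    rewrite mulr0 addr0 yE dotDl; have := iso2 l2' lr.
    have p2E : p2 = - p1 by apply/eqP; rewrite -addr_eq0 addrC -pE.
    rewrite p2E -(scaleN1r p1) => ->.
    rewrite dotZr mulN1r !dotDr !dotDl !dotZr !dotZl => E.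
    apply/eqP; rewrite -subr_eq0; apply/eqP.
    transitivity (- r * dot x1 ep + dot x1 q - (- r * dot ex p1 + dot y p1)
       + r * (dot x1 ep - dot ex p1) + c * (dot y p - dot x q)); first by ring.
    rewrite E add0r -rd -opprB -cd; ring.
  have x1E : x1 = c *: x by apply/eqP; rewrite -subr_eq0 v1.
  have p1E : p1 = c *: p by apply/eqP; rewrite -subr_eq0 v2.
  have x2E : x2 = - c *: x + yy kx by rewrite yE x1E addrA scaleNr addNr add0r.
  have p2E : p2 = - c *: p + 0.
    by apply/eqP; rewrite addr0 scaleNr -addr_eq0 addrC -p1E -pE.
  (* Now (x2, p2) = -c (x, p) + (yy, 0), which is the case q = 0 of [graph_zeros_r] unless x2 = 0;
     in that event p2 = 0, so c = 0 and yy = 0. *)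
  case: (eqVneq x2 0) => [x20|x20]; last first.
    have [l2'' _] := K2.
    by case: (graph_zeros_r l1 xp l2'' x2E p2E) => //; [rewrite dot0r|right].
  have := Kx0 _ _ K2 x20; rewrite p2E addr0 => /eqP;
    rewrite scaler_eq0 oppr_eq0.
  rewrite (negbTE p0) orbF => /eqP c0.
  by move: x2E; rewrite x20 c0 oppr0 scale0r add0r.
have K0 kx kp : K kx kp -> kx = 0 /\ kp = 0.
  move=> Kk; have [l2 E] := Kk; have y0 := Kyy _ _ Kk.
  have kxE' : kx = al kx *: x by rewrite [LHS]kxE y0 addr0.
  case: (eqVneq kp 0) => [kp0|kp0]; last first.
    by case: (graph_zeros_l l1 xp l2 kxE' (kpE kx kp) (xqq _ _ Kk) kp0).
  split=> //; have := E; rewrite kp0 dot0r => /esym/eqP.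
  rewrite kxE' dotZl mulf_eq0 (negbTE xp) orbF => /eqP ->.
  by rewrite scale0r.
(* Orthogonality to (x, p) is one linear condition on the n-dimensional second plane, so a nonzero
   [z] satisfies it. Since K = 0, [z] annihilates both X2 and P2, and both determinants vanish. *)
have [z z0 zc] := @exists_ortho R n (X2 *m p^T - P2 *m x^T) (ltnW n3).
have [] := K0 (z *m X2) (z *m P2).
  split; first by exists z.
  have := congr1 (fun A : 'M[R]_1 => A 0 0) zc.
  rewrite mulmxBr !mulmxA mxE [X in _ + X]mxE [RHS]mxE => /eqP.
  by rewrite subr_eq0 (dotC x) => /eqP.
move=> zX zP; move: nz2.
by rewrite (det_eq0_mul z0 zX) (det_eq0_mul z0 zP) !mulr0 eqxx.
Qed.

Lemma lagrangian_splitting : X1 = 0 \/ P1 = 0.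
Proof.
(* Polarisation of [lag_dot0] gives dot x q + dot y p = 0, whereas isotropy gives dot x q = dot y
   p. *)
have dot0 x p y q : in_lag X1 P1 x p -> in_lag X1 P1 y q -> dot x q = 0.
  move=> l l'; have := lag_dot0 (in_lag_lin 1 l l').
  rewrite !scale1r dotDl !dotDr (lag_dot0 l) (lag_dot0 l') add0r addr0.
  rewrite (iso1 l l') => /eqP.
  by rewrite -mulr2n mulrn_eq0/= => /eqP.
have lx x p : in_lag X1 P1 x p -> in_lag X1 P1 x 0.
  by move=> l; apply: lag_max => y q l'; rewrite dot0r (dot0 _ _ _ _ l l').
have lp x p : in_lag X1 P1 x p -> in_lag X1 P1 0 p.
  by move=> l; apply: lag_max => y q l'; rewrite dot0l (dot0 _ _ _ _ l' l).
case: (eqVneq X1 0) => [->|X10]; [by left|right].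
apply/eqP/negPn/negP => P10; move: nz1.
have [i Xi] : exists i, row i X1 != 0.
  apply: contrapT => no; move/eqP: X10; apply; apply/row_matrixP => i.
  by rewrite row0; apply/eqP/negPn/negP => Xi; apply: no; exists i.
have [j Pj] : exists j, row j P1 != 0.
  apply: contrapT => no; move/eqP: P10; apply; apply/row_matrixP => j.
  by rewrite row0; apply/eqP/negPn/negP => Pj; apply: no; exists j.
have l i' : in_lag X1 P1 (row i' X1) (row i' P1).
  by exists 'e_i'; rewrite -!rowE.
have [z [zX zP]] := lx _ _ (l i); have [t [tX tP]] := lp _ _ (l j).
have z0 : z != 0 by apply: contraNneq Xi => z0; rewrite zX z0 mul0mx.
have t0 : t != 0 by apply: contraNneq Pj => t0; rewrite tP t0 mul0mx.
by rewrite (det_eq0_mul z0 (esym zP)) (det_eq0_mul t0 (esym tX)) !mulr0 eqxx.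
Qed.

End LagrangianSplitting.

(** * From forms on one tangent space to determinants in adapted coordinates *)

Section AlternatingVanishing.
Context {R : realType} {m n : nat}.
Implicit Types (w : 'M[R]_(n, m) -> R).

(** Replacing a row with nonzero coefficient by the combination [y *m v] multiplies [w] by that
    coefficient. Hence a tuple whose span meets [K] in such a vector is a zero. *)
Lemma alt_comb w (v : 'M[R]_(n, m)) (y : 'rV[R]_n) (K : 'rV[R]_m -> Prop) :
  alternating w -> (forall v i, K (row i v) -> w v = 0) ->
  y != 0 -> K (y *m v) -> w v = 0.
Proof.
move=> aw wK y0 Kv; have [i yi] : exists i, y 0 i != 0.
  apply: contrapT => no; move/eqP: y0; apply; apply/rowP => i; rewrite mxE.
  by apply/eqP/negPn/negP => yi; apply: no; exists i.
have : w (set_row i (y *m v) v) = 0 by apply: (wK _ i); rewrite row_set_row.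
rewrite mulmx_sum_row alt_sum// (bigD1 i)//= big1 ?addr0 => [|j ji].
  by move=> /eqP; rewrite mulf_eq0 (negbTE yi)/= set_row_id => /eqP.
have [_ z] := aw; rewrite (z _ i j) ?mulr0 1?eq_sym//.
by rewrite row_set_row row_set_row_neq.
Qed.

(** [interior_zero] speaks of the first argument only; a transposition brings any other row
    there. *)
Lemma alt_first w (K : 'rV[R]_m -> Prop) : alternating w ->
  (forall (v : 'M[R]_(n, m)) (i : 'I_n), i = 0%N :> nat -> K (row i v) ->
    w v = 0) ->
  forall (v : 'M[R]_(n, m)) i, K (row i v) -> w v = 0.
Proof.
move=> aw w0 v i Kv;
  pose i0 : 'I_n := Ordinal (leq_ltn_trans (leq0n i) (ltn_ord i)).
case: (eqVneq i i0) => [ii|ii]; first by apply: (w0 _ i) => //; rewrite ii.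
apply/eqP; rewrite -oppr_eq0 -(alt_xrow _ aw ii); apply/eqP/(w0 _ i0) => //.
rewrite (_ : row i0 _ = row i v)//.
by apply/rowP => j; rewrite !mxE tpermR.
Qed.

(** Expanding over the rows of [E] and [F], every term that selects a row of [F] vanishes. *)
Lemma alt_add_killed w k l (X : 'M[R]_(n, k)) (P : 'M[R]_(n, l))
    (E : 'M[R]_(k, m)) (F : 'M[R]_(l, m)) : alternating w ->
  (forall v i, (row i v <= F)%MS -> w v = 0) ->
  w (X *m E + P *m F) = w (X *m E).
Proof.
move=> aw wF; have [ml _] := aw.
have E1 : X *m E + P *m F = row_mx X P *m col_mx E F by rewrite mul_row_col.
have E2 : X *m E = row_mx X 0 *m col_mx E F by rewrite mul_row_col mul0mx addr0.
rewrite E1 [in RHS]E2 !mlin_mul//; apply: eq_bigr => f _.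
case: (pselect (exists i j, f i = rshift k j)) => [[i [j fi]]|no].
  rewrite (wF _ i) ?mulr0// row_rowsub fi.
  rewrite (_ : row _ _ = row j F) ?row_sub//.
  by apply/rowP => c; rewrite !mxE (unsplitK (inr j)).
congr (_ * _); apply: eq_bigr => i _; rewrite !mxE.
by case: (split_ordP (f i)) => // j fi; case: no; exists i, j.
Qed.

End AlternatingVanishing.

Section PointwiseUniqueness.
Context {R : realType} {n m : nat}.
Variables (Om : 'rV[R]_m -> 'rV[R]_m -> R) (Dq : set 'rV[R]_m).

Definition lag_split (E F : 'M[R]_(n, m)) :=
  [/\ row_free E, row_free F,
      (forall u v, (u <= E)%MS -> (v <= E)%MS -> Om u v = 0),
      (forall u v, (u <= F)%MS -> (v <= F)%MS -> Om u v = 0)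
    & (forall v, Dq v <-> exists x p, v = x *m E + p *m F) /\
      (forall x p : 'rV[R]_n, x *m E = p *m F -> x = 0)].

Definition bi_decomposed (E F : 'M[R]_(n, m)) (w1 w2 : 'M[R]_(n, m) -> R) :=
  [/\ alternating w1 /\ alternating w2,
      (forall v i, (row i v <= F)%MS -> w1 v = 0),
      (forall v i, (row i v <= E)%MS -> w2 v = 0),
      w1 E != 0 & w2 F != 0].

Hypothesis n3 : (2 < n)%N.
Hypothesis OmL : forall a (u v z : 'rV[R]_m), Om (a *: u + v) z =
  a * Om u z + Om v z.
Hypothesis OmC : forall u v, Om u v = - Om v u.
Hypothesis nd : forall u, Dq u -> (forall v, Dq v -> Om u v = 0) -> u = 0.

Let OmZ a u z : Om (a *: u) z = a * Om u z.
Proof.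
have z0 : Om 0 z = 0.
  by have := OmL 1 0 0 z; rewrite scale1r addr0 mul1r => /eqP;
     rewrite eq_sym -subr_eq0 addrK => /eqP.
by have := OmL a u 0 z; rewrite z0 !addr0.
Qed.

Let OmD u v z : Om (u + v) z = Om u z + Om v z.
Proof. by have := OmL 1 u v z; rewrite scale1r mul1r. Qed.

Let OmDr u v z : Om z (u + v) = Om z u + Om z v.
Proof. by rewrite OmC OmD opprD -!OmC. Qed.

Let Om_mul k l (x : 'rV[R]_k) (p : 'rV[R]_l) (E : 'M[R]_(k, m)) (F :
  'M[R]_(l, m)) :
  Om (x *m E) (p *m F) =
  (x *m (\matrix_(i, j) Om (row i E) (row j F)) *m p^T) 0 0.
Proof.
have L (I : Type) (r : seq I) (c : I -> R) (u : I -> 'rV[R]_m) z :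
    Om (\sum_(i <- r) c i *: u i) z = \sum_(i <- r) c i * Om (u i) z.
  elim: r => [|i r IHr]; first by rewrite !big_nil -(scale0r 0) OmZ mul0r.
  by rewrite !big_cons OmL IHr.
rewrite [x *m E]mulmx_sum_row [p *m F]mulmx_sum_row L mxE.
transitivity (\sum_i \sum_j x 0 i * (p 0 j * Om (row i E) (row j F))).
  by apply: eq_bigr => i _; rewrite OmC L -sumrN big_distrr/=;
     apply: eq_bigr => j _; rewrite OmC (mulrN (p 0 j)) opprK.
rewrite exchange_big; apply: eq_bigr => j _; rewrite !mxE big_distrl/=.
by apply: eq_bigr => i _; rewrite !mxE -!mulrA; congr (_ * _); rewrite mulrC.
Qed.

(** The Gram matrix N of [E] against [F] is invertible: if x N = 0, then x E is orthogonal to [F],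
    and to [E] by isotropy, hence is zero. Replacing [F] by the basis dual to [E] gives the standard
    symplectic form. *)
Lemma lag_split_dual E F : lag_split E F ->
  exists2 A : 'M[R]_n, A \in unitmx & forall x p y q,
    Om (x *m E + p *m (A *m F)) (y *m E + q *m (A *m F)) = dot x q - dot y p.
Proof.
move=> [rE rF iE iF [DE dE]].
pose N := \matrix_(i, j) Om (row i E) (row j F).
have uN : N \in unitmx.
  rewrite -row_free_unit -kermx_eq0; apply/rowV0P => x /sub_kermxP xN.
  apply: (row_free_inj rE); rewrite mul0mx; apply: nd.
    by apply/DE; exists x, 0; rewrite mul0mx addr0.
  move=> v /DE[y [p ->]]; rewrite OmC OmD !(OmC _ (x *m E)).
  by rewrite iE ?submxMl// Om_mul -/N xN mul0mx mxE oppr0 addr0 oppr0.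
exists (invmx N)^T; first by rewrite unitmx_tr unitmx_inv.
have key x q : Om (x *m E) (q *m ((invmx N)^T *m F)) = dot x q.
  rewrite mulmxA Om_mul -/N trmx_mul trmxK !mulmxA -(mulmxA x) mulmxV//.
  by rewrite mulmx1.
have E0 x y : Om (x *m E) (y *m E) = 0 by rewrite iE ?submxMl.
have F0 x y : Om (x *m ((invmx N)^T *m F)) (y *m ((invmx N)^T *m F)) = 0.
  by rewrite !mulmxA iF ?submxMl.
move=> x p y q; rewrite OmD !OmDr E0 F0 add0r addr0 key.
by rewrite (OmC (p *m _)) key.
Qed.

Lemma bi_decomposed_det E F w1 w2 (A X P : 'M[R]_n) :
  bi_decomposed E F w1 w2 ->
  w1 (X *m E + P *m (A *m F)) - w2 (X *m E + P *m (A *m F)) =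
  w1 E * \det X - w2 F * \det A * \det P.
Proof.
move=> [[a1 a2] k1 k2 _ _].
rewrite mulmxA (alt_add_killed _ _ _ a1 k1) [X *m E + _]addrC.
rewrite (alt_add_killed _ _ _ a2 k2) (alt_det X E a1) (alt_det (P *m A) F a2).
rewrite det_mulmx.
rewrite (mulrC (w1 E)) -(mulrA (w2 F)) (mulrC (\det P)); congr (_ - _).
exact: mulrC.
Qed.

Lemma lag_split_unique E F E' F' w1 w2 w1' w2' :
  lag_split E F -> lag_split E' F' ->
  bi_decomposed E F w1 w2 -> bi_decomposed E' F' w1' w2' ->
  (forall v : 'M[R]_(n, m), (forall i, Dq (row i v)) ->
     (forall i j, Om (row i v) (row j v) = 0) ->
     w1 v - w2 v = 0 <-> w1' v - w2' v = 0) ->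
  ((E' <= E)%MS && (F' <= F)%MS) || ((E' <= F)%MS && (F' <= E)%MS).
Proof.
move=> sEF sEF' bd bd' zz.
have [A uA dual] := lag_split_dual sEF.
have [rE rF iE iF [DE dE]] := sEF; have [rE' rF' iE' iF' [DE' dE']] := sEF'.
have [[a1 a2] k1 k2 n1 n2] := bd; have [[a1' a2'] k1' k2' n1' n2'] := bd'.
pose G := A *m F.
have GF p : p *m F = (p *m invmx A) *m G by rewrite /G mulmxA mulmxKV.
have coordsD (B : 'M[R]_(n, m)) : (forall i, Dq (row i B)) ->
    exists X P, B = X *m E + P *m G.
  move=> BD; have H i : exists xp : 'rV[R]_n * 'rV[R]_n, row i B =
    xp.1 *m E + xp.2 *m G.
    have /DE[x [p ->]] := BD i; exists (x, p *m invmx A) => /=.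
    by rewrite -GF.
  have [h hE] := choice H.
  exists (\matrix_i (h i).1), (\matrix_i (h i).2).
  by apply/row_matrixP => i; rewrite linearD/= !row_mul !rowK.
have DE'1 (x : 'rV[R]_n) : Dq (x *m E') by apply/DE'; exists x, 0;
  rewrite mul0mx addr0.
have DF'1 (x : 'rV[R]_n) : Dq (x *m F') by apply/DE'; exists 0, x;
  rewrite mul0mx add0r.
have [X1 [P1 E'E]] : exists X P, E' = X *m E + P *m G.
  by apply: coordsD => i; rewrite rowE.
have [X2 [P2 F'E]] : exists X P, F' = X *m E + P *m G.
  by apply: coordsD => i; rewrite rowE.
have inj (x p y q : 'rV[R]_n) : x *m E + p *m G = y *m E + q *m G ->
  x = y /\ p = q.
  move=> xy; have xy' (r s : 'rV[R]_n) : dot x s - dot r p = dot y s - dot r q.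
    by rewrite -!dual -/G xy.
  split; apply/eqP; rewrite -subr_eq0; apply/eqP/dot_eq0 => r.
    have := xy' 0 r; rewrite !dot0l !subr0 dotDl -scaleN1r dotZl mulN1r => ->.
    by rewrite subrr.
  have := xy' r 0; rewrite !dot0r !sub0r => /oppr_inj E0.
  by rewrite dotC dotDr -scaleN1r dotZr mulN1r E0 subrr.
have l1 x p : in_lag X1 P1 x p <-> ((x *m E + p *m G)%R <= E')%MS.
  split=> [[z [-> ->]]|/submxP[z zE]].
    by rewrite -!mulmxA -mulmxDr -E'E submxMl.
  by exists z; apply: inj; rewrite zE {1}E'E mulmxDr !mulmxA.
have l2 x p : in_lag X2 P2 x p <-> ((x *m E + p *m G)%R <= F')%MS.
  split=> [[z [-> ->]]|/submxP[z zE]].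
    by rewrite -!mulmxA -mulmxDr -F'E submxMl.
  by exists z; apply: inj; rewrite zE {1}F'E mulmxDr !mulmxA.
have iso1 x p y q : in_lag X1 P1 x p -> in_lag X1 P1 y q -> dot x q = dot y p.
  move=> /l1 lx /l1 ly; apply/eqP; rewrite -subr_eq0 -dual -/G; apply/eqP.
  exact: iE'.
have iso2 x p y q : in_lag X2 P2 x p -> in_lag X2 P2 y q -> dot x q = dot y p.
  move=> /l2 lx /l2 ly; apply/eqP; rewrite -subr_eq0 -dual -/G; apply/eqP.
  exact: iF'.
have dec x p : exists x1 p1 x2 p2,
    [/\ in_lag X1 P1 x1 p1, in_lag X2 P2 x2 p2, x = x1 + x2 & p = p1 + p2].
  have : Dq (x *m E + p *m G) by apply/DE; exists x, (p *m A); rewrite -mulmxA.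
  move=> /DE'[y [z yz]]; exists (y *m X1), (y *m P1), (z *m X2), (z *m P2).
  have [xE pE] : x = y *m X1 + z *m X2 /\ p = y *m P1 + z *m P2.
    apply: inj; rewrite yz {1}E'E {1}F'E !mulmxDl !mulmxDr !mulmxA.
    by rewrite addrACA.
  by split => //; [exists y|exists z].
pose a := w1 E; pose b := w2 F * \det A.
have a0 : a != 0 by [].
have b0 : b != 0 by rewrite mulf_neq0// -unitfE -unitmxE.
(* Symmetry of X P^T says that the rows of (X | P) span an isotropic tuple; on these the two
   generators have the same zeros. *)
have tuple_zero (X P : 'M[R]_n) : X *m P^T = P *m X^T ->
    w1' (X *m E + P *m G) - w2' (X *m E + P *m G) = 0 <->
    a * \det X = b * \det P.
  move=> XP; rewrite -zz.
  - rewrite (bi_decomposed_det A X P bd) -/a -/b.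
    by split=> [/eqP|->]; rewrite ?subrr// subr_eq0 => /eqP.
  - move=> i; rewrite linearD/= !row_mul; apply/DE.
    by exists (row i X), (row i P *m A); rewrite -mulmxA.
  - move=> i j; rewrite !linearD/= !row_mul dual (dotC (row j X)) !dot_row XP.
    by rewrite subrr.
have zeros (X P : 'M[R]_n) y1 y2 : X *m P^T = P *m X^T ->
    y1 != 0 -> in_lag X1 P1 (y1 *m X) (y1 *m P) ->
    y2 != 0 -> in_lag X2 P2 (y2 *m X) (y2 *m P) -> a * \det X = b * \det P.
  move=> XP y10 /l1 ly1 y20 /l2 ly2; apply/(tuple_zero _ _ XP).
  rewrite (@alt_comb _ _ _ w1' _ y2 (fun u => (u <= F')%MS))//; last first.
    by rewrite mulmxDr (mulmxA y2 X) (mulmxA y2 P).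
  rewrite (@alt_comb _ _ _ w2' _ y1 (fun u => (u <= E')%MS)) ?subr0//.
  by rewrite mulmxDr (mulmxA y1 X) (mulmxA y1 P).
have n0 : (0 < n)%N by exact: leq_trans n3.
have isoM (X P : 'M[R]_n) : (forall x p y q,
    in_lag X P x p -> in_lag X P y q -> dot x q = dot y p) ->
    X *m P^T = P *m X^T.
  move=> iso; have lr i : in_lag X P (row i X) (row i P).
    by exists 'e_i; rewrite -!rowE.
  apply/matrixP => i j; rewrite -!dot_row (dotC (row i P)).
  exact: iso (lr i) (lr j).
have nz1 : a * \det X1 != b * \det P1.
  apply/eqP => /(tuple_zero _ _ (isoM _ _ iso1)); rewrite -E'E.
  by rewrite (k2' E' (Ordinal n0)) ?row_sub// subr0 => /eqP;
    rewrite (negbTE n1').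
have nz2 : a * \det X2 != b * \det P2.
  apply/eqP => /(tuple_zero _ _ (isoM _ _ iso2)); rewrite -F'E.
  rewrite (k1' F' (Ordinal n0)) ?row_sub// sub0r => /eqP.
  by rewrite oppr_eq0 (negbTE n2').
have R1 := lagrangian_splitting n3 a0 b0 iso1 iso2 dec zeros nz1 nz2.
have R2 : X2 = 0 \/ P2 = 0.
  apply: (lagrangian_splitting n3 a0 b0 iso2 iso1) => //.
  - move=> x p; have [x1 [p1 [x2 [p2 [? ? -> ->]]]]] := dec x p.
    by exists x2, p2, x1, p1; split => //; rewrite addrC.
  - by move=> X P y1 y2 XP y10 ly1 y20 ly2; exact: (zeros X P y2 y1).
have GleF : (G <= F)%MS by rewrite /G submxMl.
have e0 : 'e_(Ordinal n0) != 0 :> 'rV[R]_n.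
  by apply/eqP => /rowP /(_ (Ordinal n0)) /eqP; rewrite !mxE !eqxx oner_eq0.
(* If both members of the second pair lay in [F], so would all of [Dq], and in particular [E],
   although [E] and [F] meet only in 0. *)
have noE : ~ (X1 = 0 /\ X2 = 0).
  move=> [X10 X20]; move/eqP: e0; apply.
  have /DE'[x [p]] : Dq ('e_(Ordinal n0) *m E).
    by apply/DE; exists 'e_(Ordinal n0), 0; rewrite mul0mx addr0.
  rewrite E'E F'E X10 X20 !mul0mx !add0r /G !mulmxA -mulmxDl.
  exact: dE.
have noF : ~ (P1 = 0 /\ P2 = 0).
  move=> [P10 P20]; move/eqP: e0; apply.
  have /DE'[x [p]] : Dq ('e_(Ordinal n0) *m F).
    by apply/DE; exists 0, 'e_(Ordinal n0); rewrite mul0mx add0r.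
  rewrite E'E F'E P10 P20 !mul0mx !addr0 !mulmxA -mulmxDl => /esym xE.
  have x0 := dE _ _ xE; apply: (row_free_inj rF).
  by rewrite mul0mx -xE x0 mul0mx.
have XF Y P : Y = 0 -> ((Y *m E + P *m G)%R <= F)%MS.
  by move=> ->; rewrite mul0mx add0r mulmx_sub.
have PE Y P : P = 0 -> ((Y *m E + P *m G)%R <= E)%MS.
  by move=> ->; rewrite mul0mx addr0 submxMl.
apply/orP; case: R1 => H1; case: R2 => H2.
- by case: noE.
- by right; rewrite {1}E'E {1}F'E XF// PE.
- by left; rewrite {1}E'E {1}F'E XF// PE.
- by case: noF.
Qed.

End PointwiseUniqueness.

(** * Comparison of two Lagrangian pairs *)

Lemma row'_col_mx2 (R : pzRingType) m (u z : 'rV[R]_m) :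
  row' (ord0 : 'I_2) (col_mx u z : 'M[R]_(2, m)) = z.
Proof.
apply/matrixP => i j; rewrite !mxE; case: splitP => l.
  by rewrite (ord1 i) (ord1 l).
by rewrite (ord1 l) (ord1 i).
Qed.

Section IdealOnIsotropicTuples.
Context {R : realType} {m n : nat} {M : manifold R m}.

Lemma mul_row_perm_sub k l (s : 'S_(k + l)) (A : 'M[R]_(k + l, n)) (B :
  'M[R]_(n, m)) :
  usubmx (row_perm s (A *m B)) = usubmx (row_perm s A) *m B /\
  dsubmx (row_perm s (A *m B)) = dsubmx (row_perm s A) *m B.
Proof. by rewrite mul_usub_mx mul_dsub_mx !row_permE mulmxA. Qed.

(* The forms that vanish at [q] on all tuples from the span of an isotropic
   [v] (in degree [n], only if [w] does) form an ideal. *)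
Lemma ideal_gen_isotropic (V : set M) (t : dform M 1) (w : dform M n) q
    (v : 'M[R]_(n, m)) k (a : dform M k) : (2 < n)%N -> open V -> V q ->
  smooth_form V t -> smooth_form V (ext_d t) -> smooth_form V w ->
  (forall A : 'M[R]_(1, n), t q (A *m v) = 0) ->
  (forall A : 'M[R]_(2, n), ext_d t q (A *m v) = 0) ->
  ideal_gen V t w k a ->
  ((k < n)%N -> forall A : 'M[R]_(k, n), a q (A *m v) = 0) /\
  (w q v = 0 -> (k <= n)%N -> forall A : 'M[R]_(k, n), a q (A *m v) = 0).
Proof.
move=> n2 oV Vq st sdt sw tv dtv Ga.
pose J : graded_forms M := fun k (a : dform M k) => smooth_form V a /\
  (((k < n)%N -> forall A : 'M[R]_(k, n), a q (A *m v) = 0) /\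
  (w q v = 0 -> (k <= n)%N -> forall A : 'M[R]_(k, n), a q (A *m v) = 0)).
suff [] : J k a by [].
have J_wedge i j (b : dform M i) (c : dform M j) : J i b -> smooth_form V c ->
    J (i + j)%N (wedge b c) /\ J (j + i)%N (wedge c b).
  move=> [sb [b1 b2]] sc.
  have wz1 (A : 'M[R]_(i + j, n)) : (forall B : 'M[R]_(i, n), b q (B *m v) =
    0) ->
      wedge b c q (A *m v) = 0.
    move=> bz; rewrite /wedge big1 ?mulr0// => s _.
    by have [-> _] := mul_row_perm_sub s A v; rewrite bz mulr0 mul0r.
  have wz2 (A : 'M[R]_(j + i, n)) : (forall B : 'M[R]_(i, n), b q (B *m v) =
    0) ->
      wedge c b q (A *m v) = 0.
    move=> bz; rewrite /wedge big1 ?mulr0// => s _.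
    by have [_ ->] := mul_row_perm_sub s A v; rewrite bz mulr0.
  have sub1 : (i + j < n -> i < n)%N by exact/leq_ltn_trans/leq_addr.
  have sub2 : (i + j <= n -> i <= n)%N by exact/leq_trans/leq_addr.
  have sub3 : (j + i < n -> i < n)%N by exact/leq_ltn_trans/leq_addl.
  have sub4 : (j + i <= n -> i <= n)%N by exact/leq_trans/leq_addl.
  split; (split; first exact: smooth_form_wedge); split.
  - by move=> /sub1 /b1 bz A; exact: wz1.
  - by move=> w0 /sub2 /(b2 w0) bz A; exact: wz1.
  - by move=> /sub3 /b1 bz A; exact: wz2.
  - by move=> w0 /sub4 /(b2 w0) bz A; exact: wz2.
apply: Ga; first split.
- by move=> i b [].
- move=> i b c [sb [b1 b2]] sc bc; split=> //; split.
    by move=> /b1 bz A; rewrite -bc.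
  by move=> w0 /(b2 w0) bz A; rewrite -bc.
- by move=> i; split; first exact: smooth_form0.
- move=> i b c [sb [b1 b2]] [sc [c1 c2]]; split; first exact: smooth_form_add.
  split; first by move=> i_n A; rewrite /add_form b1// c1// addr0.
  by move=> w0 i_n A; rewrite /add_form b2// c2// addr0.
- exact: J_wedge.
- by split=> //; split.
- by split=> //; split.
split=> //; split; first by rewrite ltnn.
move=> w0 _ A; have [aw _] := sw; rewrite (alt_det A v (aw q Vq)).
by rewrite w0 mulr0.
Qed.

End IdealOnIsotropicTuples.

Section Dichotomy.
Context {R : realType} {n : nat} {M : manifold R (2 * n).+1}.
Hypothesis n3 : (2 < n)%N.
Local Notation m := (2 * n).+1.

Section AtPoint.
Variables (D : plane_field M) (q : M) (t : dform M 1) (U : set M).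
Hypotheses (ct : contact_form D U t) (Uq : U q).
Hypothesis sdt : smooth_form U (ext_d t).

Definition dform2 (u v : 'rV[R]_m) : R := ext_d t q (col_mx u v).

Let adt : @alternating R m 2 (ext_d t q).
Proof. by have [adt _] := sdt; exact: adt. Qed.

Lemma dform2_lin a u v z : dform2 (a *: u + v) z = a * dform2 u z + dform2 v z.
Proof.
have [ml _] := adt; rewrite -[dform2 v z]mul1r /dform2.
have rE (x : 'rV[R]_m) : row (ord0 : 'I_2) (col_mx x z : 'M[R]_(2, m)) = x.
  by apply/rowP => j; rewrite !mxE; case: splitP => // i _; rewrite (ord1 i).
apply: (ml _ _ _ ord0); rewrite ?rE ?scale1r//.
  by rewrite !row'_col_mx2.
by rewrite !row'_col_mx2.
Qed.

Lemma dform2C u v : dform2 u v = - dform2 v u.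
Proof.
rewrite /dform2 -(alt_xrow (i := ord0 : 'I_2) (j := ord_max) _ adt)//.
congr (ext_d t q _); apply/matrixP => r c; rewrite [RHS]mxE.
have e0 (x y : 'rV[R]_m) : (col_mx x y : 'M[R]_(2, m)) ord0 c = x 0 c.
  have -> : (ord0 : 'I_2) = lshift 1 (0 : 'I_1) by exact: val_inj.
  exact: col_mxEu.
have e1 (x y : 'rV[R]_m) : (col_mx x y : 'M[R]_(2, m)) ord_max c = y 0 c.
  have -> : (ord_max : 'I_2) = rshift 1 (0 : 'I_1) by exact: val_inj.
  exact: col_mxEd.
case: tpermP => [->|->|r0 r1]; rewrite ?e0 ?e1//.
case: r r0 r1 => -[|[|//]] ? r0 r1; first by case: r0; exact: val_inj.
by case: r1; exact: val_inj.
Qed.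

Lemma tuple_contact (v : 'M[R]_(n, m)) : smooth_form U t ->
  (forall i, D q (row i v)) -> forall A : 'M[R]_(1, n), t q (A *m v) = 0.
Proof.
move=> [at_ _] Dv A; have [ml _] := at_ q Uq; rewrite (mlin_mul A v ml).
rewrite big1// => f _; have [_ _ DE _] := ct.
have := Dv (f ord0); rewrite DE//= => tv.
rewrite (_ : rowsub f v = row (f ord0) v) ?tv ?mulr0//.
by apply/matrixP => i j; rewrite !mxE (ord1 i).
Qed.

Lemma tuple_isotropic (v : 'M[R]_(n, m)) :
  (forall i j, dform2 (row i v) (row j v) = 0) ->
  forall A : 'M[R]_(2, n), ext_d t q (A *m v) = 0.
Proof.
move=> iv A; have [ml _] := adt; rewrite (mlin_mul A v ml).
rewrite big1// => f _; have := iv (f ord0) (f ord_max); rewrite /dform2 => tv.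
rewrite (_ : rowsub f v = col_mx (row (f ord0) v) (row (f ord_max) v)).
  by rewrite tv mulr0.
apply/matrixP => i j; rewrite !mxE; case: splitP => l il; rewrite !mxE.
  by congr (v (f _) _); apply/val_inj; rewrite /= il (ord1 l).
by congr (v (f _) _); apply/val_inj; rewrite /= il (ord1 l).
Qed.

Lemma lag_split_at E1 E2 (X Z : 'M[R]_(n, m)) :
  lagrangian_pair D E1 E2 -> row_free X -> row_free Z ->
  E1 q = [set v | (v <= X)%MS] -> E2 q = [set v | (v <= Z)%MS] ->
  lag_split dform2 (D q) X Z.
Proof.
move=> [_ _ i1 i2 ds] rX rZ E1E E2E; have [DE E0] := ds q; split => //.
- by move=> u v uX vX; apply: (i1 _ _ ct) => //; rewrite E1E.
- by move=> u v uX vX; apply: (i2 _ _ ct) => //; rewrite E2E.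
split=> [v|x p xp].
  rewrite DE E1E E2E; split.
    by move=> [_ /submxP[x ->] [_ /submxP[p ->] <-]]; exists x, p.
  move=> [x [p ->]]; exists (x *m X); first exact: submxMl.
  by exists (p *m Z) => //; exact: submxMl.
have : (E1 q `&` E2 q) (x *m X).
  by rewrite E1E E2E; split=> /=; [exact: submxMl|rewrite xp; exact: submxMl].
by rewrite E0 /= => xX; apply: (row_free_inj rX); rewrite mul0mx.
Qed.

Lemma bi_decomposed_at V E1 E2 w1 w2 (X Z : 'M[R]_(n, m)) :
  bi_decomposing V E1 E2 w1 w2 -> V q ->
  E1 q = [set v | (v <= X)%MS] -> E2 q = [set v | (v <= Z)%MS] ->
  bi_decomposed X Z (w1 q) (w2 q).
Proof.
move=> [[a1 _] [a2 _] bd] Vq E1E E2E; have [z1 z2 v1 v2] := bd q Vq.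
have A1 := a1 _ Vq; have A2 := a2 _ Vq.
have vol E (Y : 'M[R]_(n, m)) (w : dform M n) : alternating (w q) ->
    E q = [set v | (v <= Y)%MS] -> volume_on q E w -> w q Y != 0.
  move=> aw EY [v [Ev]]; have /submxP[B ->] : (v <= Y)%MS.
    by apply/row_subP => i; have := Ev i; rewrite EY.
  by rewrite (alt_det B Y aw) mulf_eq0 negb_or => /andP[].
split => //.
- apply: (@alt_first _ _ _ (w1 q) (fun u => (u <= Z)%MS)) => // v i i0 vZ.
  have E2v : E2 q (row i v) by rewrite E2E.
  exact: (z1 _ E2v v i i0 erefl).
- apply: (@alt_first _ _ _ (w2 q) (fun u => (u <= X)%MS)) => // v i i0 vX.
  have E1v : E1 q (row i v) by rewrite E1E.
  exact: (z2 _ E1v v i i0 erefl).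
- exact: vol E1E v1.
- exact: vol E2E v2.
Qed.

End AtPoint.

(** As 1 and 2 are below [n], the forms [t'] and [ext_d t'], which belong to the ideal of the first
    generator, vanish on the span of [v] as well. The tuple is then isotropic for both, and the
    argument becomes symmetric. *)
Lemma generators_zeros (I : form_sheaf M) (V : set M) t w t' w' q
    (v : 'M[R]_(n, m)) : eds I -> open V -> V q ->
  generated_on I V t w -> generated_on I V t' w' ->
  (forall A : 'M[R]_(1, n), t q (A *m v) = 0) ->
  (forall A : 'M[R]_(2, n), ext_d t q (A *m v) = 0) ->
  w q v = 0 <-> w' q v = 0.
Proof.
move=> eI oV Vq gw gw' tv dtv; have [eI1 _ _ _] := eI.
have [I1 _ _ _ _] := eI1 V oV.
have [It Idt Iw] := generated_in oV gw.
have [It' Idt' Iw'] := generated_in oV gw'.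
have st := I1 _ _ It; have sdt := I1 _ _ Idt; have sw := I1 _ _ Iw.
have st' := I1 _ _ It'; have sdt' := I1 _ _ Idt'; have sw' := I1 _ _ Iw'.
have gV := gw V oV (@subset_refl _ V); have gV' := gw' V oV (@subset_refl _ V).
have key k (a : dform M k) : I V k a -> _ := fun Ia =>
  ideal_gen_isotropic n3 oV Vq st sdt sw tv dtv ((gV k a).1 Ia).
have tv' : forall A : 'M[R]_(1, n), t' q (A *m v) = 0.
  by have [+ _] := key _ _ It'; apply; exact: ltnW.
have dtv' : forall A : 'M[R]_(2, n), ext_d t' q (A *m v) = 0.
  by have [+ _] := key _ _ Idt'; apply.
have key' k (a : dform M k) : I V k a -> _ := fun Ia =>
  ideal_gen_isotropic n3 oV Vq st' sdt' sw' tv' dtv' ((gV' k a).1 Ia).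
split=> w0.
  have [_ /(_ w0 (leqnn n) 1%:M)] := key _ _ Iw'.
  by rewrite mul1mx.
have [_ /(_ w0 (leqnn n) 1%:M)] := key' _ _ Iw.
by rewrite mul1mx.
Qed.

Variables (D : plane_field M) (I : form_sheaf M).

Lemma pair_dichotomy E1 E2 E1' E2' q :
  monge_ampere_pair D I E1 E2 -> monge_ampere_pair D I E1' E2' ->
  (E1' q = E1 q /\ E2' q = E2 q) \/ (E1' q = E2 q /\ E2' q = E1 q).
Proof.
move=> [[eI _] lp loc] [_ lp' loc'].
have [U [t [w1 [w2 [Uq [ct _ gU] bd]]]]] := loc q.
have [U' [t' [w1' [w2' [U'q [ct' _ gU'] bd']]]]] := loc' q.
have [oU st DE nd] := ct; have [oU' _ _ _] := ct'.
pose V := U `&` U'; have oV : open V by exact: openI.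
have Vq : V q by [].
have gV := generated_on_sub (@subIsetl _ U U') gU.
have gV' := generated_on_sub (@subIsetr _ U U') gU'.
have [eI1 _ _ _] := eI; have [I1 _ _ _ _] := eI1 U oU.
have [It Idt _] := generated_in oU gU.
have sdt := I1 _ _ Idt.
have frame E : subbundle n E -> exists2 X : 'M[R]_(n, m), row_free X &
    E q = [set v | (v <= X)%MS].
  move=> /(_ q)[W [X [_ Wq + _]]] => /(_ q Wq)[rX EX].
  by exists (X q).
have [sE1 sE2 _ _ _] := lp; have [sE1' sE2' _ _ _] := lp'.
have [X rX XE] := frame _ sE1; have [Z rZ ZE] := frame _ sE2.
have [X' rX' XE'] := frame _ sE1'; have [Z' rZ' ZE'] := frame _ sE2'.
have ls := lag_split_at ct Uq lp rX rZ XE ZE.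
have ls' := lag_split_at ct Uq lp' rX' rZ' XE' ZE'.
have bq := bi_decomposed_at bd Uq XE ZE.
have bq' := bi_decomposed_at bd' U'q XE' ZE'.
have zz (v : 'M[R]_(n, m)) : (forall i, D q (row i v)) ->
    (forall i j, dform2 q t (row i v) (row j v) = 0) ->
    w1 q v - w2 q v = 0 <-> w1' q v - w2' q v = 0.
  move=> Dv iv.
  exact: (generators_zeros eI oV Vq gV gV' (tuple_contact ct Uq st Dv)
    (tuple_isotropic Uq sdt iv)).
have eqE (A B : 'M[R]_(n, m)) : row_free A -> row_free B -> (A <= B)%MS ->
    [set v | (v <= A)%MS] = [set v : 'rV[R]_m | (v <= B)%MS].
  move=> /eqP rA /eqP rB AB; have BA : (B <= A)%MS.
    by rewrite -(mxrank_leqif_sup AB) rA rB.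
  by apply/seteqP; split=> v /= vA; exact: submx_trans vA _.
have := lag_split_unique n3 (dform2_lin Uq sdt) (dform2C Uq sdt)
  (fun u => nd q u Uq) ls ls' bq bq' zz.
case/orP => /andP[l1 l2]; [left|right]; rewrite XE XE' ZE ZE'.
  by split; exact: eqE.
by split; exact: eqE.
Qed.

End Dichotomy.

(** * Continuity of subbundles and local constancy of the order *)

Section LocalConstancy.
Context {R : realType} {m : nat} {M : manifold R m}.

Lemma smooth_det k (U : set 'rV[R]_m) (G : 'rV[R]_m -> 'M[R]_k) : open U ->
  (forall i j, smooth U (fun y => G y i j)) -> smooth U (fun y => \det (G y)).
Proof.
move=> oU sG; apply: smooth_sum => // s _; apply: smoothM => //.
  exact: smooth_cst.
exact: smooth_prod.
Qed.

(** At [p] the two frames together are independent, so the stacked matrix has a right inverse [B].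
    The determinant of its product with [B] stays nonzero nearby, whereas E q = F q would bound the
    rank by n < n + n. Frames are read in a fixed chart to make this determinant continuous. *)
Lemma subbundle_neq n (E F : plane_field M) p : (0 < n)%N ->
  subbundle n E -> subbundle n F -> E p `&` F p = [set 0] ->
  exists W, [/\ open W, W p & forall q, W q -> E q <> F q].
Proof.
move=> n0 sE sF E0.
have [U1 [X [oU1 U1p XE sX]]] := sE p; have [U2 [Z [oU2 U2p ZF sZ]]] := sF p.
pose c := chart_at M p; have cA : atlas M c by exact: atlas_chart_at.
have cp : cdom c p by exact: cdom_chart_at.
pose G q := col_mx (X q *m to_chart c q) (Z q *m to_chart c q).
pose U := cdom c `&` (U1 `&` U2).
have oU : open U by apply: openI; [exact: open_cdom|exact: openI].
have Up : U p by [].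
have [B GB] : exists B, G p *m B = 1%:M.
  have [rX EX] := XE p U1p; have [rZ FZ] := ZF p U2p.
  apply/row_freeP; rewrite -kermx_eq0; apply/rowV0P => u /sub_kermxP uG.
  have T := to_chartK cA cp.
  have : lsubmx u *m X p + rsubmx u *m Z p = 0.
    rewrite -[LHS]mulmx1 -T mulmxA mulmxDl -!(mulmxA _ _ (to_chart c p)).
    by rewrite -mul_row_col hsubmxK -/(G p) uG mul0mx.
  move/eqP; rewrite addr_eq0 => /eqP xz.
  have : (E p `&` F p) (lsubmx u *m X p).
    rewrite EX FZ; split=> /=; first exact: submxMl.
    by rewrite xz -mulNmx; exact: submxMl.
  rewrite E0 /= => x0; have xu : lsubmx u = 0.
    by apply: (row_free_inj rX); rewrite x0 mul0mx.
  have zu : rsubmx u = 0.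
    apply: (row_free_inj rZ); rewrite mul0mx; apply: oppr_inj.
    by rewrite -xz x0 oppr0.
  by rewrite -[u]hsubmxK xu zu row_mx0.
pose h y := \det (G (cinv c y) *m B).
have oc : open (c @` U).
  by apply: open_chart_image; exact: openI.
have sub1 : c @` U `<=` c @` (cdom c `&` U1).
  by move=> _ [q [cq [U1q U2q]] <-]; exists q.
have sub2 : c @` U `<=` c @` (cdom c `&` U2).
  by move=> _ [q [cq [U1q U2q]] <-]; exists q.
have sh : smooth (c @` U) h.
  apply: smooth_det => // i j.
  apply: (@smooth_ext _ _ _ (fun y => \sum_l G (cinv c y) i l * B l j)) => //.
    by move=> y _; rewrite mxE.
  apply: smooth_sum => // l _; apply: smoothM => //; last exact: smooth_cst.
  case: (split_ordP i) => r ->.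
    apply: (@smooth_ext _ _ _ (fun y => row r (X (cinv c y) *m
      to_chart c (cinv c y)) 0 l)) => //.
      by move=> y _; rewrite /G col_mxEu [LHS]mxE.
    exact: smooth_sub sub1 (sX c r cA l).
  apply: (@smooth_ext _ _ _ (fun y => row r (Z (cinv c y) *m
    to_chart c (cinv c y)) 0 l)) => //.
    by move=> y _; rewrite /G col_mxEd [LHS]mxE.
  exact: smooth_sub sub2 (sZ c r cA l).
exists (U `&` (h \o c) @^-1` [set x | x != 0]); split.
- apply: (open_preimage oU); first by apply: open_neq.
  move=> q [cq Uq]; apply: continuous_comp; first exact: cfun_continuous.
  by apply: smooth_continuous sh _; exists q.
- by split=> //=; rewrite /h (cfunK cp) GB det1 oner_neq0.
move=> q [[cq [U1q U2q]]] /=; rewrite /h (cfunK cq) => hq EF.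
have [_ EX] := XE q U1q; have [_ FZ] := ZF q U2q.
have XZ : (X q <= Z q)%MS.
  apply/row_subP => i; have : E q (row i (X q)) by rewrite EX /=;
    exact: row_sub.
  by rewrite EF FZ.
have Gu : G q *m B \in unitmx by rewrite unitmxE unitfE.
have : (\rank (G q *m B) <= n)%N.
  apply: leq_trans (mxrankM_maxl _ _) _.
  have GZ : (G q <= Z q *m to_chart c q)%MS.
    by rewrite col_mx_sub submxMr//=.
  exact: leq_trans (mxrankS GZ) (rank_leq_row _).
by rewrite (mxrank_unit Gu) -[X in (_ <= X)%N]addn0 leq_add2l leqNgt n0.
Qed.

End LocalConstancy.

(** * The Legendre transformation of the standard contact space *)

Section LegendreTransformation.
Context (R : realType) (n : nat).
Local Notation E := ('rV[R]_(n + (1 + n))).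
Implicit Types (y v : E).

Definition legendre (y : E) : E :=
  row_mx (ppart y)
    (row_mx (\sum_(i < n) ppart y 0 i * xpart y 0 i - zpart y)%:M (xpart y)).

Lemma xpart_row x z p : xpart (row_mx x (row_mx z p) : E) = x.
Proof. by rewrite /xpart row_mxKl. Qed.

Lemma ppart_row x z p : ppart (row_mx x (row_mx z p) : E) = p.
Proof. by rewrite /ppart !row_mxKr. Qed.

Lemma zpart_row x (z : 'rV[R]_1) p : zpart (row_mx x (row_mx z p) : E) = z 0 0.
Proof. by rewrite /zpart row_mxKr row_mxKl. Qed.

Lemma parts_inj y y' : xpart y = xpart y' -> zpart y = zpart y' ->
  ppart y = ppart y' -> y = y'.
Proof.
move=> xE zE pE; rewrite -[y]hsubmxK -[y']hsubmxK; congr row_mx => //.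
rewrite -[rsubmx y]hsubmxK -[rsubmx y']hsubmxK; congr row_mx => //.
by apply/rowP => i; rewrite (ord1 i).
Qed.

Lemma xpart_legendre y : xpart (legendre y) = ppart y.
Proof. exact: xpart_row. Qed.

Lemma ppart_legendre y : ppart (legendre y) = xpart y.
Proof. exact: ppart_row. Qed.

Lemma zpart_legendre y :
  zpart (legendre y) = \sum_(i < n) ppart y 0 i * xpart y 0 i - zpart y.
Proof. by rewrite /legendre zpart_row !mxE mulr1n. Qed.

Lemma legendreK : involutive legendre.
Proof.
move=> y; apply: parts_inj.
- by rewrite xpart_legendre ppart_legendre.
- rewrite zpart_legendre !ppart_legendre !xpart_legendre zpart_legendre opprB.
  by under eq_bigr do rewrite mulrC; rewrite addrC subrK.
- by rewrite ppart_legendre xpart_legendre.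
Qed.

Let xi (i : 'I_n) : 'I_(n + (1 + n)) := lshift _ i.
Let zi : 'I_(n + (1 + n)) := rshift n (lshift n 0).
Let pi_ (i : 'I_n) : 'I_(n + (1 + n)) := rshift n (rshift 1 i).

Let xpartE y i : xpart y 0 i = y 0 (xi i). Proof. by rewrite !mxE. Qed.
Let zpartE y : zpart y = y 0 zi. Proof. by rewrite /zpart !mxE. Qed.
Let ppartE y i : ppart y 0 i = y 0 (pi_ i). Proof. by rewrite !mxE. Qed.

Let coords (P : 'I_(n + (1 + n)) -> Prop) :
  (forall i, P (xi i)) -> P zi -> (forall i, P (pi_ i)) -> forall j, P j.
Proof.
move=> Px Pz Pp j; case: (split_ordP j) => k ->; first exact: Px.
case: (split_ordP k) => l ->; last exact: Pp.
by rewrite (ord1 l); exact: Pz.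
Qed.

Let legendre_x i : (fun y => legendre y 0 (xi i)) = (fun y => y 0 (pi_ i)).
Proof. by apply/funext => y; rewrite -xpartE xpart_legendre ppartE. Qed.

Let legendre_p i : (fun y => legendre y 0 (pi_ i)) = (fun y => y 0 (xi i)).
Proof. by apply/funext => y; rewrite -ppartE ppart_legendre xpartE. Qed.

Let legendre_z : (fun y => legendre y 0 zi) =
  (fun y => \sum_(i < n) y 0 (pi_ i) * y 0 (xi i) + (-1) * y 0 zi).
Proof.
apply/funext => y; rewrite -zpartE zpart_legendre -zpartE mulN1r.
by congr (_ - _); apply: eq_bigr => i _; rewrite xpartE ppartE.
Qed.

Lemma smooth_legendre : smooth_map setT legendre.
Proof.
have sid := @smooth_map_id R (n + (1 + n)) setT.
apply: coords => [i||i].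
- by rewrite legendre_x; exact: sid.
- rewrite legendre_z; apply: smoothD; first exact: openT.
    apply: smooth_sum; first exact: openT.
    by move=> i _; apply: smoothM; [exact: openT|exact: sid|exact: sid].
  by apply: smoothM; [exact: openT|exact: smooth_cst|exact: sid].
- by rewrite legendre_p; exact: sid.
Qed.

Let derive_coord (y v : E) j : 'D_v (fun y : E => y 0 j : R) y = v 0 j.
Proof.
have did : differentiable (id : E -> E) y by exact: ex_diff.
by have /rowP /(_ j) := derive_rV v did; rewrite derive_id mxE.
Qed.

Lemma derive_legendre y v :
  [/\ xpart ('D_v legendre y) = ppart v, ppart ('D_v legendre y) = xpart v &
    zpart ('D_v legendre y) = \sum_(i < n) (ppart v 0 i * xpart y 0 i +
      ppart y 0 i * xpart v 0 i) - zpart v].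
Proof.
have dl : differentiable legendre y.
  exact: smooth_map_differentiable smooth_legendre _.
have dE j : 'D_v legendre y 0 j = 'D_v (fun y => legendre y 0 j : R) y.
  by rewrite (derive_rV _ dl) mxE.
have dc j : differentiable (fun y : E => y 0 j : R) y.
  exact: differentiable_coord.
split.
- by apply/rowP => i; rewrite xpartE dE legendre_x derive_coord ppartE.
- by apply/rowP => i; rewrite ppartE dE legendre_p derive_coord xpartE.
rewrite zpartE dE legendre_z.
rewrite (_ : (fun _ => _) =
  (fun y => \sum_(i < n) ((fun y : E => y 0 (pi_ i) : R) *
     (fun y : E => y 0 (xi i) : R)) y) + (-1) *: (fun y : E => y 0 zi : R))//.
have dP i : differentiable ((fun y : E => y 0 (pi_ i) : R) *
    (fun y : E => y 0 (xi i) : R)) y by exact: differentiableM.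
rewrite deriveD; last first.
- by apply: diff_derivable; exact: differentiableZ.
- by apply: diff_derivable; exact: differentiable_bigsum.
rewrite derive_bigsum// deriveZ; last exact: diff_derivable.
rewrite derive_coord scaleN1r zpartE; congr (_ - _); apply: eq_bigr => i _.
rewrite deriveM; [|exact: diff_derivable|exact: diff_derivable].
by rewrite !derive_coord !xpartE !ppartE addrC; congr (_ + _); exact: mulrC.
Qed.

Local Notation S := (std_space R n).

Lemma diffeo_legendre :
  diffeo_on setT setT (legendre : S -> S) (legendre : S -> S).
Proof.
have sl : smooth_on setT (legendre : S -> S).
  split=> [y _|c c' -> -> j].
    exact/differentiable_continuous/(smooth_map_differentiable smooth_legendre).
  exact: (smooth_sub (@subsetT _ _) (smooth_legendre j)).
split; split => //; by [exact: openT|move=> q _; exact: legendreK].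
Qed.

Lemma mul_tangent_legendre (y : S) v :
  v *m tangent_map (legendre : S -> S) y = 'D_v legendre y.
Proof.
apply: esym; apply: deriveEjacobian.
exact: (smooth_map_differentiable smooth_legendre).
Qed.

(** The form dz - p dx is pulled back to its negative, because d(p.x - z) - x dp = p dx - dz. *)
Lemma legendre_contact (y : S) v :
  D_std (legendre y) (v *m tangent_map (legendre : S -> S) y) <-> D_std y v.
Proof.
rewrite mul_tangent_legendre /D_std /=; have [-> _ ->] := derive_legendre y v.
rewrite ppart_legendre big_split/=.
rewrite [X in X + _ - _ - _](_ : _ = \sum_(i < n) xpart y 0 i * ppart v 0 i);
  last first.
  by apply: eq_bigr => i _; rewrite mulrC.
set a := \sum_(i < n) xpart y 0 i * _; set b := \sum_(i < n) _.
rewrite (_ : a + b - zpart v - a = b - zpart v); last by ring.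
by split=> /eqP; rewrite subr_eq0 => /eqP ->; rewrite subrr.
Qed.

Lemma legendre_tangent (y : S) :
  [/\ tangent_onto (legendre : S -> S) y (D_std y) (D_std (legendre y)),
      tangent_onto (legendre : S -> S) y (E1_std y) (E2_std (legendre y))
    & tangent_onto (legendre : S -> S) y (E2_std y) (E1_std (legendre y))].
Proof.
have TV := tangent_mapVK diffeo_legendre y.
pose T := tangent_map (legendre : S -> S) y.
have xT v : xpart (v *m T) = ppart v.
  by rewrite mul_tangent_legendre; have [] := derive_legendre y v.
have pT v : ppart (v *m T) = xpart v.
  by rewrite mul_tangent_legendre; have [] := derive_legendre y v.
have onto (A B : set E) : (forall v, B (v *m T) <-> A v) ->
    tangent_onto (legendre : S -> S) y A B.
  move=> AB; apply/seteqP; split=> [_ [v Av <-]|u Bu]; first exact/AB.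
  exists (u *m tangent_map (legendre : S -> S) (legendre y)).
    by apply/AB; rewrite -mulmxA TV mulmx1.
  by rewrite -mulmxA TV mulmx1.
split; apply: onto => v; first exact: legendre_contact.
- rewrite /E1_std /E2_std /= xT.
  by split=> -[Dv p0]; split=> //; exact/legendre_contact.
- rewrite /E1_std /E2_std /= pT.
  by split=> -[Dv p0]; split=> //; exact/legendre_contact.
Qed.

End LegendreTransformation.

(** * Change of sign of a generator *)

Section SignOfGenerator.
Context {R : realType} {m n : nat} {M : manifold R m}.

Lemma wedge_cst (c : R) (w : dform M n) p v : alternating (w p) ->
  @wedge _ _ M 0 n (fun _ _ => c) w p v = c * w p v.
Proof.
move=> aw; rewrite /wedge fact0 mul1n.
have dE (A : 'M[R]_(n, m)) : dsubmx (A : 'M[R]_(0 + n, m)) = A.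
  by apply/matrixP => i j; rewrite !mxE; congr (A _ _); exact: val_inj.
transitivity ((n`!%:R)^-1 * \sum_(s : 'S_n) c * w p v).
  congr (_ * _); apply: eq_bigr => s _.
  rewrite dE [w p (row_perm s v)](alt_row_perm s v aw).
  by rewrite mulrACA -signr_addb addbb expr0 mul1r.
rewrite sumr_const card_Sn -[(c * _) *+ _]mulr_natr mulrCA mulVf ?mulr1//.
Qed.

(** Ideals are closed under sums and wedge products but not, by definition, under scalars; the sign
    is obtained as the product with the constant 0-form -1. *)
Lemma ideal_gen_opp (V : set M) t (w1 w2 : dform M n) k (a : dform M k) :
  open V -> smooth_form V w1 -> smooth_form V w2 ->
  ideal_gen V t (sub_form w1 w2) k a -> ideal_gen V t (sub_form w2 w1) k a.
Proof.
move=> oV s1 s2 Ga J iJ Jt Jdt Jw; apply: (Ga J iJ Jt Jdt).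
have [_ J2 _ _ J5] := iJ.
have sw := smooth_form_sub_form oV s2 s1.
have sc : smooth_form V ((fun _ _ => -1) : dform M 0).
  split=> [p _|c v cA]; last exact: smooth_cst.
  by split=> [A B C []|A []].
apply: (J2 _ _ _ (J5 _ _ _ _ Jw sc).2).
  exact: smooth_form_sub_form.
move=> p v Vp; have [aw _] := sw.
by rewrite (wedge_cst _ _ (aw p Vp)) /sub_form mulN1r opprB.
Qed.

End SignOfGenerator.

Lemma generated_on_opp {R : realType} {n : nat} {M : manifold R (2 * n).+1}
    (I : form_sheaf M) (U : set M) t (w1 w2 : dform M n) :
  smooth_form U w1 -> smooth_form U w2 ->
  generated_on I U t (sub_form w1 w2) -> generated_on I U t (sub_form w2 w1).
Proof.
move=> s1 s2 gU V oV VU k a.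
have s1V := smooth_form_sub VU s1; have s2V := smooth_form_sub VU s2.
rewrite gU//; split; exact: ideal_gen_opp.
Qed.

(** * Independence of the Lagrangian pair *)

Section Independence.
Context {R : realType} {n : nat} {M : manifold R (2 * n).+1}.
Hypothesis n3 : (2 < n)%N.
Variables (D : plane_field M) (I : form_sheaf M).
Implicit Types (E F : plane_field M) (W : set M).

Definition same_pair W E1 E2 F1 F2 :=
  forall q, W q -> F1 q = E1 q /\ F2 q = E2 q.

(** Whichever order holds at [p], [F1] meets the opposite member of the first pair only in 0 there,
    hence differs from it nearby, and the dichotomy leaves a single order. *)
Lemma pair_locally E1 E2 F1 F2 p :
  monge_ampere_pair D I E1 E2 -> monge_ampere_pair D I F1 F2 ->
  exists W, [/\ open W, W p &
    same_pair W E1 E2 F1 F2 \/ same_pair W E2 E1 F1 F2].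
Proof.
move=> mE mF; have dich q := pair_dichotomy n3 q mE mF.
have [_ [s1 s2 _ _ ds] _] := mE; have [_ [r1 _ _ _ _] _] := mF.
have [_ E0] := ds p; have n0 : (0 < n)%N by exact: ltn_trans n3.
have [[F1E F2E]|[F1E F2E]] := dich p.
  have [|W [oW Wp WE]] := @subbundle_neq _ _ _ n F1 E2 p n0 r1 s2.
    by rewrite F1E.
  exists W; split => //; left => q /WE F12.
  by have [//|[]] := dich q.
have [|W [oW Wp WE]] := @subbundle_neq _ _ _ n F1 E1 p n0 r1 s1.
  by rewrite F1E setIC.
exists W; split => //; right => q /WE F12.
by have [[]//|] := dich q.
Qed.

Lemma flat_local E1 E2 F1 F2 :
  (forall p, exists W, [/\ open W, W p &
    same_pair W E1 E2 F1 F2 \/ same_pair W E2 E1 F1 F2]) ->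
  flat D E1 E2 -> flat D F1 F2.
Proof.
move=> loc fl p; have [W [oW Wp WE]] := loc p.
have [U [V [f [g [Up dfg fE]]]]] := fl p.
have [[oU oV sf sg] [UV VU gf fg]] := dfg.
pose U0 := U `&` W; pose V0 := V `&` g @^-1` W.
have d0 : diffeo_on U0 V0 f g.
  apply: (diffeo_restrict dfg).
  - exact: openI.
  - by apply: (open_preimage oV oW); have [cg _] := sg.
  - exact: subIsetl.
  - exact: subIsetl.
  - by move=> q [Uq Wq]; split; [exact: UV|rewrite /= gf].
  - by move=> q [Vq Wq]; split; [exact: VU|].
case: WE => WE.
  exists U0, V0, f, g; split => // q [Uq Wq].
  by have [-> ->] := WE q Wq; exact: fE.
pose l := @legendre R n : std_space R n -> std_space R n.
have lK := legendreK (R := R) (n := n).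
have dl := @diffeo_legendre R n.
have [[_ _ sl _] _] := dl.
have oV0 : open V0 by have [[]] := d0.
have dcomp : diffeo_on U0 (l @^-1` V0) (l \o f) (g \o l).
  have [[oU0 _ sf0 sg0] [UV0 VU0 gf0 fg0]] := d0.
  split; split => //.
  - exact: (open_preimage_diffeo dl).
  - by apply: smooth_on_sub (smooth_on_comp oU0 sf0 openT sl) => q U0q; split.
  - by apply: smooth_on_sub (smooth_on_comp openT sl oV0 sg0) => q V0q; split.
  - by move=> q U0q; rewrite /l /= lK; exact: UV0.
  - by move=> q V0q; exact: VU0.
  - by move=> q U0q; rewrite /l /= lK; exact: gf0.
  - by move=> q V0q; rewrite /l /= fg0.
exists U0, (l @^-1` V0), (l \o f), (g \o l); split => // q [Uq Wq].
have [-> ->] := WE q Wq; have [fD f1 f2] := fE q Uq.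
have [lD l1 l2] := legendre_tangent (f q).
have onto (A : set 'rV[R]_(2 * n).+1) (B C : set 'rV[R]_(n + (1 + n))) :
    tangent_onto f q A B -> tangent_onto l (f q) B C ->
    tangent_onto (l \o f) q A C.
  move=> <- <-; rewrite /tangent_onto (tangent_map_comp oU sf sl Uq Logic.I).
  apply/seteqP; split=> [_ [v Av <-]|_ [_ [v Av <-] <-]].
    by rewrite mulmxA; exists (v *m tangent_map f q) => //; exists v.
  by rewrite -mulmxA; exists v.
split; [exact: onto fD lD|exact: onto f2 l2|exact: onto f1 l1].
Qed.

Lemma same_pair_bi_decomposing U W E1 E2 F1 F2 (w1 w2 : dform M n) :
  same_pair W E1 E2 F1 F2 -> bi_decomposing U E1 E2 w1 w2 ->
  bi_decomposing (U `&` W) F1 F2 w1 w2.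
Proof.
move=> sp [s1 s2 bd]; split.
- exact: smooth_form_sub (@subIsetl _ _ _) s1.
- exact: smooth_form_sub (@subIsetl _ _ _) s2.
move=> q [Uq Wq]; have [z1 z2 v1 v2] := bd q Uq.
rewrite /volume_on; have [-> ->] := sp q Wq.
by split.
Qed.

Lemma bi_decomposing_swap U E1 E2 (w1 w2 : dform M n) :
  bi_decomposing U E1 E2 w1 w2 -> bi_decomposing U E2 E1 w2 w1.
Proof.
move=> [s1 s2 bd]; split => // q Uq.
by have [z1 z2 v1 v2] := bd q Uq; split.
Qed.

Lemma local_generator_sub U W t (w : dform M n) : open W ->
  local_generator D I U t w -> local_generator D I (U `&` W) t w.
Proof.
move=> oW [[oU st DE nd] sw gU]; split.
- split.
  + exact: openI.
  + exact: smooth_form_sub (@subIsetl _ _ _) st.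
  + by move=> q [Uq _]; exact: DE.
  + by move=> q u [Uq _]; exact: nd.
- exact: smooth_form_sub (@subIsetl _ _ _) sw.
- exact: generated_on_sub (@subIsetl _ _ _) gU.
Qed.

Lemma zero_mod_sub U W t (b : dform M n.+1) :
  zero_mod U t b -> zero_mod (U `&` W) t b.
Proof.
move=> [c sc bc]; exists c; first exact: smooth_form_sub (@subIsetl _ _ _) sc.
by move=> q v [Uq _]; exact: bc.
Qed.

Lemma hesse_pair_independent E1 E2 F1 F2 :
  monge_ampere_pair D I F1 F2 -> hesse_pair D I E1 E2 -> hesse_pair D I F1 F2.
Proof.
move=> mF [mE fl]; split=> //; apply: flat_local fl => p.
exact: pair_locally.
Qed.

Lemma euler_lagrange_pair_independent E1 E2 F1 F2 :
  monge_ampere_pair D I F1 F2 -> euler_lagrange_pair D I E1 E2 ->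
  euler_lagrange_pair D I F1 F2.
Proof.
move=> mF [hE loc]; have [mE _] := hE.
split; first exact: (hesse_pair_independent mF hE).
move=> p; have [W [oW Wp WE]] := pair_locally p mE mF.
have [U [t [w1 [w2 [Up lg bd z1 z2]]]]] := loc p.
case: WE => WE.
  exists (U `&` W), t, w1, w2; split.
  - by [].
  - exact: local_generator_sub.
  - exact: same_pair_bi_decomposing bd.
  - exact: zero_mod_sub.
  - exact: zero_mod_sub.
(* For the exchanged pair the bi-decomposable form is w2 - w1; the two closedness conditions merely
   change places. *)
have [s1 s2 _] := bd; have [ct sw gU] := lg; have [oU _ _ _] := ct.
have lg' : local_generator D I U t (sub_form w2 w1).
  split=> //; first exact: smooth_form_sub_form.
  exact: generated_on_opp.
exists (U `&` W), t, w2, w1; split.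
- by [].
- exact: local_generator_sub.
- exact: same_pair_bi_decomposing (bi_decomposing_swap bd).
- exact: zero_mod_sub.
- exact: zero_mod_sub.
Qed.

End Independence.

Theorem proposition6p8 (R : realType) (n : nat) (hn : (3 <= n)%N) :
  (forall (M : manifold R (2 * n).+1) (D : plane_field M) (I : form_sheaf M)
      (E1 E2 E1' E2' : plane_field M),
    contact_structure D ->
    monge_ampere_pair D I E1 E2 -> monge_ampere_pair D I E1' E2' ->
    (hesse_pair D I E1 E2 <-> hesse_pair D I E1' E2') /\
    (euler_lagrange_pair D I E1 E2 <-> euler_lagrange_pair D I E1' E2')) /\
  (forall (M M' : manifold R (2 * n).+1)
      (D : plane_field M) (D' : plane_field M') (I : form_sheaf M)
      (Phi : M -> M') (PhiV : M' -> M),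
    contact_structure D -> contact_structure D' ->
    contactomorphism D D' Phi PhiV ->
    (hesse D I -> hesse D' (transport Phi PhiV I)) /\
    (euler_lagrange D I -> euler_lagrange D' (transport Phi PhiV I))).
Proof.
split=> [M D I E1 E2 E1' E2' _ mE mE'|M M' D D' I Phi PhiV _ _ cPhi].
  split; split.
  - exact: hesse_pair_independent.
  - exact: hesse_pair_independent.
  - exact: euler_lagrange_pair_independent.
  - exact: euler_lagrange_pair_independent.
split; first exact: hesse_transport.
exact: euler_lagrange_transport.
Qed.
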